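(* Let $k\ge3$. The following formulas define a linear action of the parabolic Lie subalgebra $\mathfrak{p}_k\subset\mathfrak{g}_k$ on the Sullivan minimal model $M(\mathcal{T}^kS^4)$, i.e. a Lie algebra homomorphism $\mathfrak{p}_k\to\mathrm{Der}\,M(\mathcal{T}^kS^4)$ (with image in linear derivations). For the generator $e_k$: $$e_kg_4=e_kg_7=e_ks_ig_4=e_ks_ig_7=e_ks_is_jg_7=e_ks_1s_2s_3g_4=0\quad(i,j\in\{1,2,3\}),$$ $$e_kw_i=0\quad(1\le i\le k),\qquad e_ks_is_jg_4=\mathrm{sgn}\begin{pmatrix}1&2&3\\i&j&l\end{pmatrix}w_l\quad(\{i,j,l\}=\{1,2,3\}),$$ $$e_ks_1s_2s_3g_7=g_4,\qquad [e_k,s_i]=0\quad(4\le i\le k).$$ For $h\in\mathfrak{h}_k$ and $1\le i\le k$: $$hg_4=-\varepsilon_0(h)g_4,\quad hg_7=-2\varepsilon_0(h)g_7,\quad[h,s_i]=\varepsilon_i(h)s_i,\quad hw_i=-\varepsilon_i(h)w_i.$$ For $1\le i\le k-1$ and $1\le j\le k$: $$e_ig_4=e_ig_7=0,\quad e_iw_j=\delta_{ij}w_{i+1},\quad[e_i,s_j]=-\delta_{i+1,j}s_i,$$ $$f_ig_4=f_ig_7=0,\quad f_iw_j=\delta_{i+1,j}w_i,\quad[f_i,s_j]=-\delta_{ij}s_{i+1}.$$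
   Context: **The algebra $M(\mathcal{T}^kS^4)$.** $\mathcal{T}^kS^4=\mathrm{Map}^0(T^k,S^4)\times_{T^k}ET^k$ is the toroidification of $S^4$ ($\mathrm{Map}^0$ = path component of the constant map). Its real Sullivan minimal model $M(\mathcal{T}^kS^4)$ is the free graded commutative $\mathbb{R}$-algebra on generators $$s_{i_1}\cdots s_{i_p}g_4\ (0\le p\le3,\ 1\le i_1<\dots<i_p\le k),\quad s_{j_1}\cdots s_{j_q}g_7\ (0\le q\le6,\ 1\le j_1<\dots<j_q\le k),\quad w_1,\dots,w_k,$$ with $|g_4|=4$, $|g_7|=7$, $|w_i|=2$, each $s_i$ lowering degree by $1$. The $s_i$ act as derivations of degree $-1$ with $s_is_j=-s_js_i$, $s_iw_j=0$, and $s_i$ of a generator set to $0$ when the result would have degree $\le0$. The differential $d$ (degree $+1$) is determined by $dg_4=\sum_{i=1}^kw_i\cdot s_ig_4$, $dg_7=-\tfrac12g_4^2+\sum_{i=1}^kw_i\cdot s_ig_7$, $dw_i=0$, $ds_i+s_id=0$. **The Lie algebras.** Let $\mathfrak{h}_k$ be the real vector space with basis $h_0,\dots,h_k$, and $\varepsilon_0,\dots,\varepsilon_k\in\mathfrak{h}_k^*$ the functionals with $\varepsilon_0(h_0)=-1$, $\varepsilon_i(h_i)=1$ for $1\le i\le k$, $\varepsilon_i(h_j)=0$ for $i\ne j$. Put $\alpha_i:=\varepsilon_i-\varepsilon_{i+1}$, $\alpha_i^\vee:=h_i-h_{i+1}$ for $1\le i\le k-1$, $\alpha_k:=\varepsilon_0-\varepsilon_1-\varepsilon_2-\varepsilon_3$,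 $\alpha_k^\vee:=h_0-h_1-h_2-h_3$, and $c_{ji}:=\alpha_i(\alpha_j^\vee)$ (the generalized Cartan matrix of type $E_k$). The real Lie algebra $\mathfrak{g}_k$ is generated by $e_1,\dots,e_k$, $f_1,\dots,f_k$ and the elements of $\mathfrak{h}_k$ with relations: $[h,h']=0$; $[h,e_i]=\alpha_i(h)e_i$; $[h,f_i]=-\alpha_i(h)f_i$ for $h,h'\in\mathfrak{h}_k$; $[e_i,f_j]=\delta_{ij}\alpha_i^\vee$; and for $i\ne j$, $\mathrm{ad}(e_i)^{1-c_{ij}}(e_j)=0$ and $\mathrm{ad}(f_i)^{1-c_{ij}}(f_j)=0$. The maximal parabolic subalgebra $\mathfrak{p}_k\subset\mathfrak{g}_k$ is the subalgebra generated by all these generators except $f_k$, i.e. by $\mathfrak{h}_k$, $e_1,\dots,e_k$, $f_1,\dots,f_{k-1}$. **Actions.** $\mathrm{Der}\,A$ for an augmented DGCA $(A,d,\epsilon)$ is the Lie algebra of degree-zero derivations of $A$ commuting with $d$ and compatible with the augmentation. A derivation of a free graded commutative algebra $S(V)$ is linear if it is induced by a linear map $V\to V$ (here $V$ is the span of the generators listed above); an action is linear if it is by linear derivations. In the formulas each Lie algebra generator $x$ acts as a degree-zero derivation and $[x,s_i]=xs_i-s_ix$ is the commutator of operators on $M(\mathcal{T}^kS^4)$; the formulas determine the action on all generators of $M(\mathcal{T}^kS^4)$. *)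

(* Defs.v *)
From HB Require Import structures.
From mathcomp Require Import all_boot all_order all_algebra perm generic_quotient.
From mathcomp Require Import boolp functions reals zify.

Set Implicit Arguments.
Unset Strict Implicit.
Unset Printing Implicit Defensive.

Import Order.TTheory GRing.Theory Num.Theory.
Local Open Scope ring_scope.
Local Open Scope quotient_scope.

(** * The free graded commutative algebra on a graded set of generators

  It is the quotient of the algebra terms over [G] by the least congruence
  containing the axioms of unital associative [R]-algebras and
  [x * y = (-1)^(|x||y|) y * x] for generators [x] and [y]; as 2 is invertible,
  odd generators square to 0. *)

Section FreeGradedCommutative.
Variables (R : realType) (G : Type) (deg : G -> nat).

Inductive gcterm : Type :=
| GCgen of G
| GCconst of R
| GCadd of gcterm & gcterm
| GCmul of gcterm & gcterm.

Inductive gceq : gcterm -> gcterm -> Prop :=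
| gceq_refl t : gceq t t
| gceq_sym t u : gceq t u -> gceq u t
| gceq_trans t u v : gceq t u -> gceq u v -> gceq t v
| gceq_add t t' u u' : gceq t t' -> gceq u u' ->
    gceq (GCadd t u) (GCadd t' u')
| gceq_mul t t' u u' : gceq t t' -> gceq u u' ->
    gceq (GCmul t u) (GCmul t' u')
| gceq_addA t u v : gceq (GCadd t (GCadd u v)) (GCadd (GCadd t u) v)
| gceq_addC t u : gceq (GCadd t u) (GCadd u t)
| gceq_add0 t : gceq (GCadd (GCconst 0) t) t
| gceq_mulA t u v : gceq (GCmul t (GCmul u v)) (GCmul (GCmul t u) v)
| gceq_mul1 t : gceq (GCmul (GCconst 1) t) t
| gceq_mul0 t : gceq (GCmul (GCconst 0) t) (GCconst 0)
| gceq_mulDl t u v : gceq (GCmul (GCadd t u) v) (GCadd (GCmul t v) (GCmul u v))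
| gceq_mulDr t u v : gceq (GCmul t (GCadd u v)) (GCadd (GCmul t u) (GCmul t v))
| gceq_constD c c' : gceq (GCconst (c + c')) (GCadd (GCconst c) (GCconst c'))
| gceq_constM c c' : gceq (GCconst (c * c')) (GCmul (GCconst c) (GCconst c'))
| gceq_constC c t : gceq (GCmul (GCconst c) t) (GCmul t (GCconst c))
| gceq_comm x y : gceq (GCmul (GCgen x) (GCgen y))
    (GCmul (GCconst ((-1) ^+ (deg x * deg y))) (GCmul (GCgen y) (GCgen x))).

HB.instance Definition _ := gen_eqMixin gcterm.
HB.instance Definition _ := gen_choiceMixin gcterm.

Definition gceqb (t u : gcterm) : bool := `[< gceq t u >].

Lemma gceqb_refl : reflexive gceqb.
Proof. by move=> t; apply/asboolP/gceq_refl. Qed.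

Lemma gceqb_sym : symmetric gceqb.
Proof. by move=> t u; apply/asboolP/asboolP => /gceq_sym. Qed.

Lemma gceqb_trans : transitive gceqb.
Proof.
by move=> u t v /asboolP tu /asboolP uv; apply/asboolP; exact: gceq_trans uv.
Qed.

Canonical gceq_equiv := EquivRel gceqb gceqb_refl gceqb_sym gceqb_trans.

Definition fgca : Type := {eq_quot gceq_equiv}.
HB.instance Definition _ := Choice.on fgca.
HB.instance Definition _ := EqQuotient.on fgca.

Local Notation pi := (\pi_fgca).

Lemma fgca_eq t u : gceq t u -> pi t = pi u.
Proof. by move=> tu; apply/eqmodP/asboolP. Qed.

Lemma fgca_eqP t u : pi t = pi u -> gceq t u.
Proof. by move/eqmodP/asboolP. Qed.

Lemma fgca_repr t : gceq (repr (pi t)) t.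
Proof. by apply: fgca_eqP; rewrite reprK. Qed.

Definition fgca_const (c : R) : fgca := pi (GCconst c).
Definition fgca_add (a b : fgca) : fgca := pi (GCadd (repr a) (repr b)).
Definition fgca_mul (a b : fgca) : fgca := pi (GCmul (repr a) (repr b)).
Definition fgca_opp (a : fgca) : fgca := fgca_mul (fgca_const (-1)) a.
Definition fgca_scale (c : R) (a : fgca) : fgca := fgca_mul (fgca_const c) a.
Definition gen (x : G) : fgca := pi (GCgen x).

Lemma pi_add t u : fgca_add (pi t) (pi u) = pi (GCadd t u).
Proof. by apply: fgca_eq; apply: gceq_add; apply: fgca_repr. Qed.

Lemma pi_mul t u : fgca_mul (pi t) (pi u) = pi (GCmul t u).
Proof. by apply: fgca_eq; apply: gceq_mul; apply: fgca_repr. Qed.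

Lemma fgca_addA : associative fgca_add.
Proof.
elim/quotW=> t; elim/quotW=> u; elim/quotW=> v.
by rewrite (pi_add u v) (pi_add t u) !pi_add; apply: fgca_eq; apply: gceq_addA.
Qed.

Lemma fgca_addC : commutative fgca_add.
Proof.
by elim/quotW=> t; elim/quotW=> u; rewrite !pi_add; apply: fgca_eq; apply: gceq_addC.
Qed.

Lemma fgca_add0 : left_id (fgca_const 0) fgca_add.
Proof. by elim/quotW=> t; rewrite pi_add; apply: fgca_eq; apply: gceq_add0. Qed.

Lemma fgca_mulA : associative fgca_mul.
Proof.
elim/quotW=> t; elim/quotW=> u; elim/quotW=> v.
by rewrite (pi_mul u v) (pi_mul t u) !pi_mul; apply: fgca_eq; apply: gceq_mulA.
Qed.

Lemma fgca_mul1 : left_id (fgca_const 1) fgca_mul.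
Proof. by elim/quotW=> t; rewrite pi_mul; apply: fgca_eq; apply: gceq_mul1. Qed.

Lemma fgca_constC c a : fgca_mul (fgca_const c) a = fgca_mul a (fgca_const c).
Proof. by elim/quotW: a => t; rewrite !pi_mul; apply: fgca_eq; apply: gceq_constC. Qed.

Lemma fgca_mulr1 : right_id (fgca_const 1) fgca_mul.
Proof. by move=> a; rewrite -fgca_constC fgca_mul1. Qed.

Lemma fgca_mulDl : left_distributive fgca_mul fgca_add.
Proof.
elim/quotW=> t; elim/quotW=> u; elim/quotW=> v.
rewrite (pi_add t u) (pi_mul t v) (pi_mul u v) pi_add pi_mul.
by apply: fgca_eq; apply: gceq_mulDl.
Qed.

Lemma fgca_mulDr : right_distributive fgca_mul fgca_add.
Proof.
elim/quotW=> t; elim/quotW=> u; elim/quotW=> v.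
rewrite (pi_add u v) (pi_mul t u) (pi_mul t v) pi_add pi_mul.
by apply: fgca_eq; apply: gceq_mulDr.
Qed.

Lemma fgca_constD c c' :
  fgca_const (c + c') = fgca_add (fgca_const c) (fgca_const c').
Proof. by rewrite pi_add; apply: fgca_eq; apply: gceq_constD. Qed.

Lemma fgca_constM c c' :
  fgca_const (c * c') = fgca_mul (fgca_const c) (fgca_const c').
Proof. by rewrite pi_mul; apply: fgca_eq; apply: gceq_constM. Qed.

Lemma fgca_mul0 a : fgca_mul (fgca_const 0) a = fgca_const 0.
Proof. by elim/quotW: a => t; rewrite pi_mul; apply: fgca_eq; apply: gceq_mul0. Qed.

Lemma fgca_addN : left_inverse (fgca_const 0) fgca_opp fgca_add.
Proof.
move=> a; rewrite -[X in fgca_add _ X]fgca_mul1 -fgca_mulDl -fgca_constD.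
by rewrite addNr fgca_mul0.
Qed.

HB.instance Definition _ :=
  GRing.isZmodule.Build fgca fgca_addA fgca_addC fgca_add0 fgca_addN.

(* The augmentation, on terms: generators are sent to 0. *)
Fixpoint augt (t : gcterm) : R :=
  match t with
  | GCgen _ => 0
  | GCconst c => c
  | GCadd t u => augt t + augt u
  | GCmul t u => augt t * augt u
  end.

Lemma augt_eq t u : gceq t u -> augt t = augt u.
Proof.
elim=> //=.
- by move=> ??? _ -> _ ->.
- by move=> ???? _ -> _ ->.
- by move=> ???? _ -> _ ->.
- by move=> *; rewrite addrA.
- by move=> *; rewrite addrC.
- by move=> *; rewrite add0r.
- by move=> *; rewrite mulrA.
- by move=> *; rewrite mul1r.
- by move=> *; rewrite mul0r.
- by move=> *; rewrite mulrDl.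
- by move=> *; rewrite mulrDr.
- by move=> *; rewrite mulrC.
- by move=> *; rewrite !mulr0.
Qed.

Definition aug (a : fgca) : R := augt (repr a).

Lemma aug_pi t : aug (pi t) = augt t.
Proof. exact/augt_eq/fgca_repr. Qed.

Lemma fgca_const1_neq0 : fgca_const 1 != 0.
Proof.
apply/eqP => /(congr1 aug); rewrite /fgca_const !aug_pi /= => /eqP.
by rewrite oner_eq0.
Qed.

HB.instance Definition _ := GRing.Zmodule_isNzRing.Build fgca
  fgca_mulA fgca_mul1 fgca_mulr1 fgca_mulDl fgca_mulDr fgca_const1_neq0.

Lemma fgca_scaleA c c' a :
  fgca_scale c (fgca_scale c' a) = fgca_scale (c * c') a.
Proof. by rewrite /fgca_scale fgca_constM fgca_mulA. Qed.

Lemma fgca_scaleDr : right_distributive fgca_scale +%R.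
Proof. by move=> c a b; exact: fgca_mulDr. Qed.

Lemma fgca_scaleDl a : {morph fgca_scale^~ a : c c' / c + c'}.
Proof. by move=> c c'; rewrite /fgca_scale fgca_constD fgca_mulDl. Qed.

HB.instance Definition _ := GRing.Zmodule_isLmodule.Build R fgca
  fgca_scaleA fgca_mul1 fgca_scaleDr fgca_scaleDl.

Lemma fgca_scaleAl (c : R) (a b : fgca) : c *: (a * b) = c *: a * b.
Proof. exact: fgca_mulA. Qed.

HB.instance Definition _ := GRing.Lmodule_isLalgebra.Build R fgca fgca_scaleAl.

Lemma fgca_scaleAr (c : R) (a b : fgca) : c *: (a * b) = a * (c *: b).
Proof.
rewrite [LHS]fgca_mulA [X in fgca_mul X _]fgca_constC.
by rewrite [RHS]fgca_mulA.
Qed.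

HB.instance Definition _ := GRing.Lalgebra_isAlgebra.Build R fgca fgca_scaleAr.

Lemma fgca_piD t u : pi (GCadd t u) = pi t + pi u.
Proof. by rewrite -pi_add. Qed.

Lemma fgca_piM t u : pi (GCmul t u) = pi t * pi u.
Proof. by rewrite -pi_mul. Qed.

Lemma fgca_piC c : pi (GCconst c) = c%:A.
Proof. by rewrite -[RHS]/(fgca_mul _ _) fgca_mulr1. Qed.

Lemma fgca_pi0 : 0 = pi (GCconst 0). Proof. by []. Qed.

Lemma fgca_pi1 : 1 = pi (GCconst 1). Proof. by []. Qed.

Lemma fgca_piZ c t : pi (GCmul (GCconst c) t) = c *: pi t.
Proof. by rewrite fgca_piM fgca_piC mulr_algl. Qed.

Lemma gen_comm x y : gen x * gen y = (-1) ^+ (deg x * deg y) *: (gen y * gen x).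
Proof.
rewrite /gen -fgca_piM (fgca_eq (gceq_comm x y)) fgca_piM fgca_piC.
by rewrite fgca_piM -scalerAl mul1r.
Qed.

(* [homog n] is the homogeneous component of degree [n]. *)
Inductive homog : int -> fgca -> Prop :=
| homog0 n : homog n 0
| homogD n a b : homog n a -> homog n b -> homog n (a + b)
| homogZ n c a : homog n a -> homog n (c *: a)
| homog1 : homog 0 1
| homog_gen x : homog (deg x)%:Z (gen x)
| homogM m n a b : homog m a -> homog n b -> homog (m + n) (a * b).

Definition gderivation (p : int) (D : fgca -> fgca) : Prop :=
  [/\ linear D,
      forall n a, homog n a -> homog (n + p) (D a) &
      forall n a b, homog n a ->
        D (a * b) = D a * b + (-1) ^+ (`|p| * `|n|)%N *: (a * D b)].

(* [dext p v] is the derivation of degree [p] whose value at each generator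
  [x] is [v x], which must be homogeneous of degree [deg x + p]: see lemmas
  [dext_gen] and [dext_gderivation]. *)
Fixpoint gctwist (p : int) (t : gcterm) : gcterm :=
  match t with
  | GCgen x => GCmul (GCconst ((-1) ^+ (`|p| * deg x)%N)) (GCgen x)
  | GCconst c => GCconst c
  | GCadd t u => GCadd (gctwist p t) (gctwist p u)
  | GCmul t u => GCmul (gctwist p t) (gctwist p u)
  end.

Fixpoint dext_term (p : int) (v : G -> fgca) (t : gcterm) : fgca :=
  match t with
  | GCgen x => v x
  | GCconst _ => 0
  | GCadd t u => dext_term p v t + dext_term p v u
  | GCmul t u => dext_term p v t * pi u + pi (gctwist p t) * dext_term p v u
  end.

Definition dext (p : int) (v : G -> fgca) (a : fgca) : fgca :=
  dext_term p v (repr a).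

Lemma sgnC (m n : nat) (a b : fgca) :
  a * ((-1) ^+ m *: b) = (-1) ^+ m *: (a * b).
Proof. by rewrite scalerAr. Qed.

Lemma odd_abszD (m n : int) : odd (absz (m + n)) = odd (absz m) (+) odd (absz n).
Proof.
lia.
Qed.

Lemma sgn_abszD (m n : int) (p : nat) :
  (-1) ^+ (p * absz (m + n)%R)%N = (-1) ^+ (p * `|m|)%N * (-1) ^+ (p * `|n|)%N :> R.
Proof.
rewrite -exprD -mulnDr -[LHS]signr_odd -[RHS]signr_odd !oddM.
by rewrite odd_abszD oddD.
Qed.

Lemma homog_comm m n a b : homog m a -> homog n b ->
  a * b = (-1) ^+ (`|m| * `|n|)%N *: (b * a).
Proof.
have sg2 p : (-1) ^+ p * (-1) ^+ p = 1 :> R.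
  by rewrite -exprD addnn -muln2 mulnC exprM sqrrN !expr1n.
elim=> {m a}.
- by move=> *; rewrite mulr0 mul0r scaler0.
- by move=> m a b' _ Ia _ Ib hb; rewrite mulrDl mulrDr scalerDr Ia// Ib.
- move=> m c a _ Ia hb.
  by rewrite -scalerAl Ia// -scalerAr !scalerA mulrC.
- by rewrite mul0n scale1r mul1r mulr1.
- move=> x; elim=> {n b}.
  + by move=> *; rewrite mulr0 mul0r scaler0.
  + by move=> m a b' _ Ia _ Ib; rewrite mulrDl mulrDr scalerDr Ia// Ib.
  + move=> m c a _ Ia.
    by rewrite -scalerAl -scalerAr Ia// !scalerA mulrC.
  + by rewrite muln0 scale1r mul1r mulr1.
  + by move=> y; rewrite gen_comm.
  + move=> m n a b _ Ia _ Ib.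
    rewrite mulrA Ia -scalerAl -[a * gen x * b]mulrA Ib -scalerAr scalerA mulrA.
    by rewrite sgn_abszD.
- move=> m m' a a' _ Ia _ Ia' hb.
  rewrite -[a * a' * b]mulrA Ia'// -scalerAr [a * (b * a')]mulrA Ia//.
  rewrite -scalerAl scalerA -[b * a * a']mulrA.
  by congr (_ *: _); rewrite ![(_ * `|n|)%N]mulnC sgn_abszD mulrC.
Qed.

Section DerivationExtension.
Variables (p : int) (v : G -> fgca).
Hypothesis v_homog : forall x, homog ((deg x)%:Z + p) (v x).

Lemma pi_twist t u : gceq t u -> pi (gctwist p t) = pi (gctwist p u).
Proof.
elim=> //=.
- by move=> ??? _ -> _ ->.
- by move=> ???? _ E _ E'; rewrite !fgca_piD E E'.
- by move=> ???? _ E _ E'; rewrite !fgca_piM E E'.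
- by move=> *; rewrite !fgca_piD addrA.
- by move=> *; rewrite !fgca_piD addrC.
- by move=> *; rewrite !fgca_piD fgca_piC scale0r add0r.
- by move=> *; rewrite !fgca_piM mulrA.
- by move=> *; rewrite !fgca_piM fgca_piC scale1r mul1r.
- by move=> *; rewrite !fgca_piM fgca_piC scale0r mul0r.
- by move=> *; rewrite !(fgca_piD, fgca_piM) mulrDl.
- by move=> *; rewrite !(fgca_piD, fgca_piM) mulrDr.
- by move=> *; rewrite !(fgca_piD, fgca_piM, fgca_piC) scalerDl.
- by move=> *; rewrite !(fgca_piM, fgca_piC) -scalerAl mul1r scalerA.
- by move=> *; rewrite !(fgca_piM, fgca_piC) -scalerAl -scalerAr mul1r mulr1.
- move=> x y; rewrite !(fgca_piM, fgca_piC) !mulr_algl -!/(gen _).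
  rewrite -!scalerAl -!scalerAr gen_comm !scalerA.
  by apply: (congr1 (fun c => c *: _)); rewrite mulrC mulrA mulrAC.
Qed.

Lemma twist_homog n a : homog n a ->
  pi (gctwist p (repr a)) = (-1) ^+ (`|p| * `|n|)%N *: a.
Proof.
have tw t : pi (gctwist p (repr (pi t))) = pi (gctwist p t).
  exact/pi_twist/fgca_repr.
elim=> {n a}.
- by move=> n; rewrite scaler0 {1}fgca_pi0 tw.
- move=> n a b _ Ia _ Ib; rewrite scalerDr -Ia -Ib.
  by elim/quotW: a {Ia} => t; elim/quotW: b {Ib} => u; rewrite -fgca_piD !tw -fgca_piD.
- move=> n c a _ Ia; rewrite scalerA mulrC -scalerA -Ia.
  elim/quotW: a {Ia} => t; by rewrite -(fgca_piZ c t) !tw /= fgca_piZ.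
- by rewrite muln0 scale1r {1}fgca_pi1 tw.
- by move=> x; rewrite tw /= fgca_piZ.
- move=> m n a b _ Ia _ Ib; rewrite sgn_abszD -scalerA.
  rewrite [X in _ *: X]scalerAr scalerAl -Ia -Ib.
  by elim/quotW: a {Ia} => t; elim/quotW: b {Ib} => u; rewrite -fgca_piM !tw -fgca_piM.
Qed.

Lemma dext_term_eq t u : gceq t u -> dext_term p v t = dext_term p v u.
Proof.
elim=> //=.
- by move=> ??? _ -> _ ->.
- by move=> ???? _ -> _ ->.
- move=> ???? e E e' E'.
  by rewrite (fgca_eq e') E E' (pi_twist e).
- by move=> *; rewrite addrA.
- by move=> *; rewrite addrC.
- by move=> *; rewrite add0r.
- by move=> *; rewrite !fgca_piM mulrDl mulrDr !mulrA addrA.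
- by move=> *; rewrite fgca_piC scale1r mul0r add0r mul1r.
- by move=> *; rewrite fgca_piC scale0r !mul0r addr0.
- by move=> *; rewrite !fgca_piD !mulrDl addrACA.
- by move=> *; rewrite !fgca_piD !mulrDr addrACA.
- by move=> *; rewrite addr0.
- by move=> *; rewrite mul0r mulr0 addr0.
- move=> *; rewrite mul0r mulr0 add0r addr0 fgca_piC.
  by rewrite -scalerAl -scalerAr mul1r mulr1.
- move=> x y; rewrite !(fgca_piM, fgca_piC) !mul0r !add0r !mulr_algl -!/(gen _).
  rewrite -!scalerAl.
  rewrite (homog_comm (v_homog x) (homog_gen y)).
  rewrite (homog_comm (homog_gen x) (v_homog y)) !scalerA scalerDr !scalerA addrC.
  rewrite !absz_nat [(absz (_ + p)%R * _)%N]mulnC !sgn_abszD !absz_nat.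
  have sg2 q : (-1) ^+ q * (-1) ^+ q = 1 :> R.
    by rewrite -exprD addnn -muln2 mulnC exprM sqrrN !expr1n.
  congr (_ *: _ + _ *: _); last by rewrite [(deg y * deg x)%N]mulnC [(deg y * _)%N]mulnC.
  by rewrite [(_ * `|p|)%N]mulnC mulrCA sg2 mulr1.
Qed.

Lemma dext_pi t : dext p v (pi t) = dext_term p v t.
Proof. exact/dext_term_eq/fgca_repr. Qed.

Lemma dext_gen x : dext p v (gen x) = v x.
Proof. exact: dext_pi. Qed.

Lemma dext_linear : linear (dext p v).
Proof.
move=> c a b; elim/quotW: a => t; elim/quotW: b => u.
by rewrite -fgca_piZ -fgca_piD !dext_pi /= mul0r add0r fgca_piC mulr_algl.
Qed.

Lemma dext_leibniz n a b : homog n a -> dext p v (a * b) =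
  dext p v a * b + (-1) ^+ (`|p| * `|n|)%N *: (a * dext p v b).
Proof.
move=> /twist_homog; rewrite scalerAl => <-.
elim/quotW: a => t; elim/quotW: b => u.
rewrite -fgca_piM !dext_pi /=; congr (_ + _ * _).
exact/esym/pi_twist/fgca_repr.
Qed.

Lemma dext_homog n a : homog n a -> homog (n + p) (dext p v a).
Proof.
have D0 : dext p v 0 = 0 by exact: dext_pi.
have DD a' b' : dext p v (a' + b') = dext p v a' + dext p v b'.
  by rewrite -[X in X + b']scale1r dext_linear scale1r.
elim=> {n a}.
- by move=> n; rewrite D0; apply: homog0.
- by move=> n a b _ Ia _ Ib; rewrite DD; apply: homogD.
- move=> n c a _ Ia; rewrite -[_ *: _]addr0 dext_linear D0 addr0.
  exact: homogZ.
- by rewrite fgca_pi1 dext_pi /=; apply: homog0.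
- by move=> x; rewrite dext_gen.
- move=> m n a b ha Ia hb Ib; rewrite (dext_leibniz _ ha); apply: homogD.
    by rewrite addrAC; apply: homogM.
  by apply: homogZ; rewrite -addrA; apply: homogM.
Qed.

Lemma dext_gderivation : gderivation p (dext p v).
Proof.
by split; [exact: dext_linear | exact: dext_homog | exact: dext_leibniz].
Qed.

End DerivationExtension.

End FreeGradedCommutative.

Section DerivationTheory.
Variables (R : realType) (G : Type) (deg : G -> nat).
Local Notation M := (fgca R deg).
Local Notation gen := (gen R deg).
Local Notation homog := (@homog R G deg).
Implicit Types (p q n : int) (a b : M) (D E : M -> M).

Lemma fgca_ind (P : M -> Prop) :
    (forall a b, P a -> P b -> P (a + b)) -> (forall c a, P a -> P (c *: a)) ->
    P 1 -> (forall x a, P a -> P (gen x * a)) ->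
  forall a, P a.
Proof.
move=> PD PZ P1 PM a; suff Q : forall t b, P b -> P (\pi_(fgca R deg) t * b).
  by elim/quotW: a => t; rewrite -[\pi t]mulr1; apply: Q.
elim=> [x|c|t It u Iu|t It u Iu] b Pb.
- exact: PM.
- by rewrite fgca_piC mulr_algl; apply: PZ.
- by rewrite fgca_piD mulrDl; apply: PD; [apply: It | apply: Iu].
- by rewrite fgca_piM -mulrA; apply: It; apply: Iu.
Qed.

Lemma homog_lt0 n a : homog n a -> n < 0 -> a = 0.
Proof.
elim=> {n a}//.
- by move=> n a b _ Ia _ Ib n0; rewrite Ia// Ib// addr0.
- by move=> n c a _ Ia n0; rewrite Ia// scaler0.
- move=> m n a b _ Ia _ Ib mn0; have [m0|m0] := ltP m 0.
    by rewrite Ia// mul0r.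
  by rewrite Ib ?mulr0//; lia.
Qed.

Section Linear.
Variables (p : int) (D : M -> M).
Hypothesis gD : gderivation p D.

Lemma gderD a b : D (a + b) = D a + D b.
Proof. by case: gD => L _ _; rewrite -[X in X + b]scale1r L scale1r. Qed.

Lemma gder0 : D 0 = 0.
Proof. by apply: (addIr (D 0)); rewrite -gderD !add0r. Qed.

Lemma gderZ c a : D (c *: a) = c *: D a.
Proof. by case: gD => L _ _; rewrite -[_ *: a]addr0 L gder0 addr0. Qed.

Lemma gderN a : D (- a) = - D a.
Proof. by rewrite -scaleN1r gderZ scaleN1r. Qed.

Lemma gder_sum I (r : seq I) (P : pred I) (F : I -> M) :
  D (\sum_(i <- r | P i) F i) = \sum_(i <- r | P i) D (F i).
Proof. exact: (big_morph D gderD gder0). Qed.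

Lemma gder1 : D 1 = 0.
Proof.
case: gD => _ _ L; have := L 0 1 1 (@homog1 _ _ _).
rewrite muln0 expr0 scale1r !mul1r mulr1 => /eqP.
by rewrite -subr_eq0 opprD addNKr oppr_eq0 => /eqP.
Qed.

Lemma gder_eq0 : (forall x, D (gen x) = 0) -> forall a, D a = 0.
Proof.
move=> D0; apply: fgca_ind.
- by move=> a b Da Db; rewrite gderD Da Db addr0.
- by move=> c a Da; rewrite gderZ Da scaler0.
- exact: gder1.
- move=> x a Da; case: gD => _ _ L.
  by rewrite (L _ _ _ (homog_gen R deg x)) D0 Da mul0r mulr0 scaler0 addr0.
Qed.

End Linear.

Lemma zmod_cancel (V : zmodType) (x y z t u v : V) :
  x - y + (z + t) + (u - z + (y + v)) = x + u + (t + v).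
Proof.
rewrite addrACA [x - y + _]addrACA [z + t + _]addrACA -opprD [y + z]addrC.
by rewrite addrA subrK.
Qed.

Lemma zmod_cancel2 (V : zmodType) (x y z t u v : V) :
  x + y + (z + t) - (u + z + (y + v)) = x - u + (t - v).
Proof.
rewrite [u + z + _]addrACA opprD addrACA !opprD.
by rewrite [x + y + _]addrACA [z + t + _]addrACA !subrr addr0 add0r.
Qed.

Lemma zmod_cancel6 (V : zmodType) (x1 x2 x3 x4 x5 x6 : V) :
  x1 - x2 - (x3 - x4) + (x3 - x5 - (x6 - x2)) + (x6 - x4 - (x1 - x5)) = 0.
Proof.
rewrite !opprB (AC (2*2*2) (1*4*5*2*3*6)) /= !addrA !subrK.
by rewrite subrr.
Qed.

(* The graded commutator of two odd derivations is a derivation. *)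
Lemma gder_anticomm p q D E : odd `|p| -> odd `|q| ->
  gderivation p D -> gderivation q E ->
  gderivation (p + q) (fun a => D (E a) + E (D a)).
Proof.
move=> op oq gD gE; have [_ hD LD] := gD; have [_ hE LE] := gE.
have opq : odd (absz (p + q)) = false by rewrite odd_abszD op oq.
split.
- move=> c a b; rewrite !(gderD gD, gderD gE, gderZ gD, gderZ gE) scalerDr.
  by rewrite addrACA.
- move=> n a ha; apply: homogD.
    by rewrite addrA addrAC; apply/hD/hE.
  by rewrite addrA; apply/hE/hD.
- move=> n a b ha; rewrite (LE _ _ _ ha) (LD _ _ _ ha).
  rewrite !(gderD gD, gderD gE, gderZ gD, gderZ gE).
  rewrite (LD _ _ _ ha) (LE _ _ _ ha) (LD _ _ _ (hE _ _ ha)) (LE _ _ _ (hD _ _ ha)).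
  have sp : (-1) ^+ (`|p| * `|n|) = (-1) ^+ odd `|n| :> R.
    by rewrite -signr_odd oddM op.
  have sq : (-1) ^+ (`|q| * `|n|) = (-1) ^+ odd `|n| :> R.
    by rewrite -signr_odd oddM oq.
  have spq : (-1) ^+ (absz (p + q) * `|n|) = 1 :> R.
    by rewrite -signr_odd oddM opq.
  have sp' : (-1) ^+ (`|p| * absz (n + q)%R) = - (-1) ^+ odd `|n| :> R.
    by rewrite -signr_odd oddM op odd_abszD oq addbT /= signrN.
  have sq' : (-1) ^+ (`|q| * absz (n + p)%R) = - (-1) ^+ odd `|n| :> R.
    by rewrite -signr_odd oddM oq odd_abszD op addbT /= signrN.
  rewrite sp sq spq sp' sq' !scalerDr !scalerA -expr2 sqrr_sign !scale1r !scaleNr.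
  by rewrite mulrDl mulrDr zmod_cancel.
Qed.

End DerivationTheory.

(** * The minimal model of the toroidification of the 4-sphere

  Indices are shifted: [i : 'I_k] stands for the index [i.+1] of [s] and [w]. *)

(* The generators [s_I g_4], [s_J g_7] and [w_i]; a subset of ['I_k] stands for
  the increasing product of the [s_i] it indexes. *)
Definition tgen (k : nat) : Type :=
  {I : {set 'I_k} | (#|I| <= 3)%N} + {J : {set 'I_k} | (#|J| <= 6)%N} + 'I_k.
HB.instance Definition _ k := Finite.on (tgen k).

Definition tdeg (k : nat) (x : tgen k) : nat :=
  match x with
  | inl (inl A) => 4 - #|val A|
  | inl (inr B) => 7 - #|val B|
  | inr _ => 2
  end.

Notation tmodel R k := (fgca R (@tdeg k)).

Section ToroidificationModel.
Variables (R : realType) (k : nat).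

Local Notation tmodel := (tmodel R k).
Local Notation tgen := (tgen k).

Implicit Types (i j : 'I_k) (I J : {set 'I_k}) (a b : tmodel).

Definition tvar (x : tgen) : tmodel := gen R (@tdeg k) x.

Definition sg4 I : tmodel := oapp (fun u => tvar (inl (inl u))) 0 (insub I).
Definition sg7 J : tmodel := oapp (fun u => tvar (inl (inr u))) 0 (insub J).
Definition g4 : tmodel := sg4 set0.
Definition g7 : tmodel := sg7 set0.
Definition w_gen i : tmodel := tvar (inr i).

(* The sign of the permutation sorting [i] into the increasing sequence [I]. *)
Definition ssign i I : R := (-1) ^+ #|[set j in I | (j < i)%N]|.

Definition s_gen i (x : tgen) : tmodel :=
  match x with
  | inl (inl A) => if i \in val A then 0 else ssign i (val A) *: sg4 (i |: val A)
  | inl (inr B) => if i \in val B then 0 else ssign i (val B) *: sg7 (i |: val B)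
  | inr _ => 0
  end.

Definition s_op i : tmodel -> tmodel := dext (-1) (s_gen i).

(* [sI [:: i_1; ...; i_p]] is the operator [s_(i_1) o ... o s_(i_p)]. *)
Definition sI (r : seq 'I_k) a : tmodel := foldr s_op a r.

Definition dg4 : tmodel := \sum_i w_gen i * s_op i g4.
Definition dg7 : tmodel := - (2^-1 *: (g4 * g4)) + \sum_i w_gen i * s_op i g7.

(* The values on generators forced by [d s_i + s_i d_op = 0]. *)
Definition d_gen (x : tgen) : tmodel :=
  match x with
  | inl (inl A) => (-1) ^+ #|val A| *: sI (enum (val A)) dg4
  | inl (inr B) => (-1) ^+ #|val B| *: sI (enum (val B)) dg7
  | inr _ => 0
  end.

Definition d_op : tmodel -> tmodel := dext 1 d_gen.


(** ** Characterization of [s_i] and [d] *)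

Lemma homog_sg4 I : homog (4 - #|I|%:Z) (sg4 I).
Proof.
rewrite /sg4; case: insubP => [u uI <-|_]; last exact: homog0.
have -> : 4 - #|val u|%:Z = @tdeg k (inl (inl u)) :> int.
  by rewrite /= -subzn //; apply: leq_trans (valP u) _.
exact: (homog_gen R (@tdeg k)).
Qed.

Lemma homog_sg7 J : homog (7 - #|J|%:Z) (sg7 J).
Proof.
rewrite /sg7; case: insubP => [u uI <-|_]; last exact: homog0.
have -> : 7 - #|val u|%:Z = @tdeg k (inl (inr u)) :> int.
  by rewrite /= -subzn //; apply: leq_trans (valP u) _.
exact: (homog_gen R (@tdeg k)).
Qed.

Lemma homog_w i : homog 2 (w_gen i).
Proof. exact: (homog_gen R (@tdeg k) (inr i)). Qed.

Lemma sg4_big I : (3 < #|I|)%N -> sg4 I = 0.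
Proof. by move=> I3; rewrite /sg4 insubF// leqNgt I3. Qed.

Lemma sg7_big J : (6 < #|J|)%N -> sg7 J = 0.
Proof. by move=> J6; rewrite /sg7 insubF// leqNgt J6. Qed.

Lemma homog_s_gen i x : homog ((tdeg x)%:Z + -1) (s_gen i x).
Proof.
case: x => [[A|B]|j] /=; last exact: homog0.
- case: ifPn => iA; first exact: homog0.
  apply: homogZ; have := homog_sg4 (i |: val A); rewrite cardsU1 iA.
  by rewrite -subzn ?(leq_trans (valP A))// PoszD opprD addrA addrAC.
- case: ifPn => iB; first exact: homog0.
  apply: homogZ; have := homog_sg7 (i |: val B); rewrite cardsU1 iB.
  by rewrite -subzn ?(leq_trans (valP B))// PoszD opprD addrA addrAC.
Qed.

Lemma s_gderivation i : gderivation (-1) (s_op i).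
Proof. exact/dext_gderivation/homog_s_gen. Qed.

Lemma s_w i j : s_op i (w_gen j) = 0.
Proof. exact/dext_gen/homog_s_gen. Qed.

Lemma s_sg4 i I :
  s_op i (sg4 I) = if i \in I then 0 else ssign i I *: sg4 (i |: I).
Proof.
rewrite {1}/sg4; case: insubP => [u uI <-|I3] /=.
  by rewrite [LHS]dext_gen//; exact: homog_s_gen.
rewrite (gder0 (s_gderivation i)); case: ifPn => // iI.
by rewrite sg4_big ?scaler0// cardsU1 iI ltnS ltnW// ltnNge.
Qed.

Lemma s_sg7 i J :
  s_op i (sg7 J) = if i \in J then 0 else ssign i J *: sg7 (i |: J).
Proof.
rewrite {1}/sg7; case: insubP => [u uJ <-|J6] /=.
  by rewrite [LHS]dext_gen//; exact: homog_s_gen.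
rewrite (gder0 (s_gderivation i)); case: ifPn => // iJ.
by rewrite sg7_big ?scaler0// cardsU1 iJ ltnS ltnW// ltnNge.
Qed.

Lemma tgen_ind (P : tmodel -> Prop) :
  (forall I, P (sg4 I)) -> (forall J, P (sg7 J)) -> (forall i, P (w_gen i)) ->
  forall x : tgen, P (tvar x).
Proof.
move=> P4 P7 Pw [[A|B]|i]; last exact: Pw.
- by have := P4 (val A); rewrite /sg4 valK.
- by have := P7 (val B); rewrite /sg7 valK.
Qed.

Lemma tder_eq0 p (D : tmodel -> tmodel) : gderivation p D ->
  (forall I, D (sg4 I) = 0) -> (forall J, D (sg7 J) = 0) ->
  (forall i, D (w_gen i) = 0) -> forall a, D a = 0.
Proof.
move=> gD D4 D7 Dw; apply: (gder_eq0 gD).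
exact: (@tgen_ind (fun a => D a = 0)).
Qed.

Lemma ssignS i j I : i != j -> i \notin I -> j \notin I ->
  ssign i I * ssign j (i |: I) = - (ssign j I * ssign i (j |: I)).
Proof.
wlog ij : i j / (i < j)%N => [wl ij iI jI|].
  have [h|h|/val_inj h] := ltngtP i j.
  - exact: wl.
  - by rewrite [X in - X]wl ?opprK// eq_sym.
  - by rewrite h eqxx in ij.
move=> _ iI jI; rewrite /ssign.
have -> : [set l in i |: I | (l < j)%N] = i |: [set l in I | (l < j)%N].
  by apply/setP => l; rewrite !inE; case: eqP => // ->.
have -> : [set l in j |: I | (l < i)%N] = [set l in I | (l < i)%N].
  apply/setP => l; rewrite !inE; case: eqP => //= ->.
  by rewrite ltnNge ltnW// (negbTE jI).
by rewrite cardsU1 inE (negbTE iI) /= exprS mulN1r mulrN mulrC.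
Qed.

Lemma s_anticomm i j a : s_op i (s_op j a) = - s_op j (s_op i a).
Proof.
apply/eqP; rewrite -addr_eq0; apply/eqP; move: a.
have gD := @gder_anticomm _ _ _ (-1) (-1) _ _ isT isT (s_gderivation i) (s_gderivation j).
apply: (tder_eq0 gD) => [I|J|l]; last by rewrite !s_w !(gder0 (s_gderivation _)) addr0.
- rewrite !s_sg4; have [->|ij] := eqVneq i j.
    case: ifPn => jI; first by rewrite (gder0 (s_gderivation _)) addr0.
    by rewrite (gderZ (s_gderivation _)) s_sg4 setU11 scaler0 addr0.
  case: ifPn => jI; case: ifPn => iI;
    rewrite ?(gderZ (s_gderivation _)) ?s_sg4 ?(gder0 (s_gderivation _)).
  + by rewrite addr0.
  + by rewrite inE jI orbT scaler0 addr0.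
  + by rewrite inE iI orbT scaler0 addr0.
  + rewrite !inE [j == i]eq_sym (negbTE ij) (negbTE iI) (negbTE jI) /= !scalerA.
    by rewrite setUCA -scalerDl (ssignS ij iI jI) addrN scale0r.
- rewrite !s_sg7; have [->|ij] := eqVneq i j.
    case: ifPn => jJ; first by rewrite (gder0 (s_gderivation _)) addr0.
    by rewrite (gderZ (s_gderivation _)) s_sg7 setU11 scaler0 addr0.
  case: ifPn => jJ; case: ifPn => iJ;
    rewrite ?(gderZ (s_gderivation _)) ?s_sg7 ?(gder0 (s_gderivation _)).
  + by rewrite addr0.
  + by rewrite inE jJ orbT scaler0 addr0.
  + by rewrite inE iJ orbT scaler0 addr0.
  + rewrite !inE [j == i]eq_sym (negbTE ij) (negbTE iJ) (negbTE jJ) /= !scalerA.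
    by rewrite setUCA -scalerDl (ssignS ij iJ jJ) addrN scale0r.
Qed.

Lemma addrr_eq0 a : a + a = 0 -> a = 0.
Proof.
rewrite -mulr2n -scaler_nat => /(congr1 (fun b => 2^-1 *: b)).
by rewrite scalerA mulVf ?pnatr_eq0// scale1r scaler0.
Qed.

Lemma s_square i a : s_op i (s_op i a) = 0.
Proof. by apply: addrr_eq0; rewrite {1}s_anticomm addNr. Qed.

Lemma sI_linear r : linear (sI r).
Proof.
elim: r => [|i r Ir] c a b //=.
by rewrite Ir (gderD (s_gderivation i)) (gderZ (s_gderivation i)).
Qed.

Lemma sI0 r : sI r 0 = 0.
Proof. by elim: r => //= i r ->; rewrite (gder0 (s_gderivation i)). Qed.

Lemma sID r a b : sI r (a + b) = sI r a + sI r b.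
Proof. by rewrite -[X in X + b]scale1r sI_linear scale1r. Qed.

Lemma sIZ r c a : sI r (c *: a) = c *: sI r a.
Proof. by rewrite -[_ *: a]addr0 sI_linear sI0 addr0. Qed.

Lemma sI_sum r (K : Type) (l : seq K) (F : K -> tmodel) :
  sI r (\sum_(i <- l) F i) = \sum_(i <- l) sI r (F i).
Proof. exact: (big_morph _ (sID r) (sI0 r)). Qed.

Lemma sI_homog r n a : homog n a -> homog (n - (size r)%:Z) (sI r a).
Proof.
move=> ha; elim: r => [|i r Ir] /=; first by rewrite subr0.
case: (s_gderivation i) => _ hs _; have := hs _ _ Ir.
by rewrite -addrA -opprD -PoszD addn1.
Qed.

Lemma s_wM i j a : s_op i (w_gen j * a) = w_gen j * s_op i a.
Proof.
case: (s_gderivation i) => _ _ L.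
by rewrite (L _ _ _ (homog_w j)) s_w mul0r add0r -signr_odd expr0 scale1r.
Qed.

Lemma sI_wM r j a : sI r (w_gen j * a) = w_gen j * sI r a.
Proof. by elim: r => //= i r ->; rewrite s_wM. Qed.

Lemma s_sI i r1 r2 a : s_op i (sI (r1 ++ r2) a) =
  (-1) ^+ size r1 *: sI (r1 ++ i :: r2) a.
Proof.
elim: r1 => [|j r1 Ir] /=; first by rewrite scale1r.
by rewrite s_anticomm Ir (gderZ (s_gderivation _)) exprS mulN1r scaleNr.
Qed.

Lemma enum_splitU1 i I : exists2 r : seq 'I_k * seq 'I_k,
  enum (i |: I) = r.1 ++ i :: r.2 &
  enum I = (if i \in I then r.1 ++ i :: r.2 else r.1 ++ r.2)
  /\ ssign i I = (-1) ^+ size r.1.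
Proof.
have [e1 [e2 eE]] : exists e1 e2, enum 'I_k = e1 ++ i :: e2.
  have : i \in enum 'I_k by rewrite mem_enum.
  by case/splitPr => e1 e2; exists e1, e2.
have : pairwise (fun a b : 'I_k => (a < b)%N) (enum 'I_k).
  have := iota_ltn_sorted 0 k; rewrite -val_enum_ord sorted_map.
  by rewrite sorted_pairwise// => a b c; apply: ltn_trans.
have enumE (A : {pred 'I_k}) : enum A = filter (mem A) (enum 'I_k).
  by rewrite [enum 'I_k]enumT {1}/enum_mem.
rewrite eE pairwise_cat /= => /and3P[/allrelP lt1 _ /andP[/allP lt2 _]].
have i1 j : j \in e1 -> (j < i)%N by move=> je; apply: lt1; rewrite ?mem_head.
have ni1 j : j \in e1 -> j != i.
  by move=> /i1; apply: contraTneq => ->; rewrite ltnn.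
have ni2 j : j \in e2 -> j != i.
  by move=> /lt2; apply: contraTneq => ->; rewrite ltnn.
exists (filter (mem I) e1, filter (mem I) e2) => /=.
  rewrite enumE eE filter_cat /= !inE eqxx /=; congr (_ ++ _ :: _).
    by apply: eq_in_filter => j /ni1 /negbTE ji; rewrite /= !inE ji.
  by apply: eq_in_filter => j /ni2 /negbTE ji; rewrite /= !inE ji.
split; first by rewrite enumE eE filter_cat /=; case: ifP.
rewrite /ssign cardE enumE eE filter_cat /= !inE ltnn andbF size_cat.
have -> : [seq j <- e2 | j \in [set j in I | (j < i)%N]] = [::].
  apply/eqP; rewrite -[_ == _]negbK -has_filter; apply/hasPn => j /lt2 ij.
  by rewrite inE ltnNge ltnW// andbF.
rewrite addn0; congr (_ ^+ size _); apply: eq_in_filter => j /i1 ij.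
by rewrite /= inE ij andbT.
Qed.

Lemma s_sI_enum i I a : s_op i (sI (enum I) a) =
  if i \in I then 0 else ssign i I *: sI (enum (i |: I)) a.
Proof.
have [[r1 r2] /= e1 [e2 ->]] := enum_splitU1 i I; rewrite e1 e2.
case: ifP => _; rewrite s_sI//.
suff -> : sI (r1 ++ [:: i, i & r2]) a = 0 by rewrite scaler0.
by elim: r1 {e1 e2} => [|j r1 /= ->]; rewrite /= ?s_square ?(gder0 (s_gderivation _)).
Qed.

Lemma sg_sI I : sg4 I = sI (enum I) g4 /\ sg7 I = sI (enum I) g7.
Proof.
move En : #|I| => n; elim: n I En => [|n In] I En.
  by rewrite (cards0_eq En) enum_set0.
have [i iI] : exists i, i \in I by apply/set0Pn; rewrite -card_gt0 En.
have iD : i \notin I :\ i by rewrite !inE eqxx.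
have [|E4 E7] := In (I :\ i).
  by move: En; rewrite (cardsD1 i) iI add1n => -[].
have := congr1 (s_op i) E4; have := congr1 (s_op i) E7.
rewrite !s_sI_enum s_sg4 s_sg7 (negbTE iD) setD1K//.
have sg x : (-1) ^+ x * (-1) ^+ x = 1 :> R.
  by rewrite -expr2 -exprM mulnC exprM sqrrN !expr1n.
move=> /(congr1 (fun b => ssign i (I :\ i) *: b)) + /(congr1 (fun b => ssign i (I :\ i) *: b)).
by rewrite !scalerA !sg !scale1r.
Qed.

Lemma sI_g4_big r : (3 < size r)%N -> sI r g4 = 0.
Proof.
have [//|[I [c [<- ->]]] I3] : sI r g4 = 0 \/
    exists I c, #|I| = size r /\ sI r g4 = c *: sg4 I; last first.
  by rewrite sg4_big ?scaler0.
elim: r => [|i r [Ir|[I [c [Ir E]]]]] /=.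
- by right; exists set0, 1; rewrite cards0 scale1r.
- by left; rewrite Ir (gder0 (s_gderivation i)).
- rewrite E (gderZ (s_gderivation i)) s_sg4; case: ifPn => iI.
    by left; rewrite scaler0.
  right; exists (i |: I), (c * ssign i I).
  by rewrite cardsU1 iI Ir scalerA.
Qed.

Inductive sI_g4g4 (n : nat) : tmodel -> Prop :=
| sI_g4g4_0 : sI_g4g4 n 0
| sI_g4g4_D a b : sI_g4g4 n a -> sI_g4g4 n b -> sI_g4g4 n (a + b)
| sI_g4g4_Z c a : sI_g4g4 n a -> sI_g4g4 n (c *: a)
| sI_g4g4_M r1 r2 : (size r1 + size r2 = n)%N ->
    sI_g4g4 n (sI r1 g4 * sI r2 g4).

Lemma homog_g4 : homog 4 g4.
Proof. by have := homog_sg4 set0; rewrite cards0. Qed.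

Lemma homog_g7 : homog 7 g7.
Proof. by have := homog_sg7 set0; rewrite cards0. Qed.

Lemma sI_g4g4_big r : (6 < size r)%N -> sI r (g4 * g4) = 0.
Proof.
have : sI_g4g4 (size r) (sI r (g4 * g4)).
  elim: r => [|i r Ir] /=; first exact: (@sI_g4g4_M _ [::] [::]).
  elim: Ir => [|a b _ Ia _ Ib|c a _ Ia|r1 r2 Er].
  - by rewrite (gder0 (s_gderivation i)); apply: sI_g4g4_0.
  - by rewrite (gderD (s_gderivation i)); apply: sI_g4g4_D.
  - by rewrite (gderZ (s_gderivation i)); apply: sI_g4g4_Z.
  - case: (s_gderivation i) => _ _ L.
    rewrite (L _ _ _ (sI_homog r1 homog_g4)); apply: sI_g4g4_D.
      by apply: (@sI_g4g4_M _ (i :: r1)); rewrite /= -Er.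
    by apply/sI_g4g4_Z/(@sI_g4g4_M _ _ (i :: r2)); rewrite /= addnS Er.
move=> + r6; elim=> [//|a b _ -> _ ->|c a _ ->|r1 r2 Er].
- by rewrite addr0.
- by rewrite scaler0.
- have [h|h] := leqP (size r1) 3; last by rewrite sI_g4_big ?mul0r.
  by rewrite [X in _ * X]sI_g4_big ?mulr0//; lia.
Qed.

Lemma homog_dg4 : homog 5 dg4.
Proof.
rewrite /dg4; elim/big_ind: _ => [|a b|i _]; [exact: homog0 | exact: homogD |].
apply: (homogM (m := 2) (n := 3)); first exact: homog_w.
by case: (s_gderivation i) => _ hs _; apply: (hs 4); exact: homog_g4.
Qed.

Lemma homog_dg7 : homog 8 dg7.
Proof.
apply: homogD.
  rewrite -scaleNr; apply: homogZ.
  by apply: (homogM (m := 4) (n := 4)); exact: homog_g4.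
elim/big_ind: _ => [|a b|i _]; [exact: homog0 | exact: homogD |].
apply: (homogM (m := 2) (n := 6)); first exact: homog_w.
by case: (s_gderivation i) => _ hs _; apply: (hs 7); exact: homog_g7.
Qed.

Lemma homog_d_gen x : homog ((tdeg x)%:Z + 1) (d_gen x).
Proof.
case: x => [[A|B]|j] /=; last exact: homog0.
- have := sI_homog (enum (val A)) homog_dg4; rewrite -cardE => hI.
  have -> : (4 - #|sval A|)%N%:Z + 1 = 5 - #|sval A|%:Z.
    by have /= := valP A; lia.
  exact: homogZ.
- have := sI_homog (enum (val B)) homog_dg7; rewrite -cardE => hI.
  have -> : (7 - #|sval B|)%N%:Z + 1 = 8 - #|sval B|%:Z.
    by have /= := valP B; lia.
  exact: homogZ.
Qed.

Lemma d_gderivation : gderivation 1 d_op.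
Proof. exact/dext_gderivation/homog_d_gen. Qed.

Lemma d_w i : d_op (w_gen i) = 0.
Proof. exact/dext_gen/homog_d_gen. Qed.

Lemma sI_dg4_big r : (3 < size r)%N -> sI r dg4 = 0.
Proof.
move=> r3; rewrite /dg4 sI_sum big1// => i _; rewrite sI_wM.
case: (s_gderivation i) => _ hs _.
rewrite (homog_lt0 (sI_homog r (hs _ _ homog_g4))) ?mulr0//; lia.
Qed.

Lemma sI_dg7_big r : (6 < size r)%N -> sI r dg7 = 0.
Proof.
move=> r6; rewrite /dg7 sID -scaleNr sIZ sI_g4g4_big// scaler0 add0r.
rewrite sI_sum big1// => i _; rewrite sI_wM.
case: (s_gderivation i) => _ hs _.
rewrite (homog_lt0 (sI_homog r (hs _ _ homog_g7))) ?mulr0//; lia.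
Qed.

Lemma d_sg4 I : d_op (sg4 I) = (-1) ^+ #|I| *: sI (enum I) dg4.
Proof.
rewrite /sg4; case: insubP => [u uI <-|I3] /=.
  by rewrite [LHS]dext_gen//; exact: homog_d_gen.
by rewrite (gder0 d_gderivation) sI_dg4_big ?scaler0// -cardE ltnNge.
Qed.

Lemma d_sg7 J : d_op (sg7 J) = (-1) ^+ #|J| *: sI (enum J) dg7.
Proof.
rewrite /sg7; case: insubP => [u uI <-|I3] /=.
  by rewrite [LHS]dext_gen//; exact: homog_d_gen.
by rewrite (gder0 d_gderivation) sI_dg7_big ?scaler0// -cardE ltnNge.
Qed.

Lemma d_g4 : d_op g4 = \sum_i w_gen i * s_op i g4.
Proof. by rewrite /g4 d_sg4 cards0 enum_set0 scale1r. Qed.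

Lemma d_g7 : d_op g7 = - (2^-1 *: (g4 * g4)) + \sum_i w_gen i * s_op i g7.
Proof. by rewrite /g7 d_sg7 cards0 enum_set0 scale1r. Qed.

Lemma d_s i a : d_op (s_op i a) + s_op i (d_op a) = 0.
Proof.
move: a; have gD := @gder_anticomm _ _ _ 1 (-1) _ _ isT isT d_gderivation (s_gderivation i).
apply: (tder_eq0 gD) => [I|J|j].
- rewrite s_sg4 d_sg4 (gderZ (s_gderivation i)) s_sI_enum.
  case: ifPn => iI; first by rewrite (gder0 d_gderivation) scaler0 addr0.
  rewrite (gderZ d_gderivation) d_sg4 !scalerA cardsU1 iI exprS mulN1r mulrN.
  by rewrite scaleNr mulrC addNr.
- rewrite s_sg7 d_sg7 (gderZ (s_gderivation i)) s_sI_enum.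
  case: ifPn => iI; first by rewrite (gder0 d_gderivation) scaler0 addr0.
  rewrite (gderZ d_gderivation) d_sg7 !scalerA cardsU1 iI exprS mulN1r mulrN.
  by rewrite scaleNr mulrC addNr.
- by rewrite d_w s_w (gder0 d_gderivation) (gder0 (s_gderivation i)) addr0.
Qed.

Lemma d_sC i a : d_op (s_op i a) = - s_op i (d_op a).
Proof. by apply/eqP; rewrite -addr_eq0 d_s. Qed.

Lemma d_sI r a : d_op (sI r a) = (-1) ^+ size r *: sI r (d_op a).
Proof.
elim: r => [|i r Ir] /=; first by rewrite scale1r.
by rewrite d_sC Ir (gderZ (s_gderivation i)) exprS mulN1r scaleNr.
Qed.

Lemma d_wM i a : d_op (w_gen i * a) = w_gen i * d_op a.
Proof.
case: d_gderivation => _ _ L.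
by rewrite (L _ _ _ (homog_w i)) d_w mul0r add0r -signr_odd expr0 scale1r.
Qed.

Lemma sum_ws_square a : \sum_i w_gen i * s_op i (\sum_j w_gen j * s_op j a) = 0.
Proof.
have half b : b = - b -> b = 0 :> tmodel.
  by move/eqP; rewrite -addr_eq0 => /eqP; exact: addrr_eq0.
under eq_bigr => i _.
  rewrite (gder_sum (s_gderivation i)) mulr_sumr.
  under eq_bigr do rewrite s_wM.
  over.
apply: half; rewrite [LHS]exchange_big -sumrN; apply: eq_bigr => i _.
rewrite -sumrN; apply: eq_bigr => j _.
rewrite s_anticomm !mulrN; congr (- _); rewrite !mulrA; congr (_ * _).
by rewrite (homog_comm (homog_w j) (homog_w i)) -signr_odd scale1r.
Qed.

Lemma d_dg4 : d_op dg4 = 0.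
Proof.
rewrite /dg4 (gder_sum d_gderivation).
under eq_bigr do rewrite d_wM d_sC d_g4 mulrN.
by rewrite sumrN sum_ws_square oppr0.
Qed.

Lemma d_dg7 : d_op dg7 = 0.
Proof.
rewrite /dg7 (gderD d_gderivation) (gderN d_gderivation) (gderZ d_gderivation).
case: d_gderivation => _ _ L; rewrite (L _ _ _ homog_g4) -signr_odd expr0 scale1r.
rewrite (gder_sum d_gderivation).
have gC : d_op g4 * g4 = g4 * d_op g4.
  have [_ hd _] := d_gderivation.
  by rewrite (homog_comm (hd _ _ homog_g4) homog_g4) -signr_odd scale1r.
have sC i : s_op i g4 * g4 = g4 * s_op i g4.
  have [_ hs _] := s_gderivation i.
  by rewrite (homog_comm (hs _ _ homog_g4) homog_g4) -signr_odd scale1r.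
under eq_bigr => i _.
  rewrite d_wM d_sC d_g7 (gderD (s_gderivation i)) (gderN (s_gderivation i)).
  rewrite (gderZ (s_gderivation i)).
  have -> : s_op i (g4 * g4) = (2 : R) *: (g4 * s_op i g4).
    case: (s_gderivation i) => _ _ Ls.
    rewrite (Ls _ _ _ homog_g4) -signr_odd expr0 scale1r sC.
    by rewrite scaler_nat mulr2n.
  rewrite scalerA mulVf ?pnatr_eq0// scale1r opprD opprK mulrDr mulrN.
  over.
rewrite big_split /= sumrN sum_ws_square oppr0 addr0 gC.
have -> : \sum_i w_gen i * (g4 * s_op i g4) = g4 * d_op g4.
  rewrite d_g4 mulr_sumr; apply: eq_bigr => i _; rewrite !mulrA; congr (_ * _).
  by rewrite (homog_comm (homog_w i) homog_g4) -signr_odd scale1r.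
by rewrite -mulr2n -scaler_nat scalerA mulVf ?pnatr_eq0// scale1r addNr.
Qed.

Lemma d_square a : d_op (d_op a) = 0.
Proof.
have dd b : d_op (d_op b) + d_op (d_op b) = 0.
  move: b; have gD := @gder_anticomm _ _ _ 1 1 _ _ isT isT d_gderivation d_gderivation.
  apply: (tder_eq0 gD) => [I|J|j]; last by rewrite d_w (gder0 d_gderivation) addr0.
  - rewrite d_sg4 (gderZ d_gderivation) d_sI d_dg4 sI0.
    by rewrite !scaler0 addr0.
  - rewrite d_sg7 (gderZ d_gderivation) d_sI d_dg7 sI0.
    by rewrite !scaler0 addr0.
exact/addrr_eq0/dd.
Qed.

End ToroidificationModel.

(** * Lie algebras *)

HB.mixin Record isLieAlgebra (R : pzRingType) L of GRing.Lmodule R L := {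
  lie : L -> L -> L;
  lie_linearl : forall y, linear (lie^~ y);
  lie_linearr : forall x, linear (lie x);
  liexx : forall x, lie x x = 0;
  lie_jacobi : forall x y z,
    lie x (lie y z) + lie y (lie z x) + lie z (lie x y) = 0
}.

#[short(type="lieAlgType")]
HB.structure Definition LieAlgebra (R : pzRingType) :=
  {L of isLieAlgebra R L & GRing.Lmodule R L}.

Definition lie_morphism (R : pzRingType) (L L' : lieAlgType R) (f : L -> L') :=
  linear f /\ forall x y, f (lie x y) = lie (f x) (f y).

(** ** Subalgebras generated by a set *)

Section GeneratedLieSubalgebra.
Variables (R : pzRingType) (L : lieAlgType R) (X : L -> Prop).

Definition lie_subalgebra (S : L -> Prop) : Prop :=
  [/\ S 0, forall (c : R) x y, S x -> S y -> S (c *: x + y) &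
      forall x y, S x -> S y -> S (lie x y)].

Definition lie_generated : {pred L} :=
  fun x => `[< forall S, lie_subalgebra S -> (forall y, X y -> S y) -> S x >].

Lemma lie_generated_submod : submod_closed lie_generated.
Proof.
split=> [|c x y /asboolP hx /asboolP hy]; apply/asboolP => S sS XS.
  by case: sS.
by have [_ SD _] := sS; apply: SD; [exact: hx | exact: hy].
Qed.

HB.instance Definition _ :=
  GRing.isSubmodClosed.Build R L lie_generated lie_generated_submod.

Lemma lie_generated_lie x y :
  x \in lie_generated -> y \in lie_generated -> lie x y \in lie_generated.
Proof.
move=> /asboolP hx /asboolP hy; apply/asboolP => S sS XS.
by have [_ _ SL] := sS; apply: SL; [exact: hx | exact: hy].
Qed.

Lemma mem_lie_generated x : X x -> x \in lie_generated.
Proof. by move=> Xx; apply/asboolP => S _; apply. Qed.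

Record lie_gen := LieGen {
  lie_gen_val :> L;
  lie_gen_valP : lie_gen_val \in lie_generated
}.

HB.instance Definition _ := [isSub for lie_gen_val].
HB.instance Definition _ := [Choice of lie_gen by <:].
HB.instance Definition _ := [SubChoice_isSubLmodule of lie_gen by <:].

Definition lie_gen_lie (x y : lie_gen) : lie_gen :=
  LieGen (lie_generated_lie (lie_gen_valP x) (lie_gen_valP y)).

Lemma lie_gen_linearl y : linear (lie_gen_lie^~ y).
Proof.
move=> c x x'; apply: val_inj.
rewrite [RHS]linearP -[LHS]/(lie (val (c *: x + x')) (val y)).
by rewrite [val (c *: x + x')]linearP [LHS]lie_linearl.
Qed.

Lemma lie_gen_linearr x : linear (lie_gen_lie x).
Proof.
move=> c y y'; apply: val_inj.
rewrite [RHS]linearP -[LHS]/(lie (val x) (val (c *: y + y'))).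
by rewrite [val (c *: y + y')]linearP [LHS]lie_linearr.
Qed.

Lemma lie_gen_liexx x : lie_gen_lie x x = 0.
Proof. by apply: val_inj; rewrite [RHS]linear0; exact: liexx. Qed.

Lemma lie_gen_jacobi x y z : lie_gen_lie x (lie_gen_lie y z) +
  lie_gen_lie y (lie_gen_lie z x) + lie_gen_lie z (lie_gen_lie x y) = 0.
Proof. by apply: val_inj; rewrite !linearD [RHS]linear0; exact: lie_jacobi. Qed.

HB.instance Definition _ := isLieAlgebra.Build R lie_gen
  lie_gen_linearl lie_gen_linearr lie_gen_liexx lie_gen_jacobi.

End GeneratedLieSubalgebra.

(** ** The Lie algebra with generators [G] and relations [rel] *)

Inductive lieterm (R : pzRingType) (G : Type) : Type :=
| Lgen of G
| Lzero
| Ladd of lieterm R G & lieterm R G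
| Lscale of R & lieterm R G
| Lbr of lieterm R G & lieterm R G.

Arguments Lgen {R G} _.
Arguments Lzero {R G}.

Section PresentedLieAlgebra.
Variables (R : pzRingType) (G : Type).
Local Notation term := (lieterm R G).
Variable rel : term -> term -> Prop.

Inductive lieeq : term -> term -> Prop :=
| lieeq_refl t : lieeq t t
| lieeq_sym t u : lieeq t u -> lieeq u t
| lieeq_trans t u v : lieeq t u -> lieeq u v -> lieeq t v
| lieeq_add t t' u u' : lieeq t t' -> lieeq u u' ->
    lieeq (Ladd t u) (Ladd t' u')
| lieeq_scale c t t' : lieeq t t' -> lieeq (Lscale c t) (Lscale c t')
| lieeq_br t t' u u' : lieeq t t' -> lieeq u u' ->
    lieeq (Lbr t u) (Lbr t' u')
| lieeq_addA t u v : lieeq (Ladd t (Ladd u v)) (Ladd (Ladd t u) v)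
| lieeq_addC t u : lieeq (Ladd t u) (Ladd u t)
| lieeq_add0 t : lieeq (Ladd Lzero t) t
| lieeq_addN t : lieeq (Ladd (Lscale (-1) t) t) Lzero
| lieeq_scaleA c c' t : lieeq (Lscale c (Lscale c' t)) (Lscale (c * c') t)
| lieeq_scale1 t : lieeq (Lscale 1 t) t
| lieeq_scaleDr c t u :
    lieeq (Lscale c (Ladd t u)) (Ladd (Lscale c t) (Lscale c u))
| lieeq_scaleDl c c' t :
    lieeq (Lscale (c + c') t) (Ladd (Lscale c t) (Lscale c' t))
| lieeq_linearl c t t' u :
    lieeq (Lbr (Ladd (Lscale c t) t') u) (Ladd (Lscale c (Lbr t u)) (Lbr t' u))
| lieeq_linearr c t u u' :
    lieeq (Lbr t (Ladd (Lscale c u) u')) (Ladd (Lscale c (Lbr t u)) (Lbr t u'))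
| lieeq_xx t : lieeq (Lbr t t) Lzero
| lieeq_jacobi t u v :
    lieeq (Ladd (Ladd (Lbr t (Lbr u v)) (Lbr u (Lbr v t))) (Lbr v (Lbr t u)))
      Lzero
| lieeq_rel t u : rel t u -> lieeq t u.

HB.instance Definition _ := gen_eqMixin term.
HB.instance Definition _ := gen_choiceMixin term.

Definition lieeqb (t u : term) : bool := `[< lieeq t u >].

Lemma lieeqb_refl : reflexive lieeqb.
Proof. by move=> t; apply/asboolP/lieeq_refl. Qed.

Lemma lieeqb_sym : symmetric lieeqb.
Proof. by move=> t u; apply/asboolP/asboolP => /lieeq_sym. Qed.

Lemma lieeqb_trans : transitive lieeqb.
Proof.
by move=> u t v /asboolP tu /asboolP uv; apply/asboolP; exact: lieeq_trans uv.
Qed.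

Canonical lieeq_equiv := EquivRel lieeqb lieeqb_refl lieeqb_sym lieeqb_trans.

Definition lie_pres : Type := {eq_quot lieeq_equiv}.
HB.instance Definition _ := Choice.on lie_pres.
HB.instance Definition _ := EqQuotient.on lie_pres.

Local Notation pi := (\pi_lie_pres).

Lemma lie_pres_eq t u : lieeq t u -> pi t = pi u.
Proof. by move=> tu; apply/eqmodP/asboolP. Qed.

Lemma lie_pres_eqP t u : pi t = pi u -> lieeq t u.
Proof. by move/eqmodP/asboolP. Qed.

Lemma lie_pres_repr t : lieeq (repr (pi t)) t.
Proof. by apply: lie_pres_eqP; rewrite reprK. Qed.

Definition lie_pres_gen (x : G) : lie_pres := pi (Lgen x).
Definition lie_pres_zero : lie_pres := pi Lzero.
Definition lie_pres_add (a b : lie_pres) : lie_pres :=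
  pi (Ladd (repr a) (repr b)).
Definition lie_pres_scale (c : R) (a : lie_pres) : lie_pres :=
  pi (Lscale c (repr a)).
Definition lie_pres_opp (a : lie_pres) : lie_pres := lie_pres_scale (-1) a.
Definition lie_pres_lie (a b : lie_pres) : lie_pres :=
  pi (Lbr (repr a) (repr b)).

Lemma lie_pi_add t u : lie_pres_add (pi t) (pi u) = pi (Ladd t u).
Proof. by apply: lie_pres_eq; apply: lieeq_add; apply: lie_pres_repr. Qed.

Lemma lie_pi_scale c t : lie_pres_scale c (pi t) = pi (Lscale c t).
Proof. by apply: lie_pres_eq; apply: lieeq_scale; apply: lie_pres_repr. Qed.

Lemma lie_pi_lie t u : lie_pres_lie (pi t) (pi u) = pi (Lbr t u).
Proof. by apply: lie_pres_eq; apply: lieeq_br; apply: lie_pres_repr. Qed.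

Lemma lie_pres_addA : associative lie_pres_add.
Proof.
elim/quotW=> t; elim/quotW=> u; elim/quotW=> v.
rewrite (lie_pi_add u v) (lie_pi_add t u) !lie_pi_add.
by apply: lie_pres_eq; apply: lieeq_addA.
Qed.

Lemma lie_pres_addC : commutative lie_pres_add.
Proof.
elim/quotW=> t; elim/quotW=> u; rewrite (lie_pi_add t u) lie_pi_add.
by apply: lie_pres_eq; apply: lieeq_addC.
Qed.

Lemma lie_pres_add0 : left_id lie_pres_zero lie_pres_add.
Proof.
by elim/quotW=> t; rewrite lie_pi_add; apply: lie_pres_eq; apply: lieeq_add0.
Qed.

Lemma lie_pres_addN : left_inverse lie_pres_zero lie_pres_opp lie_pres_add.
Proof.
elim/quotW=> t; rewrite /lie_pres_opp (lie_pi_scale _ t) lie_pi_add.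
by apply: lie_pres_eq; apply: lieeq_addN.
Qed.

HB.instance Definition _ := GRing.isZmodule.Build lie_pres
  lie_pres_addA lie_pres_addC lie_pres_add0 lie_pres_addN.

Lemma lie_pres_scaleA c c' a :
  lie_pres_scale c (lie_pres_scale c' a) = lie_pres_scale (c * c') a.
Proof.
elim/quotW: a => t; rewrite (lie_pi_scale c' t) !lie_pi_scale.
by apply: lie_pres_eq; apply: lieeq_scaleA.
Qed.

Lemma lie_pres_scale1 : left_id 1 lie_pres_scale.
Proof.
by elim/quotW=> t; rewrite lie_pi_scale; apply: lie_pres_eq; apply: lieeq_scale1.
Qed.

Lemma lie_piD t u : pi (Ladd t u) = pi t + pi u.
Proof. by rewrite -lie_pi_add. Qed.

Lemma lie_pres_scaleDr : right_distributive lie_pres_scale +%R.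
Proof.
move=> c; elim/quotW=> t; elim/quotW=> u.
rewrite -lie_piD !lie_pi_scale -lie_piD.
by apply: lie_pres_eq; apply: lieeq_scaleDr.
Qed.

Lemma lie_pres_scaleDl a : {morph lie_pres_scale^~ a : c c' / c + c'}.
Proof.
move=> c c'; elim/quotW: a => t; rewrite !lie_pi_scale -lie_piD.
by apply: lie_pres_eq; apply: lieeq_scaleDl.
Qed.

HB.instance Definition _ := GRing.Zmodule_isLmodule.Build R lie_pres
  lie_pres_scaleA lie_pres_scale1 lie_pres_scaleDr lie_pres_scaleDl.

Lemma lie_piZ c t : pi (Lscale c t) = c *: pi t.
Proof. by rewrite -lie_pi_scale. Qed.

Lemma lie_pres_linearl b : linear (lie_pres_lie^~ b).
Proof.
move=> c; elim/quotW: b => u; elim/quotW=> t; elim/quotW=> t'.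
rewrite -lie_piZ -lie_piD !lie_pi_lie -lie_piZ -lie_piD.
by apply: lie_pres_eq; apply: lieeq_linearl.
Qed.

Lemma lie_pres_linearr a : linear (lie_pres_lie a).
Proof.
move=> c; elim/quotW: a => t; elim/quotW=> u; elim/quotW=> u'.
rewrite -lie_piZ -lie_piD !lie_pi_lie -lie_piZ -lie_piD.
by apply: lie_pres_eq; apply: lieeq_linearr.
Qed.

Lemma lie_pres_liexx a : lie_pres_lie a a = 0.
Proof.
by elim/quotW: a => t; rewrite lie_pi_lie; apply: lie_pres_eq; apply: lieeq_xx.
Qed.

Lemma lie_pres_jacobi a b c : lie_pres_lie a (lie_pres_lie b c) +
  lie_pres_lie b (lie_pres_lie c a) + lie_pres_lie c (lie_pres_lie a b) = 0.
Proof.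
elim/quotW: a => t; elim/quotW: b => u; elim/quotW: c => v.
rewrite (lie_pi_lie u v) (lie_pi_lie v t) (lie_pi_lie t u) !lie_pi_lie -!lie_piD.
by apply: lie_pres_eq; apply: lieeq_jacobi.
Qed.

HB.instance Definition _ := isLieAlgebra.Build R lie_pres
  lie_pres_linearl lie_pres_linearr lie_pres_liexx lie_pres_jacobi.

Lemma lie_piL t u : pi (Lbr t u) = lie (pi t) (pi u).
Proof. by rewrite -[RHS]/(lie_pres_lie _ _) lie_pi_lie. Qed.

End PresentedLieAlgebra.

(** * The Kac-Moody algebra of type E_k and its parabolic subalgebra

  For [Ee], [Ef], [alpha] and [coroot], [i : 'I_k] stands for the index [i.+1];
  [hb] and [eps] take the index itself, in the range 0 .. k. *)

Section LieE.
Variables (R : realType) (k : nat).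

Local Notation hk := 'rV[R]_k.+1.

Definition hb (i : nat) : hk := delta_mx 0 (inord i).

Definition eps (i : nat) (x : hk) : R :=
  if i == 0%N then - x 0 ord0 else x 0 (inord i).

Definition alpha (i : 'I_k) (x : hk) : R :=
  if i.+1 == k then eps 0 x - eps 1 x - eps 2 x - eps 3 x
  else eps i.+1 x - eps i.+2 x.

Definition coroot (i : 'I_k) : hk :=
  if i.+1 == k then hb 0 - hb 1 - hb 2 - hb 3 else hb i.+1 - hb i.+2.

Definition cartan (j i : 'I_k) : R := alpha i (coroot j).

Inductive ekgen := Ee of 'I_k | Ef of 'I_k | Eh of hk.

Local Notation term := (lieterm R ekgen).
Local Notation te i := (Lgen (Ee i) : term).
Local Notation tf i := (Lgen (Ef i) : term).
Local Notation th x := (Lgen (Eh x) : term).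

Inductive ekrel : term -> term -> Prop :=
| ek_hlinear (c : R) (x y : hk) :
    ekrel (th (c *: x + y)) (Ladd (Lscale c (th x)) (th y))
| ek_hh x y : ekrel (Lbr (th x) (th y)) Lzero
| ek_he x i : ekrel (Lbr (th x) (te i)) (Lscale (alpha i x) (te i))
| ek_hf x i : ekrel (Lbr (th x) (tf i)) (Lscale (- alpha i x) (tf i))
| ek_ef i : ekrel (Lbr (te i) (tf i)) (th (coroot i))
| ek_ef0 i j : i != j -> ekrel (Lbr (te i) (tf j)) Lzero
| ek_serre_e i j (n : nat) : i != j -> n%:R = 1 - cartan i j ->
    ekrel (iter n (Lbr (te i)) (te j)) Lzero
| ek_serre_f i j (n : nat) : i != j -> n%:R = 1 - cartan i j ->
    ekrel (iter n (Lbr (tf i)) (tf j)) Lzero.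

Definition gk : Type := lie_pres ekrel.
HB.instance Definition _ := LieAlgebra.on gk.

Definition gk_e (i : 'I_k) : gk := lie_pres_gen ekrel (Ee i).
Definition gk_f (i : 'I_k) : gk := lie_pres_gen ekrel (Ef i).
Definition gk_h (x : hk) : gk := lie_pres_gen ekrel (Eh x).

Inductive pk_generator : gk -> Prop :=
| pk_gen_h x : pk_generator (gk_h x)
| pk_gen_e i : pk_generator (gk_e i)
| pk_gen_f (i : 'I_k) : (i.+1 < k)%N -> pk_generator (gk_f i).

Definition pk : Type := lie_gen pk_generator.
HB.instance Definition _ := LieAlgebra.on pk.

Definition pk_h (x : hk) : pk := LieGen (mem_lie_generated (pk_gen_h x)).
Definition pk_e (i : 'I_k) : pk := LieGen (mem_lie_generated (pk_gen_e i)).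
Definition pk_f (i : 'I_k) (hi : (i.+1 < k)%N) : pk :=
  LieGen (mem_lie_generated (pk_gen_f hi)).

End LieE.

(** * Derivations of the minimal model *)

Section ModelDerivations.
Variables (R : realType) (k : nat).
Local Notation M := (tmodel R k).
Implicit Types D E : M -> M.

(* Degree-zero derivations commuting with [d_op] and annihilated by the
  augmentation. *)
Definition tder_pred : {pred M -> M} := fun D => `[<
  [/\ gderivation 0 D, forall a, D (d_op a) = d_op (D a) &
      forall a, aug (D a) = 0] >].

Lemma augD (a b : M) : aug (a + b) = aug a + aug b.
Proof.
by elim/quotW: a => t; elim/quotW: b => u; rewrite -fgca_piD !aug_pi.
Qed.

Lemma augZ c (a : M) : aug (c *: a) = c * aug a.
Proof. by elim/quotW: a => t; rewrite -fgca_piZ !aug_pi. Qed.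

Lemma aug0 : aug (0 : M) = 0.
Proof. by rewrite fgca_pi0 aug_pi. Qed.

Lemma tder_submod : submod_closed tder_pred.
Proof.
split=> [|c D E /asboolP[gD dD aD] /asboolP[gE dE aE]]; apply/asboolP.
  split=> [|a|a]; last exact: aug0.
  - split=> [c a b|n a _|n a b _]; first by rewrite scaler0 addr0.
      exact: homog0.
    by rewrite mul0r mulr0 scaler0 addr0.
  - by rewrite (gder0 (d_gderivation R k)).
have [lD hD LD] := gD; have [lE hE LE] := gE.
split=> [|a|a].
- split=> [c' a b|n a ha|n a b ha].
  + rewrite !fctE lD lE !scalerDr !scalerA addrACA; congr (_ + _ + _).
    by rewrite mulrC.
  + by apply: homogD; [apply/homogZ/hD | apply: hE].
  + rewrite !fctE (LD _ _ _ ha) (LE _ _ _ ha) !mul0n !scale1r scalerDr.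
    by rewrite addrACA mulrDl mulrDr -scalerAl -scalerAr.
- rewrite !fctE dD dE (gderD (d_gderivation R k)).
  by rewrite (gderZ (d_gderivation R k)).
- by rewrite [aug _]augD augZ aD aE mulr0 addr0.
Qed.

HB.instance Definition _ :=
  GRing.isSubmodClosed.Build R (M -> M) tder_pred tder_submod.

Record tder := TDer { tder_fun :> M -> M; tderP : tder_fun \in tder_pred }.

HB.instance Definition _ := [isSub for tder_fun].
HB.instance Definition _ := [Choice of tder by <:].
HB.instance Definition _ := [SubChoice_isSubLmodule of tder by <:].

Definition commutator D E : M -> M := fun a => D (E a) - E (D a).

Lemma tder_commutator D E :
  D \in tder_pred -> E \in tder_pred -> commutator D E \in tder_pred.
Proof.
move=> /asboolP[gD dD aD] /asboolP[gE dE aE]; apply/asboolP.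
have [lD hD LD] := gD; have [lE hE LE] := gE; rewrite /commutator.
have h0 (F : M -> M) n a : gderivation 0 F -> homog n a -> homog n (F a).
  by case=> _ hF _ ha; rewrite -[n]addr0; apply: hF.
split=> [|a|a].
- split=> [c a b|n a ha|n a b ha].
  + by rewrite lE lD lD lE opprD addrACA scalerBr.
  + rewrite addr0 -[- _]scaleN1r.
    apply: homogD; first exact: h0 _ _ _ gD (h0 _ _ _ gE ha).
    by apply: homogZ; exact: h0 _ _ _ gE (h0 _ _ _ gD ha).
  + rewrite (LE _ _ _ ha) (LD _ _ _ ha) !mul0n !scale1r.
    rewrite !(gderD gD, gderD gE) (LD _ _ _ ha) (LE _ _ _ ha).
    rewrite (LD _ _ _ (h0 _ _ _ gE ha)) (LE _ _ _ (h0 _ _ _ gD ha)).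
    rewrite !mul0n !scale1r mulrBl mulrBr.
    exact: zmod_cancel2.
- by rewrite !(dE, dD) (gderD (d_gderivation R k)) (gderN (d_gderivation R k)).
- by rewrite augD -[- _]scaleN1r augZ aD aE mulr0 addr0.
Qed.

Definition tder_lie (D E : tder) : tder :=
  TDer (tder_commutator (tderP D) (tderP E)).

Lemma tder_eq (D E : tder) : (forall a, D a = E a) -> D = E.
Proof. by move=> DE; apply/val_inj/funext. Qed.

Lemma tder_gder (D : tder) : gderivation 0 D.
Proof. by have /asboolP[] := tderP D. Qed.

Lemma tder_linearE c (D E : tder) a : (c *: D + E) a = c *: D a + E a.
Proof. by []. Qed.

Lemma tder_lieE (D E : tder) a : tder_lie D E a = D (E a) - E (D a).
Proof. by []. Qed.

Lemma tder_liexx (D : tder) : tder_lie D D = 0.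
Proof. by apply: tder_eq => a; rewrite tder_lieE subrr. Qed.

Lemma tder_linearl (E : tder) : linear (tder_lie^~ E).
Proof.
move=> c D D'; apply: tder_eq => a; rewrite tder_linearE !tder_lieE !tder_linearE.
rewrite (gderD (tder_gder E)) (gderZ (tder_gder E)).
by rewrite opprD addrACA scalerBr.
Qed.

Lemma tder_linearr (D : tder) : linear (tder_lie D).
Proof.
move=> c E E'; apply: tder_eq => a; rewrite tder_linearE !tder_lieE !tder_linearE.
rewrite (gderD (tder_gder D)) (gderZ (tder_gder D)).
by rewrite opprD addrACA scalerBr.
Qed.

Lemma tder_jacobi (D E F : tder) : tder_lie D (tder_lie E F) + tder_lie E (tder_lie F D) +
  tder_lie F (tder_lie D E) = 0.
Proof.
apply: tder_eq => a.
rewrite -[LHS]/(tder_lie D (tder_lie E F) a + tder_lie E (tder_lie F D) a +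
  tder_lie F (tder_lie D E) a) !tder_lieE.
rewrite !(gderD (tder_gder _), gderN (tder_gder _)).
exact: zmod_cancel6.
Qed.

HB.instance Definition _ := isLieAlgebra.Build R tder
  tder_linearl tder_linearr tder_liexx tder_jacobi.

(* The space [V] spanned by the generators, and its inclusion in [M]. *)
Definition tspace : Type := {ffun tgen k -> R^o}.
HB.instance Definition _ := GRing.Lmodule.on tspace.

Definition tspace_incl (v : tspace) : M := \sum_x v x *: tvar R x.

Definition linear_derivation D : Prop :=
  exists L : {linear tspace -> tspace},
    forall v, D (tspace_incl v) = tspace_incl (L v).

End ModelDerivations.

(** * The formulas of the action *)

Section Action.
Variables (R : realType) (k : nat) (k3 : (3 <= k)%N).
Local Notation M := (tmodel R k).
Local Notation g4 := (g4 R k).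
Local Notation g7 := (g7 R k).
Local Notation w := (w_gen R).
Local Notation s := (@s_op R k).

(* The elements 0, 1 and 2 of ['I_3] stand for the indices 1, 2 and 3. *)
Definition i3 (i : 'I_3) : 'I_k := widen_ord k3 i.

Definition ek_formulas (D : M -> M) : Prop :=
  [/\ D g4 = 0 /\ D g7 = 0,
      forall i, D (s (i3 i) g4) = 0 /\ D (s (i3 i) g7) = 0,
      forall i j, D (s (i3 i) (s (i3 j) g7)) = 0 &
      D (s (i3 0) (s (i3 1) (s (i3 2) g4))) = 0] /\
  [/\ forall i, D (w i) = 0,
      forall sigma : 'S_3, D (s (i3 (sigma 0)) (s (i3 (sigma 1)) g4)) =
        (-1) ^+ sigma *: w (i3 (sigma 2)),
      D (s (i3 0) (s (i3 1) (s (i3 2) g7))) = g4 &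
      forall i : 'I_k, (3 <= i)%N -> forall a, commutator D (s i) a = 0].

Definition h_formulas (x : 'rV[R]_k.+1) (D : M -> M) : Prop :=
  [/\ D g4 = - eps 0 x *: g4,
      D g7 = - (2 * eps 0 x) *: g7,
      forall i a, commutator D (s i) a = eps i.+1 x *: s i a &
      forall i, D (w i) = - eps i.+1 x *: w i].

(* In the next two definitions [i'] is the successor of [i]. *)
Definition ei_formulas (i i' : 'I_k) (D : M -> M) : Prop :=
  [/\ D g4 = 0, D g7 = 0,
      forall j, D (w j) = (i == j)%:R *: w i' &
      forall j a, commutator D (s j) a = - ((i' == j)%:R *: s i a)].

Definition fi_formulas (i i' : 'I_k) (D : M -> M) : Prop :=
  [/\ D g4 = 0, D g7 = 0,
      forall j, D (w j) = (i' == j)%:R *: w i &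
      forall j a, commutator D (s j) a = - ((i == j)%:R *: s i' a)].

Definition action_formulas (phi : pk R k -> tder R k) : Prop :=
  [/\ forall i : 'I_k, i.+1 = k -> ek_formulas (phi (pk_e R i)),
      forall x : 'rV[R]_k.+1, h_formulas x (phi (pk_h x)),
      forall (i : 'I_k) (hi : (i.+1 < k)%N),
        ei_formulas i (Ordinal hi) (phi (pk_e R i)) &
      forall (i : 'I_k) (hi : (i.+1 < k)%N),
        fi_formulas i (Ordinal hi) (phi (pk_f R hi))].

End Action.

(* Main.v *)
(* The parabolic algebra is defined inside [g_k], so one must first see that it
  is presented by the relations of [g_k] not involving [f_k]: a representation
  [V] of that presentation has to be a quotient of a [g_k]-module.  It is one of
  the coinduced module of [U(p)]-linear maps [U(g) -> V].  Written on monomials in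
  the [f_j] it is an explicit space of functions, on which the relations are
  checked by the usual argument: the Serre elements in the [e_i] commute with
  every [f_j] and conversely.  Evaluation at 1 maps it onto [V].

  To construct the action, let the exterior algebra on [xi_1, .., xi_k] act on
  the model by [xi_i |-> s_i].  A linear derivation is then described by its
  values at [x g_4] and [x g_7], for [x] in the exterior algebra.  The
  generators [h], [e_i], [f_i] with [i < k] come from [gl_k x R], acting by
  derivations of the exterior algebra.  The generator [e_k] is a triple
  contraction: [x g_7 |-> J x g_4] and [x g_4 |-> sum_l aug (J (xi_l x)) w_l]
  with [J = hook_1 hook_2 hook_3 tau], where [hook_i] contracts with [xi_i] and
  [tau] is the parity.  Brackets become commutators of operators on the exterior
  algebra, and [e_k] commutes with [d] by a computation of its values at
  [s_I (g_4 g_4)]. *)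

Require Import Defs.
From HB Require Import structures.
From mathcomp Require Import all_boot all_order all_algebra perm generic_quotient.
From mathcomp Require Import boolp functions reals ring lra zify.

Set Implicit Arguments.
Unset Strict Implicit.
Unset Printing Implicit Defensive.

Import Order.TTheory GRing.Theory Num.Theory.
Local Open Scope ring_scope.
Local Open Scope quotient_scope.

(** An equality in [p_k] is an equality in [g_k], so its derivation may pass through terms
    containing [f_k], which is not part of the action. Instead of appealing to a triangular
    decomposition, the proof replays any such derivation in a module coinduced from a faithful
    representation of the target, the model itself. On arbitrary functions of words every relation
    of [g_k] holds except the Serre relations in the [f_j]; these, with linearity over [p_k], cut
    out the right subspace.

    The formula for [e_k] on the [s_I g_4] is matched to that on the [s_J g_7]: when [e_k] is
    applied to [d (x g_7)], the terms by which [J] fails to commute with the [xi_i] must cancel half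
    of the value at [x (g_4 g_4)]. The parity in [J] compensates the sign of three odd contractions,
    whence [[e_k, s_i] = 0] for [i > 3].

    The theorem also asserts that the formulas determine the action. For [h], [e_i], [f_i] this
    follows from the commutators with all [s_j]. For [e_k] no commutator with [s_1, s_2, s_3] is
    prescribed, and the subsets of [{1, 2, 3}] are compared one by one. *)

(** * Reflection for equalities in commutative groups *)

Inductive zexpr := ZVar of nat | ZZero | ZAdd of zexpr & zexpr | ZOpp of zexpr.

Fixpoint zeval (V : zmodType) (env : seq V) (e : zexpr) : V :=
  match e with
  | ZVar n => env`_n
  | ZZero => 0
  | ZAdd e1 e2 => zeval env e1 + zeval env e2
  | ZOpp e1 => - zeval env e1
  end.

Fixpoint zcoef (e : zexpr) (n : nat) : int :=
  match e with
  | ZVar m => Posz (m == n)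
  | ZZero => 0
  | ZAdd e1 e2 => zcoef e1 n + zcoef e2 n
  | ZOpp e1 => - zcoef e1 n
  end.

Lemma zevalE (V : zmodType) (env : seq V) e :
  zeval env e = \sum_(n < size env) env`_n *~ zcoef e n.
Proof.
elim: e => [m||e1 IH1 e2 IH2|e1 IH1] /=.
- have [ms|ms] := ltnP m (size env).
    rewrite (bigD1 (Ordinal ms))//= eqxx mulr1z big1 ?addr0// => i.
    by rewrite -(inj_eq val_inj) /= eq_sym => /negbTE ->.
  rewrite nth_default// big1// => i _; case: eqP => [mi|//].
  by move: (ltn_ord i); rewrite -mi ltnNge ms.
- by rewrite big1.
- by rewrite IH1 IH2 -big_split; apply: eq_bigr => i _; rewrite mulrzDr.
- by rewrite IH1 -sumrN; apply: eq_bigr => i _; rewrite mulrNz.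
Qed.

Lemma zeval_eq (V : zmodType) (env : seq V) e1 e2 :
  all (fun n => zcoef e1 n == zcoef e2 n) (iota 0 (size env)) ->
  zeval env e1 = zeval env e2.
Proof.
move=> /allP e12; rewrite !zevalE; apply: eq_bigr => i _; congr (_ *~ _).
by apply/eqP/e12; rewrite mem_iota ltn_ord.
Qed.

(** Atoms are compared by [unify], so that convertible occurrences share one index. The [match goal]
    lets this tactic run inside a function that returns a term. *)
Ltac zindex env x :=
  match env with
  | ?y :: _ => let _ := match goal with _ => unify x y end in constr:(0%N)
  | _ :: ?env' => let n := zindex env' x in constr:(S n)
  end.

Ltac zinsert env x :=
  match env with
  | _ => let n := zindex env x in env
  | _ => constr:(x :: env)
  end.

Ltac zatoms env t :=
  lazymatch t with
  | ?x + ?y => let env' := zatoms env x in zatoms env' y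
  | - ?x => zatoms env x
  | 0 => env
  | _ => zinsert env t
  end.

Ltac zreify env t :=
  lazymatch t with
  | ?x + ?y => let a := zreify env x in let b := zreify env y in constr:(ZAdd a b)
  | - ?x => let a := zreify env x in constr:(ZOpp a)
  | 0 => constr:(ZZero)
  | _ => let n := zindex env t in constr:(ZVar n)
  end.

(* Equalities in a commutative group, by comparison of coefficients. *)
Ltac zmodule :=
  lazymatch goal with
  | |- @eq ?T ?x ?y =>
    let env := zatoms (@nil T) x in let env := zatoms env y in
    let a := zreify env x in let b := zreify env y in
    apply: (@zeval_eq _ env a b); lazy; reflexivity
  end.

(** * Lie algebras of linear operators *)

Section LinearOperators.
Variables (R : comNzRingType) (V : lmodType R).
Implicit Types f g : V -> V.

Definition linop_pred : {pred V -> V} := fun f => `[< linear f >].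

Lemma linopBmod : submod_closed linop_pred.
Proof.
split=> [|c f g /asboolP lf /asboolP lg]; apply/asboolP => a x y.
  by rewrite scaler0 addr0.
rewrite !fctE lf lg !scalerDr !scalerA addrACA; congr (_ + _ + _).
by rewrite mulrC.
Qed.

HB.instance Definition _ :=
  GRing.isSubmodClosed.Build R (V -> V) linop_pred linopBmod.

Record linop := LinOp { linop_fun :> V -> V; linopP : linop_fun \in linop_pred }.

HB.instance Definition _ := [isSub for linop_fun].
HB.instance Definition _ := [Choice of linop by <:].
HB.instance Definition _ := [SubChoice_isSubLmodule of linop by <:].

Lemma linop_eq (f g : linop) : f =1 g -> f = g.
Proof. by move=> fg; apply/val_inj/funext. Qed.

Lemma linop_linear (f : linop) : linear f.
Proof. exact/asboolP/linopP. Qed.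

HB.instance Definition _ (f : linop) :=
  GRing.isLinear.Build R V V _ f (linop_linear f).

Lemma linop0 (f : linop) : f 0 = 0.
Proof. exact: linear0. Qed.

Lemma linopD (f : linop) x y : f (x + y) = f x + f y.
Proof. exact: linearD. Qed.

Lemma linopZ (f : linop) c x : f (c *: x) = c *: f x.
Proof. exact: linearZ. Qed.

Lemma linopB (f : linop) x y : f (x - y) = f x - f y.
Proof. exact: linearB. Qed.

Lemma linop_combE c (f g : linop) x : (c *: f + g) x = c *: f x + g x.
Proof. by []. Qed.

Lemma linop_addE (f g : linop) x : (f + g) x = f x + g x.
Proof. by []. Qed.

Lemma linop_scaleE c (f : linop) x : (c *: f) x = c *: f x.
Proof. by []. Qed.

Lemma linop_lie_subproof (f g : linop) : (fun x => f (g x) - g (f x)) \in linop_pred.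
Proof.
apply/asboolP => c x y.
by rewrite !linop_linear opprD addrACA scalerBr.
Qed.

Definition linop_lie (f g : linop) : linop := LinOp (linop_lie_subproof f g).

Lemma linop_lieE (f g : linop) x : linop_lie f g x = f (g x) - g (f x).
Proof. by []. Qed.

Lemma linop_linearl (g : linop) : linear (linop_lie^~ g).
Proof.
move=> c f f'; apply: linop_eq => x; rewrite linop_combE !linop_lieE !linop_combE.
by rewrite linop_linear scalerBr opprD addrACA.
Qed.

Lemma linop_linearr (f : linop) : linear (linop_lie f).
Proof.
move=> c g g'; apply: linop_eq => x; rewrite linop_combE !linop_lieE !linop_combE.
by rewrite linop_linear scalerBr opprD addrACA.
Qed.

Lemma linop_liexx (f : linop) : linop_lie f f = 0.
Proof. by apply: linop_eq => x; rewrite linop_lieE subrr. Qed.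

Lemma linop_jacobi (f g h : linop) : linop_lie f (linop_lie g h) +
  linop_lie g (linop_lie h f) + linop_lie h (linop_lie f g) = 0.
Proof.
apply: linop_eq => x; rewrite !linop_addE !linop_lieE !linopB.
exact: zmod_cancel6.
Qed.

HB.instance Definition _ := isLieAlgebra.Build R linop
  linop_linearl linop_linearr linop_liexx linop_jacobi.

Lemma lie_linopE (f g : linop) x : lie f g x = f (g x) - g (f x).
Proof. by []. Qed.

End LinearOperators.

(** * Calculus of brackets *)

Section LieTheory.
Variables (R : pzRingType) (L : lieAlgType R).
Implicit Types x y z : L.

Lemma lieDl x y z : lie (x + y) z = lie x z + lie y z.
Proof. by rewrite -[x]scale1r lie_linearl !scale1r. Qed.

Lemma lie0l x : lie 0 x = 0.
Proof. by apply: (addIr (lie 0 x)); rewrite -lieDl !add0r. Qed.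

Lemma lieZl c x y : lie (c *: x) y = c *: lie x y.
Proof. by rewrite -[c *: x]addr0 lie_linearl lie0l addr0. Qed.

Lemma lieNl x y : lie (- x) y = - lie x y.
Proof. by rewrite -scaleN1r lieZl scaleN1r. Qed.

Lemma lieDr x y z : lie x (y + z) = lie x y + lie x z.
Proof. by rewrite -[y]scale1r lie_linearr !scale1r. Qed.

Lemma lie0r x : lie x 0 = 0.
Proof. by apply: (addIr (lie x 0)); rewrite -lieDr !add0r. Qed.

Lemma lieZr c x y : lie x (c *: y) = c *: lie x y.
Proof. by rewrite -[c *: y]addr0 lie_linearr lie0r addr0. Qed.

Lemma lieNr x y : lie x (- y) = - lie x y.
Proof. by rewrite -scaleN1r lieZr scaleN1r. Qed.

Lemma lieC x y : lie x y = - lie y x.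
Proof.
have := liexx (x + y); rewrite lieDl !lieDr !liexx add0r addr0.
by move/eqP; rewrite addr_eq0 => /eqP.
Qed.

Lemma lie_leibniz x y z : lie x (lie y z) = lie (lie x y) z + lie y (lie x z).
Proof.
have := lie_jacobi x y z; rewrite [lie z (lie _ _)]lieC [lie z x]lieC lieNr.
move/eqP; rewrite subr_eq0 => /eqP <-; by rewrite subrK.
Qed.

End LieTheory.

(** * Evaluation of Lie terms *)

Section LieEvaluation.
Variables (R : pzRingType) (G : Type).

Fixpoint leval (L : lieAlgType R) (g : G -> L) (t : lieterm R G) : L :=
  match t with
  | Lgen x => g x
  | Lzero => 0
  | Ladd t u => leval g t + leval g u
  | Lscale c t => c *: leval g t
  | Lbr t u => lie (leval g t) (leval g u)
  end.

Lemma leval_iter (L : lieAlgType R) (g : G -> L) n x t :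
  leval g (iter n (Lbr (Lgen x)) t) = iter n (lie (g x)) (leval g t).
Proof. by elim: n => //= n ->. Qed.

Lemma leval_morph (L L' : lieAlgType R) (f : L -> L') (g : G -> L) t :
  lie_morphism f -> leval (f \o g) t = f (leval g t).
Proof.
case=> lf fL; have f0 : f 0 = 0.
  by apply: (addIr (f 0)); rewrite add0r -[X in X + _]scale1r -lf scaler0 addr0.
elim: t => [x||t It u Iu|c t It|t It u Iu] //=.
- by rewrite It Iu -[f _ in LHS]scale1r -lf scale1r.
- by rewrite It -[c *: leval g t]addr0 lf f0 addr0.
- by rewrite It Iu fL.
Qed.

End LieEvaluation.

Section LinopEvaluation.
Variables (R : comNzRingType) (V : lmodType R) (G : Type) (g : G -> linop V).
Implicit Types (t u : lieterm R G) (x : V).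

Lemma leval_addE t u x : leval g (Ladd t u) x = leval g t x + leval g u x.
Proof. by []. Qed.

Lemma leval_scaleE c t x : leval g (Lscale c t) x = c *: leval g t x.
Proof. by []. Qed.

Lemma leval_brE t u x :
  leval g (Lbr t u) x = leval g t (leval g u x) - leval g u (leval g t x).
Proof. by []. Qed.

End LinopEvaluation.

(** * The Cartan matrix of type E_k *)

Section CartanMatrix.
Variables (R : realType) (k : nat).
Implicit Types (i j : 'I_k) (x y : 'rV[R]_k.+1).

Lemma eps_linear n c x y : eps n (c *: x + y) = c * eps n x + eps n y.
Proof. by rewrite /eps; case: ifP => _; rewrite !mxE// opprD mulrN. Qed.

Lemma alpha_linear i c x y : alpha i (c *: x + y) = c * alpha i x + alpha i y.
Proof. by rewrite /alpha; case: ifP => _; rewrite !eps_linear; ring. Qed.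

Lemma eps_hb n m : (n <= k)%N -> (m <= k)%N ->
  eps n (hb R k m) = (-1) ^+ (n == 0)%N * (n == m)%:R.
Proof.
move=> nk mk; have E (a b : nat) : (a <= k)%N -> (b <= k)%N ->
    (inord a == inord b :> 'I_k.+1) = (a == b).
  by move=> ak bk; rewrite -(inj_eq val_inj) /= !inordK.
rewrite /eps /hb; case: ifPn => [/eqP->|_]; rewrite !mxE eqxx /=.
  have -> : ord0 = inord 0 :> 'I_k.+1 by apply: val_inj; rewrite /= inordK.
  by rewrite E// expr1 mulN1r.
by rewrite E// expr0 mul1r.
Qed.

Lemma epsB n x y : eps n (x - y) = eps n x - eps n y.
Proof. by rewrite -scaleN1r addrC eps_linear mulN1r addrC. Qed.

(** For the last node the value is -1 + 3, because [eps 0] takes the value -1 at [hb 0]. *)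
Lemma cartan_diag i : (3 <= k)%N -> cartan R i i = 2.
Proof.
move=> k3; have ik := ltn_ord i; rewrite /cartan /alpha /coroot.
case: eqVneq => [ei|ni]; rewrite !epsB !eps_hb //; try lia.
- by rewrite /= expr0 expr1; ring.
- have n1 : (i == i.+1 :> nat) = false by apply/eqP; lia.
  have n2 : (i.+1 == i :> nat) = false by apply/eqP; lia.
  rewrite /= !eqSS eqxx n1 n2 expr0 /=; ring.
Qed.

(** The Dynkin diagram is the chain of the nodes before the last one, with the last node attached to
    the node of index 2, the third one. For [k = 3] that node is the last one itself, which is then
    isolated. *)
Lemma cartanE i j : (3 <= k)%N -> i != j -> cartan R i j =
  if i.+1 == k then - (j == 2 :> nat)%:R else
  if j.+1 == k then - (i == 2 :> nat)%:R else
  - (i == j.+1 :> nat)%:R - (j == i.+1 :> nat)%:R.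
Proof.
move=> k3; rewrite -(inj_eq val_inj) => /= ij.
have [ik jk] := (ltn_ord i, ltn_ord j).
rewrite /cartan /alpha /coroot.
case: (eqVneq i.+1 k) => [ei|ni]; case: (eqVneq j.+1 k) => [ej|nj].
- by move/eqP: ij; case; lia.
- rewrite !epsB !eps_hb //; try lia; rewrite ?eqxx /= expr0.
  by case: (val j) nj => [|[|[|m]]] _ /=; rewrite ?eqSS /=; ring.
- rewrite !epsB !eps_hb //; try lia; rewrite ?eqxx /= expr0 expr1.
  by case: (val i) ni => [|[|[|m]]] _ /=; rewrite ?eqSS /=; ring.
- rewrite !epsB !eps_hb //; try lia; rewrite !eqSS /= expr0.
  have -> : (j == i :> nat) = false by rewrite eq_sym (negbTE ij).
  by rewrite [(j.+1 == i :> nat)]eq_sym /=; ring.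
Qed.

Lemma cartan_simply_laced i j : (3 <= k)%N -> i != j ->
  cartan R i j = 0 /\ cartan R j i = 0 \/ cartan R i j = -1 /\ cartan R j i = -1.
Proof.
move=> k3 ij; have ji : j != i by rewrite eq_sym.
rewrite (cartanE k3 ij) (cartanE k3 ji).
have [ei|_] := eqVneq i.+1 k; have [ej|_] := eqVneq j.+1 k.
- by case/eqP: ij; apply: val_inj; apply: succn_inj; exact: etrans ei (esym ej).
- by case: eqP => _; [right|left]; rewrite ?oppr0.
- by case: eqP => _; [right|left]; rewrite ?oppr0.
- case: eqP => [e1|_]; case: eqP => [e2|_]; rewrite ?subr0 ?oppr0 ?add0r ?addr0.
  + by lia.
  + by right.
  + by right.
  + by left.
Qed.

(** Cartan entries are reals, so [n] is known only through an equation in [R]. As the diagram is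
    simply laced, every Serre relation has one or two brackets, and both are checked by hand
    below. *)
Lemma serre_exponent i j n : (3 <= k)%N -> i != j -> n%:R = 1 - cartan R i j ->
  [/\ n = 1%N, cartan R i j = 0 & cartan R j i = 0] \/
  [/\ n = 2%N, cartan R i j = -1 & cartan R j i = -1].
Proof.
move=> k3 ij; case: (cartan_simply_laced k3 ij) => -[-> ->].
- by rewrite subr0 -[1]/(1%:R) => /eqP; rewrite eqr_nat => /eqP ->; left.
- by rewrite opprK -[1 + 1]/(2%:R) => /eqP; rewrite eqr_nat => /eqP ->; right.
Qed.

End CartanMatrix.

(** * Serre elements and the opposite generators *)

Section SerreCommutation.
Variables (R : realType) (k : nat) (L : lieAlgType R).
Variables (e f : 'I_k -> L) (h : 'rV[R]_k.+1 -> L).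
Hypothesis lie_he : forall x i, lie (h x) (e i) = alpha i x *: e i.
Hypothesis lie_ef : forall i j, lie (e i) (f j) = (i == j)%:R *: h (coroot R i).

(** Only the relations between [h] and [e] and between [e] and [f] are assumed. The lemma therefore
    applies to operators whose Serre relations are not yet known, and also with [e] and [f]
    exchanged and [h] negated. *)
Lemma serre_commute i j n l : (3 <= k)%N -> i != j -> n%:R = 1 - cartan R i j ->
  lie (f l) (iter n (lie (e i)) (e j)) = 0.
Proof.
move=> k3 ij nc.
have fe a b : lie (f a) (e b) = - ((b == a)%:R *: h (coroot R b)) by rewrite lieC lie_ef.
have eh a x : lie (e a) (h x) = - (alpha a x *: e a) by rewrite lieC lie_he.
have E1 : lie (f l) (lie (e i) (e j)) =
    (j == l)%:R *: (cartan R j i *: e i) - (i == l)%:R *: (cartan R i j *: e j).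
  rewrite lie_leibniz !fe lieNl lieZl lie_he lieNr lieZr eh.
  by rewrite scalerN opprK addrC.
case: (serre_exponent k3 ij nc) => -[-> cij cji] /=.
  by rewrite E1 cij cji !scale0r !scaler0 subr0.
(* The weight is 2 - 1 = 1, so for [l = i] the two contributions to the bracket are opposite. *)
have hX : lie (h (coroot R i)) (lie (e i) (e j)) = lie (e i) (e j).
  rewrite lie_leibniz !lie_he lieZr lieZl -!/(cartan _ _ _) cij (cartan_diag _ _ k3).
  by rewrite -scalerDl (_ : 2 - 1 = 1 :> R) ?scale1r//; ring.
rewrite lie_leibniz E1 cij cji fe !(lieNl, lieDr, lieNr, lieZr, lieZl) liexx hX.
by rewrite !scaler0 add0r scaleN1r scalerN opprK addNr.
Qed.
End SerreCommutation.

(** * Representations of the parabolic subalgebra *)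

Section ParabolicFamily.
Variables (R : realType) (k : nat).

(* The generator [f_k], which is not in [p_k], takes the dummy value 0; this only
  costs the relation for [e_k, f_k]. *)
Definition pk_family (L : lieAlgType R) (g : ekgen R k -> L) : Prop :=
  (forall i : 'I_k, i.+1 = k -> g (Ef R i) = 0) /\
  forall t u, ekrel t u ->
    (forall i : 'I_k, i.+1 = k -> t <> Lbr (Lgen (Ee R i)) (Lgen (Ef R i))) ->
    leval g t = leval g u.

(** These terms represent the elements of [p_k]; two of them may be equal in [g_k] through terms
    that are not of this kind. *)
Fixpoint pterm (t : lieterm R (ekgen R k)) : bool :=
  match t with
  | Lgen (Ef i) => (i.+1 < k)%N
  | Lgen _ => true
  | Lzero => true
  | Ladd t u => pterm t && pterm u
  | Lscale _ t => pterm t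
  | Lbr t u => pterm t && pterm u
  end.

End ParabolicFamily.

(** * The coinduced module *)

Section Coinduction.
Variables (R : realType) (k : nat) (k3 : (3 <= k)%N).
Variables (V : lmodType R) (g : ekgen R k -> linop V).
Hypothesis gP : pk_family g.

Local Notation hk := 'rV[R]_k.+1.
Local Notation W := (seq 'I_k -> V).
Implicit Types (i j l : 'I_k) (x y : hk) (P Q : W) (z : seq 'I_k).

Local Notation E i := (g (Ee R i)).
Local Notation F i := (g (Ef R i)).
Local Notation H x := (g (Eh x)).

Lemma gHlinear c x y (v : V) : H (c *: x + y) v = c *: H x v + H y v.
Proof. by case: gP => _ /(_ _ _ (ek_hlinear c x y)) /= -> //. Qed.

Lemma gHH x y : lie (H x) (H y) = 0.
Proof. by case: gP => _ /(_ _ _ (ek_hh x y)) /= -> //. Qed.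

Lemma gHE x i : lie (H x) (E i) = alpha i x *: E i.
Proof. by case: gP => _ /(_ _ _ (ek_he x i)) /= -> //. Qed.

Lemma gHF x i : lie (H x) (F i) = - alpha i x *: F i.
Proof. by case: gP => _ /(_ _ _ (ek_hf x i)) /= -> //. Qed.

Lemma gEF i j : (j.+1 < k)%N -> lie (E i) (F j) = (i == j)%:R *: H (coroot R i).
Proof.
move=> jk; have [->|ij] := eqVneq i j.
  rewrite scale1r; case: gP => _ /(_ _ _ (ek_ef R j)) /= -> // l lk [jl].
  by move: jk; rewrite jl lk ltnn.
rewrite scale0r; case: gP => _ /(_ _ _ (ek_ef0 R ij)) /= -> // l lk [il jl].
by rewrite il jl eqxx in ij.
Qed.

Lemma gEE i j n : i != j -> n%:R = 1 - cartan R i j ->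
  iter n (lie (E i)) (E j) = 0.
Proof.
move=> ij nc; case: gP => _ /(_ _ _ (ek_serre_e ij nc)).
by rewrite leval_iter; apply => l _; case: n nc => [|[|n]].
Qed.

Lemma gFF i j n : i != j -> n%:R = 1 - cartan R i j ->
  iter n (lie (F i)) (F j) = 0.
Proof.
move=> ij nc; case: gP => _ /(_ _ _ (ek_serre_f ij nc)).
by rewrite leval_iter; apply => l _; case: n nc => [|[|n]].
Qed.

(* An element of [W] is a [U(p)]-linear map [P : U(g) -> V], recorded by its
  values at the monomials in the [f_j]: [P [:: j_1; ..; j_m]] stands for the
  value at [f_(j_m) .. f_(j_1)].  The action [(x P) a = P (a x)] of the
  generators then takes the following form. *)
Definition fop j P : W := fun u => P (j :: u).

(** The recursion moves the operator to the left of the monomial: [f_j h = h f_j + alpha_j(h) f_j]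
    here, and [f_j e_i = e_i f_j] minus a possible coroot in [eop]. At the empty monomial linearity
    over [p_k] applies. *)
Fixpoint hop x P u : V :=
  match u with
  | [::] => H x (P [::])
  | j :: v => hop x (fop j P) v + alpha j x *: P (j :: v)
  end.

Fixpoint eop i P u : V :=
  match u with
  | [::] => E i (P [::])
  | j :: v => eop i (fop j P) v - (i == j)%:R *: hop (coroot R i) P v
  end.

Lemma fop_linop j : fop j \in @linop_pred R W.
Proof. by apply/asboolP => c P Q. Qed.

Lemma fopD j c P Q : fop j (c *: P + Q) = c *: fop j P + fop j Q.
Proof. by []. Qed.

Lemma hop_linop x : hop x \in @linop_pred R W.
Proof.
apply/asboolP => c P Q; apply/funext => u; rewrite !fctE.
elim: u P Q => [|j u IH] P Q /=; first by rewrite -linop_linear.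
rewrite fopD IH !scalerDr !scalerA addrACA; congr (_ + _ + _).
by rewrite mulrC.
Qed.

Lemma eop_linop i : eop i \in @linop_pred R W.
Proof.
apply/asboolP => c P Q; apply/funext => u; rewrite !fctE.
elim: u P Q => [|j u IH] P Q /=; first by rewrite -linop_linear.
have /asboolP -> := hop_linop (coroot R i).
rewrite fopD IH !scalerDr !scalerN !scalerA opprD addrACA.
by congr (_ + _ + _); rewrite mulrC.
Qed.

Definition gW (a : ekgen R k) : linop W :=
  match a with
  | Ee i => LinOp (eop_linop i)
  | Ef j => LinOp (fop_linop j)
  | Eh x => LinOp (hop_linop x)
  end.

Local Notation e i := (gW (Ee R i)).
Local Notation f j := (gW (Ef R j)).
Local Notation h x := (gW (Eh x)).

(** This and [W_ef] are the recursion clauses of [hop] and [eop], so they hold on all of [W]. They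
    are what makes the criterion [W_eq0] applicable to the remaining relations. *)
Lemma W_hf x j : lie (h x) (f j) = - alpha j x *: f j.
Proof.
apply: linop_eq => P; apply/funext => u; rewrite lie_linopE scaleNr.
by rewrite [LHS]/= !fctE /fop /= opprD addNKr.
Qed.

Lemma W_ef i j : lie (e i) (f j) = (i == j)%:R *: h (coroot R i).
Proof.
apply: linop_eq => P; apply/funext => u; rewrite lie_linopE.
by rewrite [LHS]/= /fop /= opprB addrC subrK.
Qed.

(* [X P (j :: u) = X (f_j P) u] reduces every value to one at the empty monomial. *)
Lemma W_eq0 (X : linop W) : (forall j, lie (f j) X = 0) ->
  (forall P, X P [::] = 0) -> X = 0.
Proof.
move=> fX X0; apply: linop_eq => P; apply/funext => u.
elim: u P => [|j u IH] P; first exact: X0.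
have := congr1 (fun Y : linop W => Y P u) (fX j).
rewrite lie_linopE [X in X = _]/= /fop fctE => /eqP.
by rewrite subr_eq0 => /eqP ->; rewrite IH.
Qed.

Lemma W_hlinear c x y : h (c *: x + y) = c *: h x + h y.
Proof.
apply: linop_eq => P; apply/funext => u; rewrite linop_combE !fctE /=.
elim: u P => [|j u IH] P /=; first exact: gHlinear.
rewrite IH alpha_linear scalerDl -!scalerA addrACA.
by rewrite scalerDr.
Qed.

Lemma W_fh x j : lie (f j) (h x) = alpha j x *: f j.
Proof. by rewrite lieC W_hf scaleNr opprK. Qed.

Lemma W_fe i j : lie (f j) (e i) = - ((i == j)%:R *: h (coroot R i)).
Proof. by rewrite lieC W_ef. Qed.

Lemma W_hh x y : lie (h x) (h y) = 0.
Proof.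
apply: W_eq0 => [j|P].
  by rewrite lie_leibniz !W_fh lieZl W_fh lieZr W_hf scaleNr scalerN !scalerA mulrC subrr.
have := congr1 (fun Y : linop V => Y (P [::])) (gHH x y).
by rewrite !lie_linopE.
Qed.

Lemma W_he x i : lie (h x) (e i) = alpha i x *: e i.
Proof.
apply/eqP; rewrite -subr_eq0; apply/eqP; apply: W_eq0 => [j|P].
  rewrite lieDr lieNr lieZr lie_leibniz W_fh W_fe lieNr lieZr W_hh lieZl W_fe.
  rewrite scaler0 subr0 !scalerN opprK; case: eqP => [->|_].
    by rewrite addNr.
  by rewrite !scale0r !scaler0 ?oppr0 ?addr0.
have EE : lie (H x) (E i) (P [::]) - (alpha i x *: E i) (P [::]) = 0.
  by rewrite gHE subrr.
exact: EE.
Qed.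

Lemma W_serre_e i j n : i != j -> n%:R = 1 - cartan R i j ->
  iter n (lie (e i)) (e j) = 0.
Proof.
move=> ij nc; apply: W_eq0 => [l|P].
  exact: (serre_commute W_he W_ef).
(* At the empty monomial [e i] acts as [E i], so the Serre element of [W] is evaluated by that of
   [V]. *)
have -> : forall m P, (iter m (lie (e i)) (e j)) P [::] =
    (iter m (lie (E i)) (E j)) (P [::]).
  elim=> [//|m IH] Q; rewrite !iterS !lie_linopE -(IH Q).
  by rewrite (_ : E i (Q [::]) = e i Q [::])// -(IH (e i Q)).
by rewrite gEE.
Qed.

Definition serre_f i j n : linop W := iter n (lie (f i)) (f j).

Definition shift z P : W := fun u => P (z ++ u).

(** The last letter of a word is the leftmost factor, so the first clause is linearity over the
    [f_i] in [p_k]. Since [W] consists of functions on words, that is, on the free algebra, the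
    second clause says that [P] vanishes on the two-sided ideal of the Serre elements: [shift z]
    supplies the right factor, and the argument of the resulting function the left one. *)
Definition coind P : Prop :=
  (forall i u, (i.+1 < k)%N -> P (rcons u i) = F i (P u)) /\
  forall i j n z, i != j -> n%:R = 1 - cartan R i j ->
    serre_f i j n (shift z P) = 0.

Lemma coind_comb c P Q : coind P -> coind Q -> coind (c *: P + Q).
Proof.
move=> [P1 P2] [Q1 Q2]; split=> [i u ik|i j n z ij nc].
  by rewrite linop_linear -P1// -Q1.
have -> : shift z (c *: P + Q) = c *: shift z P + shift z Q by [].
by rewrite linop_linear P2// Q2// scaler0 addr0.
Qed.

Lemma coind0 : coind 0.
Proof.
split=> [i u _|i j n z _ _]; first exact/esym/(linop0 (F i)).
by have -> : shift z 0 = 0 by []; exact: (linop0 (serre_f i j n)).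
Qed.

Lemma coind_f j P : coind P -> coind (f j P).
Proof.
move=> [P1 P2]; split=> [i u|i l n z]; first exact: (P1 i (j :: u)).
exact: (P2 i l n (j :: z)).
Qed.

Lemma lie_h_serre x i j n :
  exists c, lie (h x) (serre_f i j n) = c *: serre_f i j n.
Proof.
elim: n => [|n [c IH]]; first by exists (- alpha j x); exact: W_hf.
exists (- alpha i x + c); rewrite /serre_f iterS -/(serre_f i j n).
by rewrite lie_leibniz IH W_hf lieZl lieZr -scalerDl.
Qed.

(** The monomial [z] is a weight vector, so moving [h] past it costs only a multiple of the
    identity. *)
Lemma shift_h x z P : exists c, shift z (h x P) = h x (shift z P) + c *: shift z P.
Proof.
elim: z P => [|j z IH] P; first by exists 0; rewrite scale0r addr0.
have [c Ec] := IH (f j P); exists (c + alpha j x).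
apply/funext => u; rewrite !fctE scalerDl addrA.
by have := congr1 (fun Q : W => Q u) Ec; rewrite !fctE => <-.
Qed.

Lemma coind_h x P : coind P -> coind (h x P).
Proof.
move=> [P1 P2]; split=> [i u ik|i j n z ij nc].
- change (hop x P (rcons u i) = F i (hop x P u)).
  elim: u P P1 {P2} => [|j u IH] P P1 /=.
    have := congr1 (fun Y : linop V => Y (P [::])) (gHF x i).
    rewrite lie_linopE linop_scaleE /fop -(P1 i [::] ik) /= => /eqP.
    by rewrite subr_eq scaleNr addrC -subr_eq opprK => /eqP.
  rewrite -/(rcons _ _) IH => [|l v lk]; last exact: (P1 l (j :: v)).
  by rewrite /fop linopD linopZ -P1.
- have [c ->] := shift_h x z P; have [c' Eh] := lie_h_serre x i j n.
  rewrite linopD linopZ /= P2// scaler0 addr0.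
  have := congr1 (fun Y : linop W => Y (shift z P)) Eh.
  rewrite lie_linopE linop_scaleE P2// linop0 scaler0 add0r => /eqP.
  by rewrite oppr_eq0 => /eqP.
Qed.

Lemma coind_e l P : coind P -> coind (e l P).
Proof.
move=> cP; split=> [i u ik|i j n z ij nc].
- change (eop l P (rcons u i) = F i (eop l P u)).
  elim: u P cP => [|j u IH] P cP /=.
    have := congr1 (fun Y : linop V => Y (P [::])) (gEF l ik).
    rewrite lie_linopE linop_scaleE /fop -(cP.1 i [::] ik) /= => <-.
    by rewrite subKr.
  rewrite -/(rcons _ _) IH; last exact: coind_f.
  by rewrite linopB linopZ; congr (_ - _ *: _); exact: (coind_h _ cP).1.
- elim: z P cP => [|m z IH] P cP.
    have fe : lie (e l) (serre_f i j n) = 0.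
      (* The roles of [e] and [f] are exchanged, and [h] is negated so that the [f] have weights
         [alpha]. *)
      apply: (@serre_commute R k _ (fun a => f a) (fun a => e a) (fun x => - h x)) => //.
      + by move=> x a; rewrite lieNl W_hf scaleNr opprK.
      + move=> a b; rewrite W_fe scalerN; case: eqVneq => [->//|_].
        by rewrite !scale0r oppr0.
    have := congr1 (fun Y : linop W => Y P) fe.
    rewrite lie_linopE [X in e l X](cP.2 i j n [::])// linop0 sub0r => /eqP.
    by rewrite oppr_eq0 => /eqP.
  have -> : shift (m :: z) (e l P) =
      shift z (e l (f m P)) - (l == m)%:R *: shift z (h (coroot R l) P) by [].
  rewrite linopB linopZ /= IH; last exact: coind_f.
  by rewrite (coind_h _ cP).2// scaler0 subr0.
Qed.

Lemma coind_leval (t : lieterm R (ekgen R k)) P : coind P -> coind (leval gW t P).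
Proof.
elim: t P => [[i|j|x]||t It u Iu|c t It|t It u Iu] P cP.
- exact: coind_e.
- exact: coind_f.
- exact: coind_h.
- exact: coind0.
- have := coind_comb 1 (It _ cP) (Iu _ cP); by rewrite scale1r.
- have := coind_comb c (It _ cP) coind0; by rewrite addr0.
- have := coind_comb (-1) (Iu _ (It _ cP)) (It _ (Iu _ cP)).
  by rewrite scaleN1r addrC.
Qed.

(** Induction over the derivation of an equality in [g_k]. Membership in [coind] serves the Serre
    relations in the [f_j]; in the congruence rule for brackets it is transported by
    [coind_leval]. *)
Lemma leval_lieeq t u P : lieeq (@ekrel R k) t u -> coind P ->
  leval gW t P = leval gW u P.
Proof.
move=> tu; elim: tu P => {t u}.
- by [].
- by move=> t u _ IH P cP; rewrite IH.
- by move=> t u v _ IH _ IH' P cP; rewrite IH// IH'.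
- by move=> t t' u u' _ IH _ IH' P cP; rewrite !leval_addE IH// IH'.
- by move=> c t t' _ IH P cP; rewrite !leval_scaleE IH.
- move=> t t' u u' _ IH _ IH' P cP; rewrite !leval_brE (IH' P)// (IH P)//.
  by rewrite (IH (leval gW u' P)) ?(IH' (leval gW t' P))//; exact: coind_leval.
- by move=> t u v P _; congr (linop_fun _ P); rewrite /= addrA.
- by move=> t u P _; congr (linop_fun _ P); rewrite /= addrC.
- by move=> t P _; congr (linop_fun _ P); rewrite /= add0r.
- by move=> t P _; congr (linop_fun _ P); rewrite /= scaleN1r addNr.
- by move=> c c' t P _; congr (linop_fun _ P); rewrite /= scalerA.
- by move=> t P _; congr (linop_fun _ P); rewrite /= scale1r.
- by move=> c t u P _; congr (linop_fun _ P); rewrite /= scalerDr.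
- by move=> c c' t P _; congr (linop_fun _ P); rewrite /= scalerDl.
- by move=> c t t' u P _; congr (linop_fun _ P); rewrite /= lieDl lieZl.
- by move=> c t u u' P _; congr (linop_fun _ P); rewrite /= lieDr lieZr.
- by move=> t P _; congr (linop_fun _ P); rewrite /= liexx.
- by move=> t u v P _; congr (linop_fun _ P); rewrite /= lie_jacobi.
- move=> t u; case=> {t u}.
  + by move=> c x y P _; congr (linop_fun _ P); exact: W_hlinear.
  + by move=> x y P _; congr (linop_fun _ P); exact: W_hh.
  + by move=> x i P _; congr (linop_fun _ P); exact: W_he.
  + by move=> x i P _; congr (linop_fun _ P); exact: W_hf.
  + by move=> i P _; congr (linop_fun _ P); have := W_ef i i; rewrite eqxx scale1r.
  + by move=> i j ij P _; congr (linop_fun _ P); have := W_ef i j; rewrite (negbTE ij) scale0r.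
  + by move=> i j n ij nc P _; rewrite leval_iter W_serre_e.
  + move=> i j n ij nc P cP; rewrite leval_iter.
    exact: (cP.2 i j n [::] ij nc).
Qed.

(** Evaluation at 1 is a morphism of [p_k]-modules from the coinduced module to [V]. *)
Lemma leval_nil t P : pterm t -> coind P -> leval gW t P [::] = leval g t (P [::]).
Proof.
elim: t P => [[i|j|x]||t It u Iu|c t It|t It u Iu] P //.
- by move=> jk cP; exact: (cP.1 j [::]).
- by move=> /andP[pt pu] cP; rewrite !leval_addE fctE -It// -Iu.
- by move=> pt cP; rewrite !leval_scaleE fctE -It.
- move=> /andP[pt pu] cP; rewrite !leval_brE fctE -(It P)// -(Iu P)//.
  by rewrite -(It (leval gW u P)) -?(Iu (leval gW t P))//; exact: coind_leval.
Qed.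

(* The [U(p)]-linear extension of [1 |-> v]; it vanishes on monomials in which
  [f_k] occurs because [f_k] acts on [V] as the dummy value 0. *)
Definition coext (v : V) : W := foldl (fun a j => F j a) v.

Lemma coext_coind v : coind (coext v).
Proof.
split=> [i u _|i j n z ij nc]; first by rewrite /coext -cats1 foldl_cat.
have -> : shift z (coext v) = coext (coext v z).
  by apply/funext => u; rewrite /shift /coext foldl_cat.
(* By construction [f i] sends [coext a] to [coext (F i a)], so Serre elements pass inside
   [coext]. *)
have -> : forall m a, iter m (lie (f i)) (f j) (coext a) =
    coext (iter m (lie (F i)) (F j) a).
  have coextB a b : coext (a - b) = coext a - coext b.
    apply/funext => u; rewrite !fctE.
    by elim: u a b => [|l u IH] a b //=; rewrite linopB IH.
  elim=> [//|m IH] a; rewrite !iterS !lie_linopE IH coextB.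
  by congr (_ - _); exact: IH.
rewrite gFF//; apply/funext => u; rewrite /coext /=.
by elim: u => //= l u IH; rewrite linop0.
Qed.

(** Each [v] in [V] is the value at 1 of [coext v], and there the equality can be checked in the
    [g_k]-module. *)
Lemma leval_pk_lieeq t u : pterm t -> pterm u -> lieeq (@ekrel R k) t u ->
  leval g t = leval g u.
Proof.
move=> pt pu tu; apply: linop_eq => v; have cv := coext_coind v.
by rewrite -[v]/(coext v [::]) -!leval_nil// (leval_lieeq tu cv).
Qed.

End Coinduction.

(** * Morphisms out of the parabolic subalgebra *)

Section ParabolicMorphism.
Variables (R : realType) (k : nat) (k3 : (3 <= k)%N).
Variables (L : lieAlgType R) (V : lmodType R) (rho : L -> linop V).
Hypotheses (rho_morph : lie_morphism rho) (rho_inj : injective rho).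
Variable g : ekgen R k -> L.
Hypothesis gP : pk_family g.

Lemma pk_family_rho : pk_family (rho \o g).
Proof.
case: gP => gF gR; split=> [i /gF /= ->|t u tu ntu].
  by apply: (addIr (rho 0)); rewrite add0r -[X in X + _]scale1r -rho_morph.1 scaler0 addr0.
by rewrite !leval_morph// (gR t u).
Qed.

(** Coinduction needs a module, so the equality in [L] is tested through the faithful representation
    [rho]. *)
Lemma leval_pi t u : pterm t -> pterm u ->
  \pi_(gk R k) t = \pi_(gk R k) u -> leval g t = leval g u.
Proof.
move=> pt pu /lie_pres_eqP tu; apply: rho_inj.
by rewrite -!leval_morph//; exact: leval_pk_lieeq pk_family_rho _ _ pt pu tu.
Qed.

Lemma pk_term (x : pk R k) : exists t, pterm t /\ \pi_(gk R k) t = lie_gen_val x.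
Proof.
case: x => x /= /asboolP /(_ (fun x => exists t, pterm t /\ \pi_(gk R k) t = x)).
apply.
  split=> [|c y z [t [pt <-]] [u [pu <-]]|y z [t [pt <-]] [u [pu <-]]].
  - by exists Lzero.
  - exists (Ladd (Lscale c t) u); split; first by rewrite /= pt.
    by rewrite lie_piD lie_piZ.
  - by exists (Lbr t u); split; [rewrite /= pt | exact: lie_piL].
move=> y; case=> [x'|i|i ik].
- by exists (Lgen (Eh x')).
- by exists (Lgen (Ee R i)).
- by exists (Lgen (Ef R i)).
Qed.

(** The morphism evaluates a chosen term without [f_k] over each element; [leval_pi] makes the
    choice immaterial. *)
Theorem pk_morphism : exists phi : pk R k -> L,
  [/\ lie_morphism phi, forall x, phi (pk_h x) = g (Eh x),
      forall i, phi (pk_e R i) = g (Ee R i) &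
      forall (i : 'I_k) (ik : (i.+1 < k)%N), phi (pk_f R ik) = g (Ef R i)].
Proof.
have [T TP] := choice pk_term.
have E x t : pterm t -> \pi_(gk R k) t = lie_gen_val x -> leval g (T x) = leval g t.
  by have [pT piT] := TP x => pt tE; apply: leval_pi => //; rewrite piT.
exists (fun x => leval g (T x)); split.
- split=> [c x y|x y]; have [px xE] := TP x; have [py yE] := TP y.
  + rewrite (E _ (Ladd (Lscale c (T x)) (T y)))//= ?px//.
    by rewrite lie_piD lie_piZ xE yE.
  + rewrite (E _ (Lbr (T x) (T y)))//= ?px//.
    by rewrite lie_piL xE yE.
- by move=> x; rewrite (E _ (Lgen (Eh x))).
- by move=> i; rewrite (E _ (Lgen (Ee R i))).
- by move=> i ik; rewrite (E _ (Lgen (Ef R i))).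
Qed.

End ParabolicMorphism.

Section Uniqueness.
Variables (R : realType) (k : nat) (L : lieAlgType R).

Lemma pk_ind (S : pk R k -> Prop) : S 0 ->
  (forall (c : R) x y, S x -> S y -> S (c *: x + y)) ->
  (forall x y, S x -> S y -> S (lie x y)) ->
  (forall x, S (pk_h x)) -> (forall i, S (pk_e R i)) ->
  (forall (i : 'I_k) (ik : (i.+1 < k)%N), S (pk_f R ik)) -> forall x, S x.
Proof.
move=> S0 SD SL Sh Se Sf [x xX].
(* Generation is expressed by predicates on [g_k], hence the predicate of having a preimage in [p_k]
   that satisfies [S]. *)
have [] // : exists y : pk R k, lie_gen_val y = x /\ S y.
  move/asboolP: (xX) => /(_ (fun x => exists y, lie_gen_val y = x /\ S y)); apply.
    split=> [|c _ _ [y [<- Sy]] [z [<- Sz]]|_ _ [y [<- Sy]] [z [<- Sz]]].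
    - by exists 0.
    - by exists (c *: y + z); split => //; exact: SD.
    - by exists (lie y z); split => //; exact: SL.
  move=> _ [y|i|i ik].
  - by exists (pk_h y).
  - by exists (pk_e R i).
  - by exists (pk_f R ik).
move=> y [yx Sy]; rewrite (_ : LieGen xX = y)//; exact: val_inj.
Qed.

Lemma pk_morph_eq (phi psi : pk R k -> L) :
  lie_morphism phi -> lie_morphism psi ->
  (forall x, phi (pk_h x) = psi (pk_h x)) ->
  (forall i, phi (pk_e R i) = psi (pk_e R i)) ->
  (forall (i : 'I_k) (ik : (i.+1 < k)%N), phi (pk_f R ik) = psi (pk_f R ik)) ->
  phi = psi.
Proof.
move=> [lp Lp] [ls Ls] eh ee ef; apply/funext; apply: pk_ind => //.
- have z (f : pk R k -> L) : linear f -> f 0 = 0.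
    by move=> lf; apply: (addIr (f 0)); rewrite add0r -[X in X + _]scale1r -lf scaler0 addr0.
  by rewrite !z.
- by move=> c x y Ex Ey; rewrite lp ls Ex Ey.
- by move=> x y Ex Ey; rewrite Lp Ls Ex Ey.
Qed.

End Uniqueness.

(** * The exterior algebra and its action on the model *)

Section Augmentation.
Variables (R : realType) (G : Type) (deg : G -> nat).
Local Notation M := (fgca R deg).
Implicit Types (a b : M) (n : int).

Lemma aug_linear c a b : aug (c *: a + b) = c * aug a + aug b.
Proof.
by elim/quotW: a => t; elim/quotW: b => u; rewrite -fgca_piZ -fgca_piD !aug_pi.
Qed.

Lemma aug_eq0 : aug (0 : M) = 0.
Proof. by rewrite fgca_pi0 aug_pi. Qed.

Lemma aug_add a b : aug (a + b) = aug a + aug b.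
Proof. by have := aug_linear 1 a b; rewrite scale1r mul1r. Qed.

Lemma aug_scale c a : aug (c *: a) = c * aug a.
Proof. by have := aug_linear c a 0; rewrite addr0 aug_eq0 addr0. Qed.

Lemma aug_opp a : aug (- a) = - aug a.
Proof. by rewrite -scaleN1r aug_scale mulN1r. Qed.

Lemma augM a b : aug (a * b) = aug a * aug b.
Proof. by elim/quotW: a => t; elim/quotW: b => u; rewrite -fgca_piM !aug_pi. Qed.

Lemma aug1 : aug (1 : M) = 1.
Proof. by rewrite fgca_pi1 aug_pi. Qed.

Lemma aug_gen x : aug (gen R deg x) = 0.
Proof. exact: aug_pi. Qed.

Lemma homog_const c : homog 0 (c *: 1 : M).
Proof. exact/homogZ/homog1. Qed.

Lemma homogN n a : homog n a -> homog n (- a).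
Proof. by rewrite -scaleN1r; apply: homogZ. Qed.

Lemma homogB n a b : homog n a -> homog n b -> homog n (a - b).
Proof. by move=> ha hb; apply/homogD/homogN. Qed.

Lemma homog_sum n (I : Type) (r : seq I) (F : I -> M) :
  (forall i, homog n (F i)) -> homog n (\sum_(i <- r) F i).
Proof.
by move=> hF; elim/big_ind: _ => [|a b|i _]; [exact: homog0|exact: homogD|exact: hF].
Qed.

Lemma homog_eq m n a : m = n -> homog m a -> homog n a.
Proof. by move=> ->. Qed.

End Augmentation.

Section GradedCommutator.
Variables (R : realType) (G : Type) (deg : G -> nat).
Local Notation M := (fgca R deg).
Implicit Types (p q n : int) (D E : M -> M).

Lemma gder_comm p q D E : gderivation p D -> gderivation q E ->
  gderivation (p + q) (fun a => D (E a) - (-1) ^+ (`|p| * `|q|)%N *: E (D a)).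
Proof.
move=> gD gE; have [_ hD LD] := gD; have [_ hE LE] := gE.
set eps := (-1) ^+ (`|p| * `|q|)%N; have eps2 : eps * eps = 1 :> R.
  by rewrite /eps -exprD addnn -mul2n exprM sqrrN !expr1n.
split.
- move=> c a b; rewrite !(gderD gD, gderD gE, gderZ gD, gderZ gE).
  by rewrite scalerBr scalerDr !scalerA [eps * c]mulrC opprD addrACA.
- move=> n a ha; apply: homogB.
    by rewrite addrA addrAC; apply/hD/hE.
  by apply: homogZ; rewrite addrA; apply/hE/hD.
- move=> n a b ha; rewrite (LE _ _ _ ha) (LD _ _ _ ha).
  rewrite !(gderD gD, gderD gE, gderZ gD, gderZ gE).
  rewrite (LD _ _ _ ha) (LE _ _ _ ha) (LD _ _ _ (hE _ _ ha)) (LE _ _ _ (hD _ _ ha)).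
  rewrite [(absz (p + q)%R * _)%N]mulnC !sgn_abszD -/eps.
  rewrite [(`|q| * `|p|)%N]mulnC -/eps [(`|n| * `|p|)%N]mulnC [(`|n| * `|q|)%N]mulnC.
  set sp := (-1) ^+ (`|p| * `|n|); set sq := (-1) ^+ (`|q| * `|n|).
  rewrite !scalerDr !scalerA mulrBl mulrBr scalerBr -!scalerAl -!scalerAr !scalerA.
  rewrite [eps * (sq * eps)]mulrCA eps2 mulr1 [eps * sp]mulrC [sq * sp]mulrC.
  by rewrite [sp * eps * sq]mulrAC zmod_cancel2.
Qed.

Lemma gder_ext p D E : gderivation p D -> gderivation p E ->
  (forall x, D (gen R deg x) = E (gen R deg x)) -> D =1 E.
Proof.
move=> gD gE DE; apply: fgca_ind.
- by move=> a b Da Db; rewrite (gderD gD) (gderD gE) Da Db.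
- by move=> c a Da; rewrite (gderZ gD) (gderZ gE) Da.
- by rewrite (gder1 gD) (gder1 gE).
- move=> x a Da; have [_ _ LD] := gD; have [_ _ LE] := gE.
  by rewrite (LD _ _ _ (homog_gen R deg x)) (LE _ _ _ (homog_gen R deg x)) DE Da.
Qed.

End GradedCommutator.


(** * Contractions, derivations and parity on the exterior algebra *)

Section Exterior.
Variables (R : realType) (k : nat).

(* The exterior algebra on generators [xi i]; [xi i] will act on the model as
  [s_i]. *)
Local Notation Lam := (fgca R (fun _ : 'I_k => 1%N)).
Local Notation M := (tmodel R k).
Implicit Types (x y : Lam) (a b : M) (i j l : 'I_k) (A B : 'M[R]_k).

Definition xi i : Lam := gen R (fun _ : 'I_k => 1%N) i.

Lemma xiC i j : xi i * xi j = - (xi j * xi i).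
Proof. by rewrite gen_comm scaleN1r. Qed.

Lemma Lam_ind (P : Lam -> Prop) : (forall x y, P x -> P y -> P (x + y)) ->
  (forall c x, P x -> P (c *: x)) -> P 1 -> (forall i x, P x -> P (xi i * x)) ->
  forall x, P x.
Proof. exact: fgca_ind. Qed.

Definition hook j : Lam -> Lam := dext (-1) (fun i => (i == j)%:R *: 1).

Lemma hook_gder j : gderivation (-1) (hook j).
Proof. by apply: dext_gderivation => i; exact: homog_const. Qed.

Lemma hookM j i x : hook j (xi i * x) = (i == j)%:R *: x - xi i * hook j x.
Proof.
have [_ _ L] := hook_gder j; rewrite (L _ _ _ (homog_gen R _ i)) scaleN1r.
by rewrite {1}/hook dext_gen ?mulr_algl// => l; exact: homog_const.
Qed.

Lemma hook1 j : hook j 1 = 0.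
Proof. exact: gder1 (hook_gder j). Qed.

(** This is contragredient to the action of [A] on the [w_i] by rows: the pairing [sum_i w_i xi_i],
    through which the differential is expressed, becomes invariant. *)
Definition delta A : Lam -> Lam := dext 0 (fun j => - \sum_i A i j *: xi i).

Lemma delta_gen_homog A j : homog 1 (- \sum_i A i j *: xi i).
Proof.
apply: homogN; apply: homog_sum => i; apply: homogZ.
exact: (homog_gen R (fun _ : 'I_k => 1%N)).
Qed.

Lemma delta_gder A : gderivation 0 (delta A).
Proof. by apply: dext_gderivation => j; rewrite addr0; exact: delta_gen_homog. Qed.

Lemma deltaM A j x : delta A (xi j * x) = xi j * delta A x - \sum_i A i j *: (xi i * x).
Proof.
have [_ _ L] := delta_gder A; rewrite (L _ _ _ (homog_gen R _ j)) mul0n scale1r addrC.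
congr (_ + _); rewrite /delta dext_gen => [|l].
  by rewrite mulNr mulr_suml; under eq_bigr do rewrite -scalerAl.
by rewrite addr0; exact: delta_gen_homog.
Qed.

Lemma delta1 A : delta A 1 = 0.
Proof. exact: gder1 (delta_gder A). Qed.

Local Notation piL t := (\pi_(fgca R (fun _ : 'I_k => 1%N)) t).

Definition tau x : Lam := piL (gctwist (fun _ : 'I_k => 1%N) 1 (repr x)).

Lemma tau_pi t : tau (piL t) = piL (gctwist (fun _ : 'I_k => 1%N) 1 t).
Proof. exact/pi_twist/fgca_repr. Qed.

Lemma tau_linear c x y : tau (c *: x + y) = c *: tau x + tau y.
Proof.
elim/quotW: x => t; elim/quotW: y => u.
by rewrite -fgca_piZ -fgca_piD !tau_pi /= fgca_piD fgca_piZ.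
Qed.

Lemma tauM i x : tau (xi i * x) = - (xi i * tau x).
Proof.
elim/quotW: x => t; rewrite -fgca_piM !tau_pi /= fgca_piM fgca_piZ.
by rewrite scaleN1r mulNr.
Qed.

Lemma tau1 : tau 1 = 1.
Proof. by rewrite fgca_pi1 tau_pi. Qed.

Lemma tau_homog n x : homog n x -> homog n (tau x).
Proof. by move=> hx; rewrite /tau (twist_homog 1 hx); exact: homogZ. Qed.

Lemma tauD x y : tau (x + y) = tau x + tau y.
Proof. by rewrite -[x]scale1r tau_linear !scale1r. Qed.

Lemma tau0 : tau 0 = 0.
Proof. by rewrite {1}fgca_pi0 tau_pi. Qed.

Lemma tauZ c x : tau (c *: x) = c *: tau x.
Proof. by rewrite -[c *: x]addr0 tau_linear tau0 addr0. Qed.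

Lemma tauN x : tau (- x) = - tau x.
Proof. by rewrite -scaleN1r tauZ scaleN1r. Qed.

(** The parity is exactly the sign of moving an odd generator across [x]. *)
Lemma tau_xi x i : tau x * xi i = xi i * x.
Proof.
elim/Lam_ind: x => [x y Ix Iy|c x Ix||j x Ix].
- by rewrite tauD mulrDl mulrDr Ix Iy.
- by rewrite tauZ -scalerAl -scalerAr Ix.
- by rewrite tau1 mul1r mulr1.
- by rewrite tauM mulNr -mulrA Ix !mulrA [xi i * xi j]xiC mulNr.
Qed.

Lemma hook_anti i j x : hook i (hook j x) = - hook j (hook i x).
Proof.
apply/eqP; rewrite -addr_eq0; apply/eqP.
have gD := gder_anticomm (p := -1) (q := -1) isT isT (hook_gder i) (hook_gder j).
apply: (gder_eq0 gD) => l.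
have iE m : hook m (gen R _ l) = (l == m)%:R *: 1.
  by apply: dext_gen => ?; exact: homog_const.
by rewrite !iE !(gderZ (hook_gder _)) !hook1 !scaler0 addr0.
Qed.

Lemma hook_sq j x : hook j (hook j x) = 0.
Proof.
have := hook_anti j j x => /eqP; rewrite -addr_eq0 -mulr2n -scaler_nat scaler_eq0.
by rewrite pnatr_eq0 => /eqP.
Qed.

Lemma hookD j x y : hook j (x + y) = hook j x + hook j y.
Proof. exact: gderD (hook_gder j) _ _. Qed.
Lemma hookN j x : hook j (- x) = - hook j x.
Proof. exact: gderN (hook_gder j) _. Qed.
Lemma hookZ j c x : hook j (c *: x) = c *: hook j x.
Proof. exact: gderZ (hook_gder j) _ _. Qed.
Lemma deltaD A x y : delta A (x + y) = delta A x + delta A y.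
Proof. exact: gderD (delta_gder A) _ _. Qed.
Lemma deltaN A x : delta A (- x) = - delta A x.
Proof. exact: gderN (delta_gder A) _. Qed.
Lemma deltaZ A c x : delta A (c *: x) = c *: delta A x.
Proof. exact: gderZ (delta_gder A) _ _. Qed.

Lemma tau_hook j x : tau (hook j x) = - hook j (tau x).
Proof.
elim/Lam_ind: x => [x y Ix Iy|c x Ix||i x Ix].
- by rewrite hookD !tauD hookD Ix Iy opprD.
- by rewrite hookZ !tauZ hookZ Ix scalerN.
- by rewrite tau1 hook1 tau0 oppr0.
- rewrite tauM hookN !hookM tauD tauZ tauN tauM Ix mulrN. by rewrite !opprK.
Qed.

Lemma tau_delta A x : tau (delta A x) = delta A (tau x).
Proof.
elim/Lam_ind: x => [x y Ix Iy|c x Ix||i x Ix].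
- by rewrite deltaD !tauD deltaD Ix Iy.
- by rewrite deltaZ !tauZ deltaZ Ix.
- by rewrite tau1 delta1 tau0.
- rewrite tauM deltaN !deltaM tauD tauM Ix tauN (big_morph tau tauD tau0).
  rewrite opprD; congr (_ - _); rewrite -sumrN; apply: eq_bigr => l _.
  by rewrite tauZ tauM scalerN.
Qed.

(** Contractions are dual to the [xi_i], so they transform by the rows of [A], as the [w_i] do. *)
Lemma delta_hook A j x :
  delta A (hook j x) = hook j (delta A x) + \sum_l A j l *: hook l x.
Proof.
elim/Lam_ind: x => [x y Ix Iy|c x Ix||i x Ix].
- rewrite !(hookD, deltaD) Ix Iy addrACA -big_split /=; congr (_ + _).
  by apply: eq_bigr => l _; rewrite hookD scalerDr.
- rewrite !(hookZ, deltaZ) Ix scalerDr scaler_sumr; congr (_ + _).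
  by apply: eq_bigr => l _; rewrite hookZ !scalerA mulrC.
- rewrite delta1 hook1 (gder0 (delta_gder A)) (gder0 (hook_gder j)) add0r.
  by rewrite big1// => l _; rewrite hook1 scaler0.
- rewrite hookM deltaD deltaN deltaZ !deltaM Ix hookD hookM hookN.
  rewrite (big_morph _ (hookD j) (gder0 (hook_gder j))).
  have -> : \sum_l A j l *: hook l (xi i * x) =
      A j i *: x - xi i * \sum_l A j l *: hook l x.
    rewrite mulr_sumr (bigD1 i)//= [in RHS](bigD1 i)//= hookM eqxx scale1r scalerBr.
    rewrite opprD [RHS]addrA -scalerAr -sumrN; congr (_ + _).
    apply: eq_bigr => l li; rewrite hookM eq_sym (negbTE li) scale0r sub0r.
    by rewrite scalerN -scalerAr.
  have -> : \sum_l hook j (A l i *: (xi l * x)) =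
      A j i *: x - \sum_l A l i *: (xi l * hook j x).
    rewrite (bigD1 j)//= [in RHS](bigD1 j)//= hookZ hookM eqxx scale1r scalerBr.
    rewrite opprD [RHS]addrA -sumrN; congr (_ + _).
    apply: eq_bigr => l li; rewrite hookZ hookM (negbTE li) scale0r sub0r.
    by rewrite scalerN.
  by rewrite mulrDr; zmodule.
Qed.

(** The matrix products come in reversed order because [A] acts on the [xi_i] as minus a matrix. *)
Lemma delta_bracket A B x :
  delta A (delta B x) - delta B (delta A x) = delta (B *m A - A *m B) x.
Proof.
elim/Lam_ind: x => [x y Ix Iy|c x Ix||i x Ix].
- by rewrite !deltaD -Ix -Iy opprD addrACA.
- by rewrite !deltaZ -Ix scalerBr.
- by rewrite !delta1 !(gder0 (delta_gder _)) subrr.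
(* The two mixed sums together are symmetric in [C] and [D], so in the commutator only the matrix
   products survive. *)
- have dd C D : delta C (delta D (xi i * x)) = xi i * delta C (delta D x)
      - \sum_l C l i *: (xi l * delta D x) - \sum_l D l i *: (xi l * delta C x)
      + \sum_l (C *m D) l i *: (xi l * x).
    rewrite deltaM deltaD deltaN deltaM (big_morph _ (deltaD C) (gder0 (delta_gder C))).
    rewrite -!addrA; congr (_ + (_ + _)).
    under eq_bigr => l _ do rewrite deltaZ deltaM scalerBr.
    rewrite sumrB opprB addrC; congr (_ + _).
    under eq_bigr => l _ do rewrite scaler_sumr.
    rewrite exchange_big; apply: eq_bigr => l _ /=; rewrite mxE scaler_suml.
    by apply: eq_bigr => m _; rewrite scalerA mulrC.
  rewrite !dd deltaM -Ix mulrBr.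
  have -> : \sum_l (B *m A - A *m B) l i *: (xi l * x) =
      \sum_l (B *m A) l i *: (xi l * x) - \sum_l (A *m B) l i *: (xi l * x).
    by rewrite -sumrB; apply: eq_bigr => l _; rewrite !mxE scalerBl.
  set u := \sum_l (A *m B) l i *: _; set v := \sum_l (B *m A) l i *: _.
  by zmodule.
Qed.

End Exterior.

(** * Monomials of the exterior algebra *)

Section Words.
Variables (R : realType) (k : nat).
Local Notation Lam := (fgca R (fun _ : 'I_k => 1%N)).
Implicit Types (x y : Lam) (i j l : 'I_k) (r : seq 'I_k) (n : int).
Local Notation xi := (@xi R k).

Definition xis r : Lam := foldr (fun i x => xi i * x) 1 r.

Lemma xis_cat r1 r2 : xis (r1 ++ r2) = xis r1 * xis r2.
Proof. by elim: r1 => [|i r IH] /=; rewrite ?mul1r// IH mulrA. Qed.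

Lemma homog_xis r : homog (size r)%:Z (xis r).
Proof.
elim: r => [|i r IH] /=; first exact: homog1.
apply: (homog_eq (m := 1 + (size r)%:Z)); first by lia.
apply: homogM => //; exact: (homog_gen R (fun _ : 'I_k => 1%N)).
Qed.

Inductive xis_span n : Lam -> Prop :=
| xis_span0 : xis_span n 0
| xis_spanD x y : xis_span n x -> xis_span n y -> xis_span n (x + y)
| xis_spanZ c x : xis_span n x -> xis_span n (c *: x)
| xis_span_xis r : (size r)%:Z = n -> xis_span n (xis r).

Lemma homog_xis_span n x : homog n x -> xis_span n x.
Proof.
elim=> {n x}.
- exact: xis_span0.
- by move=> *; exact: xis_spanD.
- by move=> *; exact: xis_spanZ.
- exact: (@xis_span_xis _ [::]).
- by move=> i; rewrite -[gen _ _ _]mulr1; exact: (@xis_span_xis _ [:: i]).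
- move=> m n x y _ hx _ hy; elim: hx => {x}.
  + by rewrite mul0r; exact: xis_span0.
  + by move=> *; rewrite mulrDl; exact: xis_spanD.
  + by move=> *; rewrite -scalerAl; exact: xis_spanZ.
  + move=> r rm; elim: hy => {y}.
    * by rewrite mulr0; exact: xis_span0.
    * by move=> *; rewrite mulrDr; exact: xis_spanD.
    * by move=> *; rewrite -scalerAr; exact: xis_spanZ.
    * move=> r' rn; rewrite -xis_cat; apply: xis_span_xis.
      by rewrite size_cat PoszD rm rn.
Qed.

Lemma xi_xis i r1 r2 : xi i * xis (r1 ++ r2) = (-1) ^+ size r1 *: xis (r1 ++ i :: r2).
Proof.
elim: r1 => [|j r1 IH] /=; first by rewrite scale1r.
by rewrite mulrA xiC mulNr -mulrA IH -scalerAr exprS mulN1r scaleNr.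
Qed.

Lemma xi_sq i : xi i * xi i = 0.
Proof.
have /eqP := xiC R i i; rewrite -addr_eq0 -mulr2n -scaler_nat scaler_eq0.
by rewrite pnatr_eq0 => /eqP.
Qed.

(** The sign is the one in the definition of [s_op], so sorted monomials match the generators of the
    model. *)
Lemma xi_xis_enum i (I : {set 'I_k}) : xi i * xis (enum I) =
  if i \in I then 0 else ssign R i I *: xis (enum (i |: I)).
Proof.
have [[r1 r2] /= e1 [e2 ->]] := enum_splitU1 R i I; rewrite e1 e2.
case: ifP => _; rewrite xi_xis//.
rewrite (_ : xis (r1 ++ [:: i, i & r2]) = 0) ?scaler0//.
by rewrite xis_cat /= [xi i * _]mulrA xi_sq mul0r mulr0.
Qed.

Lemma Lam_enum_ind (P : Lam -> Prop) :
  (forall x y, P x -> P y -> P (x + y)) -> (forall c x, P x -> P (c *: x)) ->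
  (forall I : {set 'I_k}, P (xis (enum I))) -> forall x, P x.
Proof.
move=> PD PZ PI x.
have P0 : P 0 by rewrite -[X in P X](scale0r (xis (enum set0))); exact: PZ.
(* The predicate is quantified inside because the step for [xi i] uses the hypothesis at [S]
   composed with multiplication by [xi i]. *)
pose Q y := forall (S : Lam -> Prop), (forall x y, S x -> S y -> S (x + y)) ->
  (forall c x, S x -> S (c *: x)) -> S 0 ->
  (forall I : {set 'I_k}, S (xis (enum I))) -> S y.
suff Qx : Q x by exact: (Qx P PD PZ P0 PI).
elim/Lam_ind: x => [x y Qx Qy|c x Qx||i x Qx] S SD SZ S0 SI.
- exact: (SD _ _ (Qx S SD SZ S0 SI) (Qy S SD SZ S0 SI)).
- exact: (SZ _ _ (Qx S SD SZ S0 SI)).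
- by have := SI set0; rewrite enum_set0.
- apply: (Qx (fun y => S (xi i * y))) => [y z Sy Sz|c y Sy||I].
  + by rewrite mulrDr; exact: SD.
  + by rewrite -scalerAr; exact: SZ.
  + by rewrite mulr0.
  + by rewrite xi_xis_enum; case: ifP => _ //; exact: SZ.
Qed.

End Words.

(** * The exterior algebra acting on the model *)

Section ExteriorAction.
Variables (R : realType) (k : nat).
Local Notation Lam := (fgca R (fun _ : 'I_k => 1%N)).
Local Notation M := (tmodel R k).
Local Notation xi := (@xi R k).
Local Notation xis := (@xis R k).
Local Notation g4 := (g4 R k).
Local Notation g7 := (g7 R k).
Local Notation w := (w_gen R).
Implicit Types (x y : Lam) (a b : M) (i j l : 'I_k) (r : seq 'I_k) (n m : int).

Fixpoint act_term (t : gcterm R 'I_k) a : M :=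
  match t with
  | GCgen i => s_op i a
  | GCconst c => c *: a
  | GCadd t u => act_term t a + act_term u a
  | GCmul t u => act_term t (act_term u a)
  end.

Lemma sD i a b : s_op i (a + b) = s_op i a + s_op i b.
Proof. exact: gderD (s_gderivation R i) _ _. Qed.
Lemma sZ i c a : s_op i (c *: a) = c *: s_op i a.
Proof. exact: gderZ (s_gderivation R i) _ _. Qed.
Lemma s0 i : s_op i (0 : M) = 0.
Proof. exact: gder0 (s_gderivation R i). Qed.

Lemma act_term_linear t c a b : act_term t (c *: a + b) = c *: act_term t a + act_term t b.
Proof.
elim: t a b => [i|c'|t It u Iu|t It u Iu] a b /=.
- by rewrite sD sZ.
- by rewrite scalerDr !scalerA mulrC.
- by rewrite It Iu scalerDr addrACA.
- by rewrite Iu It.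
Qed.

Lemma act_term_eq t u a : gceq (fun _ : 'I_k => 1%N) t u -> act_term t a = act_term u a.
Proof.
move=> tu; elim: tu a => {t u} /=.
- by [].
- by move=> ? ? _ IH a; rewrite IH.
- by move=> ? ? ? _ IH _ IH' a; rewrite IH IH'.
- by move=> ? ? ? ? _ IH _ IH' a; rewrite IH IH'.
- by move=> ? ? ? ? _ IH _ IH' a; rewrite IH IH'.
- by move=> *; rewrite addrA.
- by move=> *; rewrite addrC.
- by move=> *; rewrite scale0r add0r.
- by [].
- by move=> *; rewrite scale1r.
- by move=> *; rewrite !scale0r.
- by [].
- move=> t u v a; have := act_term_linear t 1 (act_term u a) (act_term v a).
  by rewrite !scale1r.
- by move=> *; rewrite scalerDl.
- by move=> *; rewrite scalerA.
- move=> c t a; have := act_term_linear t c a 0; rewrite !addr0 => ->.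
  have := act_term_linear t (-1) 0 0; rewrite scaler0 addr0 scaleN1r addNr.
  by move=> ->; rewrite addr0.
- by move=> i j a; rewrite s_anticomm scaleN1r.
Qed.

Definition act x a : M := act_term (repr x) a.

Lemma act_pi t a : act (\pi_(Lam) t) a = act_term t a.
Proof. exact/act_term_eq/fgca_repr. Qed.

Lemma actD x y a : act (x + y) a = act x a + act y a.
Proof. by elim/quotW: x => t; elim/quotW: y => u; rewrite -fgca_piD !act_pi. Qed.

Lemma actZ c x a : act (c *: x) a = c *: act x a.
Proof. by elim/quotW: x => t; rewrite -fgca_piZ !act_pi. Qed.

Lemma act1 a : act 1 a = a.
Proof. by rewrite fgca_pi1 act_pi /= scale1r. Qed.

Lemma act0 a : act 0 a = 0.
Proof. by rewrite -(scale0r (0 : Lam)) actZ scale0r. Qed.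

Lemma actN x a : act (- x) a = - act x a.
Proof. by rewrite -scaleN1r actZ scaleN1r. Qed.

Lemma act_sum (I : Type) (s : seq I) (F : I -> Lam) a :
  act (\sum_(i <- s) F i) a = \sum_(i <- s) act (F i) a.
Proof. exact: (big_morph (act^~ a) (fun x y => actD x y a) (act0 a)). Qed.

Lemma act_xi i x a : act (xi i * x) a = s_op i (act x a).
Proof. by elim/quotW: x => t; rewrite -fgca_piM !act_pi. Qed.

Lemma act_linear x c a b : act x (c *: a + b) = c *: act x a + act x b.
Proof. exact: act_term_linear. Qed.

Lemma act_xis r a : act (xis r) a = sI r a.
Proof. by elim: r => [|i r IH] /=; rewrite ?act1// act_xi IH. Qed.

Lemma act_homog n m x a : homog n x -> homog m a -> homog (m - n) (act x a).
Proof.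
move=> /homog_xis_span hx ha; elim: hx => {x}.
- by rewrite act0; exact: homog0.
- by move=> *; rewrite actD; exact: homogD.
- by move=> *; rewrite actZ; exact: homogZ.
- by move=> r <-; rewrite act_xis; exact: sI_homog.
Qed.

Lemma sI_g7_big r : (6 < size r)%N -> sI r g7 = 0.
Proof.
have [//|[I [c [<- ->]]] I6] : sI r g7 = 0 \/
    exists (I : {set 'I_k}) c, #|I| = size r /\ sI r g7 = c *: sg7 R I; last first.
  by rewrite sg7_big ?scaler0.
elim: r => [|i r [Ir|[I [c [Ir E]]]]] /=.
- by right; exists set0, 1; rewrite cards0 scale1r.
- by left; rewrite Ir s0.
- rewrite E sZ s_sg7; case: ifPn => iI.
    by left; rewrite scaler0.
  right; exists (i |: I), (c * ssign R i I).
  by rewrite cardsU1 iI Ir scalerA.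
Qed.

Lemma act_g4_big n x : homog n x -> 3 < n -> act x g4 = 0.
Proof.
move=> /homog_xis_span; elim=> {x}.
- by rewrite act0.
- by move=> x y _ Ix _ Iy n3; rewrite actD Ix// Iy// addr0.
- by move=> c x _ Ix n3; rewrite actZ Ix// scaler0.
- by move=> r <- r3; rewrite act_xis sI_g4_big.
Qed.

Lemma act_g7_big n x : homog n x -> 6 < n -> act x g7 = 0.
Proof.
move=> /homog_xis_span; elim=> {x}.
- by rewrite act0.
- by move=> x y _ Ix _ Iy n3; rewrite actD Ix// Iy// addr0.
- by move=> c x _ Ix n3; rewrite actZ Ix// scaler0.
- by move=> r <- r3; rewrite act_xis sI_g7_big.
Qed.

Lemma sg4_act I : sg4 R I = act (xis (enum I)) g4.
Proof. by rewrite act_xis; case: (sg_sI R I). Qed.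

Lemma sg7_act I : sg7 R I = act (xis (enum I)) g7.
Proof. by rewrite act_xis; case: (sg_sI R I). Qed.

Lemma act_wM x l a : act x (w l * a) = w l * act x a.
Proof.
elim/Lam_ind: x => [x y Ix Iy|c x Ix||i x Ix].
- by rewrite !actD Ix Iy mulrDr.
- by rewrite !actZ Ix scalerAr.
- by rewrite !act1.
- by rewrite !act_xi Ix s_wM.
Qed.

Lemma act_aD x a b : act x (a + b) = act x a + act x b.
Proof. by have := act_linear x 1 a b; rewrite !scale1r. Qed.

Lemma act_a0 x : act x 0 = 0.
Proof. by apply: (addIr (act x 0)); rewrite -act_aD !add0r. Qed.

Lemma act_aZ x c a : act x (c *: a) = c *: act x a.
Proof. by rewrite -[c *: a]addr0 act_linear act_a0 addr0. Qed.

Lemma act_aN x a : act x (- a) = - act x a.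
Proof. by rewrite -scaleN1r act_aZ scaleN1r. Qed.

Lemma act_asum x (I : Type) (s : seq I) (F : I -> M) :
  act x (\sum_(i <- s) F i) = \sum_(i <- s) act x (F i).
Proof. exact: (big_morph (act x) (act_aD x) (act_a0 x)). Qed.

Lemma act_mul_xi x i a : act (x * xi i) a = act x (s_op i a).
Proof.
elim/Lam_ind: x => [x y Ix Iy|c x Ix||j x Ix].
- by rewrite mulrDl !actD Ix Iy.
- by rewrite -scalerAl !actZ Ix.
- by rewrite mul1r -[xi i]mulr1 act_xi !act1.
- by rewrite -mulrA !act_xi Ix.
Qed.

Lemma d_act x a : d_op (act x a) = act (tau x) (d_op a).
Proof.
have gd := d_gderivation R k.
elim/Lam_ind: x => [x y Ix Iy|c x Ix||j x Ix].
- by rewrite tauD !actD (gderD gd) Ix Iy.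
- by rewrite tauZ !actZ (gderZ gd) Ix.
- by rewrite tau1 !act1.
- by rewrite tauM actN !act_xi d_sC Ix.
Qed.

(** The parity created by moving [d] across [act x] is absorbed when [xi i] is moved to the front;
    the differential of [act x g4] is thus free of signs. *)
Lemma act_tau_sum_ws x a :
  act (tau x) (\sum_i w i * s_op i a) = \sum_i w i * act (xi i * x) a.
Proof. by rewrite act_asum; apply: eq_bigr => i _; rewrite act_wM -act_mul_xi tau_xi. Qed.

Lemma d_act_g4 x : d_op (act x g4) = \sum_i w i * act (xi i * x) g4.
Proof. by rewrite d_act d_g4 act_tau_sum_ws. Qed.

Lemma d_act_g7 x : d_op (act x g7) =
  - (2^-1 *: act (tau x) (g4 * g4)) + \sum_i w i * act (xi i * x) g7.
Proof. by rewrite d_act d_g7 act_aD act_aN act_aZ act_tau_sum_ws. Qed.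

Lemma act_gder_ext p (D E : M -> M) : gderivation p D -> gderivation p E ->
  (forall x, D (act x g4) = E (act x g4)) -> (forall x, D (act x g7) = E (act x g7)) ->
  (forall i, D (w i) = E (w i)) -> D =1 E.
Proof.
move=> gD gE DE4 DE7 DEw; apply: (gder_ext gD gE).
apply: (@tgen_ind R k (fun a => D a = E a)) => [I|J|i]; last exact: DEw.
- by rewrite sg4_act DE4.
- by rewrite sg7_act DE7.
Qed.

Section Extension.
Variables (p : int) (P4 P7 : Lam -> M) (om : 'I_k -> M).
Hypotheses (P4D : forall x y, P4 (x + y) = P4 x + P4 y)
  (P4Z : forall c x, P4 (c *: x) = c *: P4 x)
  (P7D : forall x y, P7 (x + y) = P7 x + P7 y)
  (P7Z : forall c x, P7 (c *: x) = c *: P7 x)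
  (P4h : forall n x, homog n x -> homog (4 - n + p) (P4 x))
  (P7h : forall n x, homog n x -> homog (7 - n + p) (P7 x))
  (P4_big : forall n x, homog n x -> 3 < n -> P4 x = 0)
  (P7_big : forall n x, homog n x -> 6 < n -> P7 x = 0)
  (omh : forall i, homog (2 + p) (om i)).

Definition ext_gen (z : tgen k) : M :=
  match z with
  | inl (inl A) => P4 (xis (enum (val A)))
  | inl (inr B) => P7 (xis (enum (val B)))
  | inr i => om i
  end.

Definition ext : M -> M := dext p ext_gen.

Lemma ext_gen_homog z : homog ((tdeg z)%:Z + p) (ext_gen z).
Proof.
case: z => [[A|B]|i] /=; last exact: omh.
- have := P4h (homog_xis R (enum (val A))); apply: homog_eq.
  rewrite -cardE; by rewrite /= -subzn ?(leq_trans (valP A)).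
- have := P7h (homog_xis R (enum (val B))); apply: homog_eq.
  by rewrite -cardE /= -subzn ?(leq_trans (valP B)).
Qed.

Lemma ext_gder : gderivation p ext.
Proof. exact/dext_gderivation/ext_gen_homog. Qed.

Lemma ext_w i : ext (w i) = om i.
Proof. by rewrite /ext /w_gen /tvar dext_gen//; exact: ext_gen_homog. Qed.

(** The derivation is defined on sorted monomials only. [P4_big] makes the formula hold for all [x],
    since monomials of length above 3 annihilate [g4]; likewise 6 for [g7]. *)
Lemma ext_g4 x : ext (act x g4) = P4 x.
Proof.
elim/Lam_enum_ind: x => [x y Ix Iy|c x Ix|I].
- by rewrite actD (gderD ext_gder) Ix Iy.
- by rewrite actZ (gderZ ext_gder) Ix.
- rewrite -sg4_act /sg4; case: insubP => [u uI <-|I3] /=.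
    by rewrite /ext /tvar dext_gen//; exact: ext_gen_homog.
  rewrite (gder0 ext_gder) (P4_big (homog_xis R (enum I)))//.
  by rewrite -cardE ltz_nat ltnNge.
Qed.

Lemma ext_g7 x : ext (act x g7) = P7 x.
Proof.
elim/Lam_enum_ind: x => [x y Ix Iy|c x Ix|I].
- by rewrite actD (gderD ext_gder) Ix Iy.
- by rewrite actZ (gderZ ext_gder) Ix.
- rewrite -sg7_act /sg7; case: insubP => [u uI <-|I3] /=.
    by rewrite /ext /tvar dext_gen//; exact: ext_gen_homog.
  rewrite (gder0 ext_gder) (P7_big (homog_xis R (enum I)))//.
  by rewrite -cardE ltz_nat ltnNge.
Qed.

End Extension.

End ExteriorAction.

(** * Derivations of the minimal model *)

Section HomogAug.
Variables (R : realType) (G : Type) (deg : G -> nat).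
Local Notation M := (fgca R deg).
Implicit Types (a b : M) (n p : int).

Lemma homog_aug n a : homog n a -> n != 0 -> aug a = 0.
Proof.
elim=> {n a}.
- by move=> *; rewrite aug_eq0.
- by move=> n a b _ Ia _ Ib n0; rewrite aug_add Ia// Ib// addr0.
- by move=> n c a _ Ia n0; rewrite aug_scale Ia// mulr0.
- by rewrite eqxx.
- by move=> x _; rewrite aug_gen.
- move=> m n a b _ Ia _ Ib mn; rewrite augM; have [m0|m0] := eqVneq m 0.
    by rewrite Ib ?mulr0//; move: mn; rewrite m0 add0r.
  by rewrite Ia// mul0r.
Qed.

(** Generators have positive degree and [D] preserves degrees, so their images have augmentation 0.
    Compatibility with the augmentation is therefore automatic. *)
Lemma gder_aug (D : M -> M) : (forall x, (0 < deg x)%N) -> gderivation 0 D ->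
  forall a, aug (D a) = 0.
Proof.
move=> deg0 gD; have [_ h L] := gD; apply: fgca_ind.
- by move=> a b Da Db; rewrite (gderD gD) aug_add Da Db addr0.
- by move=> c a Da; rewrite (gderZ gD) aug_scale Da mulr0.
- by rewrite (gder1 gD) aug_eq0.
- move=> x a Da; rewrite (L _ _ _ (homog_gen R deg x)) aug_add aug_scale !augM.
  rewrite aug_gen mul0r mulr0 addr0 (homog_aug (h _ _ (homog_gen R deg x))) ?mul0r//.
  by rewrite addr0 eqz_nat -lt0n.
Qed.

Lemma gder_comm0 p (D E : M -> M) : gderivation 0 D -> gderivation p E ->
  gderivation p (fun a => D (E a) - E (D a)).
Proof.
move=> gD gE; have := gder_comm gD gE; rewrite add0r mul0n expr0 => -[l h L].
by split=> [c a b|n a ha|n a b ha];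
  [have := l c a b | have := h n a ha | have := L n a b ha]; rewrite !scale1r.
Qed.

Lemma gder_lincomb p (I : Type) (r : seq I) (c : I -> R) (E : I -> M -> M) :
  (forall i, gderivation p (E i)) ->
  gderivation p (fun a => \sum_(i <- r) c i *: E i a).
Proof.
move=> gE; split.
- move=> e a b; rewrite scaler_sumr -big_split; apply: eq_bigr => i _ /=.
  by rewrite (gderD (gE i)) (gderZ (gE i)) scalerDr !scalerA mulrC.
- by move=> n a ha; apply: homog_sum => i; apply: homogZ; case: (gE i) => _ h _; exact: h.
- move=> n a b ha; rewrite mulr_suml mulr_sumr scaler_sumr -big_split.
  apply: eq_bigr => i _ /=; case: (gE i) => _ _ L; rewrite (L _ _ _ ha) scalerDr.
  by rewrite -scalerAl -scalerAr !scalerA mulrC.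
Qed.

End HomogAug.

Section ModelDerivationFamilies.
Variables (R : realType) (k : nat).
Local Notation Lam := (fgca R (fun _ : 'I_k => 1%N)).
Local Notation M := (tmodel R k).
Local Notation xi := (@xi R k).
Local Notation g4 := (g4 R k).
Local Notation g7 := (g7 R k).
Local Notation w := (w_gen R).
Implicit Types (x y : Lam) (a b : M) (i j l : 'I_k) (A B : 'M[R]_k) (n m : int).

Lemma tdeg_gt0 (z : tgen k) : (0 < tdeg z)%N.
Proof.
case: z => [[A|B]|i] //=; rewrite subn_gt0 ltnS.
- exact: valP A.
- exact: valP B.
Qed.

Lemma tder_predP (D : M -> M) : gderivation 0 D ->
  (forall a, D (d_op a) = d_op (D a)) -> D \in @tder_pred R k.
Proof. by move=> gD dD; apply/asboolP; split => //; exact: gder_aug tdeg_gt0 gD. Qed.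

Lemma act_gder_eq0 p (D : M -> M) : gderivation p D ->
  (forall x, D (act x g4) = 0) -> (forall x, D (act x g7) = 0) ->
  (forall i, D (w i) = 0) -> forall a, D a = 0.
Proof.
move=> gD D4 D7 Dw; apply: (tder_eq0 gD) => [I|J|i]; last exact: Dw.
- by rewrite sg4_act D4.
- by rewrite sg7_act D7.
Qed.

Lemma homog_act_g4 n x : homog n x -> homog (4 - n + 0) (act x g4).
Proof. by move=> hx; rewrite addr0; exact: act_homog hx (homog_g4 R k). Qed.

Lemma homog_act_g7 n x : homog n x -> homog (7 - n + 0) (act x g7).
Proof. by move=> hx; rewrite addr0; exact: act_homog hx (homog_g7 R k). Qed.

(** * The action of gl_k x R *)

Section LeviDerivation.
Variables (A : 'M[R]_k) (c : R).

(** The scalar at [g7] is twice that at [g4] because the differential of [g7] contains the square of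
    [g4]. *)
Definition levi : M -> M := ext 0 (fun x => act (delta A x + c *: x) g4)
  (fun x => act (delta A x + (2 * c) *: x) g7) (fun i => \sum_l A i l *: w l).

Let lhom n x e : homog n x -> homog n (delta A x + e *: x).
Proof.
move=> hx; apply: homogD; last exact: homogZ.
by case: (delta_gder A) => _ h _; have := h _ _ hx; rewrite addr0.
Qed.

Let lD e x y a : act (delta A (x + y) + e *: (x + y)) a =
  act (delta A x + e *: x) a + act (delta A y + e *: y) a.
Proof. by rewrite -actD deltaD scalerDr addrACA. Qed.

Let lZ e e' x a : act (delta A (e' *: x) + e *: (e' *: x)) a =
  e' *: act (delta A x + e *: x) a.
Proof. by rewrite -actZ deltaZ scalerDr !scalerA mulrC. Qed.

Let lw i : homog (2 + 0) (\sum_l A i l *: w l).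
Proof. by rewrite addr0; apply: homog_sum => l; apply/homogZ/homog_w. Qed.

Let l4 n x : homog n x -> homog (4 - n + 0) (act (delta A x + c *: x) g4).
Proof. by move=> hx; exact/homog_act_g4/lhom. Qed.

Let l7 n x : homog n x -> homog (7 - n + 0) (act (delta A x + (2 * c) *: x) g7).
Proof. by move=> hx; exact/homog_act_g7/lhom. Qed.

Lemma levi_gder : gderivation 0 levi.
Proof. exact: ext_gder. Qed.

Lemma levi_w i : levi (w i) = \sum_l A i l *: w l.
Proof. exact: ext_w. Qed.

Lemma levi_act_g4 x : levi (act x g4) = act (delta A x + c *: x) g4.
Proof. by apply: ext_g4 => // n y hy; apply: act_g4_big; exact: lhom. Qed.

Lemma levi_act_g7 x : levi (act x g7) = act (delta A x + (2 * c) *: x) g7.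
Proof. by apply: ext_g7 => // n y hy; apply: act_g7_big; exact: lhom. Qed.

Lemma levi_g4 : levi g4 = c *: g4.
Proof. by have := levi_act_g4 1; rewrite delta1 add0r actZ act1. Qed.

Lemma levi_g7 : levi g7 = (2 * c) *: g7.
Proof. by have := levi_act_g7 1; rewrite delta1 add0r actZ act1. Qed.

Lemma levi_s j a : levi (s_op j a) - s_op j (levi a) = \sum_i (- A i j) *: s_op i a.
Proof.
move: a; apply: (act_gder_ext (gder_comm0 levi_gder (s_gderivation R j))).
- by apply: gder_lincomb => i; exact: s_gderivation.
- move=> x; rewrite -act_xi !levi_act_g4 -act_xi -actN -actD deltaM mulrDr.
  rewrite -scalerAr -sumrN; under [RHS]eq_bigr do rewrite -act_xi -actZ scaleNr.
  by rewrite -act_sum; congr act; zmodule.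
- move=> x; rewrite -act_xi !levi_act_g7 -act_xi -actN -actD deltaM mulrDr.
  rewrite -scalerAr -sumrN; under [RHS]eq_bigr do rewrite -act_xi -actZ scaleNr.
  by rewrite -act_sum; congr act; zmodule.
- move=> i; rewrite s_w (gder0 levi_gder) levi_w (gder_sum (s_gderivation R j)).
  rewrite !big1 ?subrr// => l _; last by rewrite sZ s_w scaler0.
  by rewrite s_w scaler0.
Qed.

Lemma levi_act x a : levi (act x a) = act (delta A x) a + act x (levi a).
Proof.
elim/Lam_ind: x => [x y Ix Iy|e x Ix||j x Ix].
- by rewrite deltaD !actD (gderD levi_gder) Ix Iy addrACA.
- by rewrite deltaZ !actZ (gderZ levi_gder) Ix scalerDr.
- by rewrite delta1 act0 !act1 add0r.
- have /eqP := levi_s j (act x a); rewrite subr_eq => /eqP.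
  rewrite act_xi => ->; rewrite Ix sD deltaM actD actN act_sum !act_xi.
  have -> : \sum_i act (A i j *: (xi i * x)) a = - \sum_i - A i j *: s_op i (act x a).
    by rewrite -sumrN; apply: eq_bigr => i _; rewrite actZ act_xi scaleNr opprK.
  by zmodule.
Qed.

Lemma levi_d a : levi (d_op a) = d_op (levi a).
Proof.
have gd := d_gderivation R k.
apply/eqP; rewrite -subr_eq0; apply/eqP; move: a.
(* This is the invariance of [sum_i w_i xi_i]: the terms where [A] acts on [w i] cancel those where
   it acts on [xi i]. *)
have key x b : levi (\sum_i w i * act (xi i * x) b) =
    \sum_i w i * act (xi i * delta A x) b + \sum_i w i * act (xi i * x) (levi b).
  have [_ _ L] := levi_gder.
  rewrite (gder_sum levi_gder).
  under eq_bigr => i _.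
    rewrite (L _ _ _ (homog_w R i)) mul0n scale1r levi_w levi_act mulrDr addrA.
    rewrite deltaM actD mulrDr.
  over.
  rewrite !big_split /=; congr (_ + _); rewrite addrCA -[RHS]addr0; congr (_ + _).
  under eq_bigr do rewrite mulr_suml.
  rewrite exchange_big -big_split big1// => i _ /=.
  rewrite actN act_sum mulrN mulr_sumr -sumrB big1// => l _.
  by rewrite actZ -scalerAl -scalerAr subrr.
apply: (act_gder_eq0 (gder_comm0 levi_gder gd)).
- move=> x; rewrite d_act_g4 levi_act_g4 d_act_g4 key levi_g4 -big_split -sumrB.
  rewrite big1// => i _; rewrite /= act_aZ mulrDr actD -[xi i * (_ *: x)]scalerAr actZ.
  by rewrite mulrDr subrr.
- move=> x; rewrite d_act_g7 (gderD levi_gder) (gderN levi_gder) (gderZ levi_gder).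
  rewrite levi_act_g7 d_act_g7 key levi_g7 levi_act.
  have [_ _ L] := levi_gder; rewrite (L _ _ _ (homog_g4 R k)) mul0n scale1r levi_g4.
  rewrite -scalerAl -scalerAr -scalerDl act_aZ tauD tauZ tau_delta actD actZ.
  rewrite -big_split (_ : c + c = 2 * c); last by ring.
  have -> : \sum_i w i * act (xi i * (delta A x + (2 * c) *: x)) g7 =
    \sum_i (w i * act (xi i * delta A x) g7 + w i * act (xi i * x) ((2 * c) *: g7)).
    apply: eq_bigr => i _; rewrite act_aZ mulrDr actD -[xi i * (_ *: x)]scalerAr actZ.
    by rewrite mulrDr.
  by rewrite subrr.
- by move=> i; rewrite d_w (gder0 levi_gder) levi_w (gder_sum gd) big1 ?subrr// => l _;
    rewrite (gderZ gd) d_w scaler0.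
Qed.

Lemma levi_tder : levi \in @tder_pred R k.
Proof. exact: tder_predP levi_gder levi_d. Qed.

End LeviDerivation.

Lemma levi_comm A c B c' a :
  levi A c (levi B c' a) - levi B c' (levi A c a) = levi (B *m A - A *m B) 0 a.
Proof.
move: a.
apply: (act_gder_ext (gder_comm0 (levi_gder A c) (levi_gder B c')) (levi_gder _ _)).
- move=> x; rewrite !levi_act_g4 -actN -actD !deltaD !deltaZ scale0r addr0.
  rewrite -delta_bracket !scalerDr !scalerA [c' * c]mulrC; congr act; zmodule.
- move=> x; rewrite !levi_act_g7 -actN -actD !deltaD !deltaZ mulr0 scale0r addr0.
  rewrite -delta_bracket !scalerDr !scalerA [2 * c' * _]mulrC; congr act; zmodule.
- move=> i; rewrite !levi_w !(gder_sum (levi_gder _ _)).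
  have E (C D : 'M[R]_k) e : \sum_l levi C e (D i l *: w l) = \sum_l (D *m C) i l *: w l.
    under eq_bigr do rewrite (gderZ (levi_gder _ _)) levi_w scaler_sumr.
    rewrite exchange_big; apply: eq_bigr => l _ /=; rewrite mxE scaler_suml.
    by apply: eq_bigr => m _; rewrite scalerA.
  by rewrite !E -sumrB; apply: eq_bigr => l _; rewrite !mxE scalerBl.
Qed.

End ModelDerivationFamilies.

(** * Derivations given by operators of degree -3 *)

Section Contraction.
Variables (R : realType) (k : nat).
Local Notation Lam := (fgca R (fun _ : 'I_k => 1%N)).
Local Notation M := (tmodel R k).
Local Notation xi := (@xi R k).
Local Notation g4 := (g4 R k).
Local Notation g7 := (g7 R k).
Local Notation w := (w_gen R).
Implicit Types (x y : Lam) (a b : M) (i j l : 'I_k) (A B : 'M[R]_k) (n m : int).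

Definition lowers3 (J : Lam -> Lam) : Prop :=
  linear J /\ forall n x, homog n x -> homog (n - 3) (J x).

Definition contr (J : Lam -> Lam) : M -> M :=
  ext 0 (fun x => \sum_l aug (J (xi l * x)) *: w l) (fun x => act (J x) g4) (fun=> 0).

Section OneContraction.
Variables (J : Lam -> Lam) (J3 : lowers3 J).

Lemma lowers3D x y : J (x + y) = J x + J y.
Proof. by rewrite -[x]scale1r J3.1 !scale1r. Qed.

Lemma lowers30 : J 0 = 0.
Proof. by apply: (addIr (J 0)); rewrite -lowers3D !add0r. Qed.

Lemma lowers3Z c x : J (c *: x) = c *: J x.
Proof. by rewrite -[c *: x]addr0 J3.1 lowers30 addr0. Qed.

Let P4D x y : \sum_l aug (J (xi l * (x + y))) *: w l =
  \sum_l aug (J (xi l * x)) *: w l + \sum_l aug (J (xi l * y)) *: w l.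
Proof.
rewrite -big_split; apply: eq_bigr => l _ /=.
by rewrite mulrDr lowers3D aug_add scalerDl.
Qed.

Let P4Z c x : \sum_l aug (J (xi l * (c *: x))) *: w l =
  c *: \sum_l aug (J (xi l * x)) *: w l.
Proof.
rewrite scaler_sumr; apply: eq_bigr => l _ /=.
by rewrite -scalerAr lowers3Z aug_scale scalerA.
Qed.

Let P4h n x : homog n x -> homog (4 - n + 0) (\sum_l aug (J (xi l * x)) *: w l).
Proof.
(* The augmentation sees only degree 0, so the sum can be nonzero only when [xi l * x] has degree
   3. *)
move=> hx; have [->|n2] := eqVneq n 2.
  by apply: homog_sum => l; apply/homogZ/homog_w.
rewrite big1; first exact: homog0.
move=> l _; rewrite (@homog_aug _ _ _ (1 + n - 3)) ?scale0r//.
  by apply: J3.2; apply: homogM => //; exact: (homog_gen R (fun _ : 'I_k => 1%N)).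
by apply: contra_neq n2; lia.
Qed.

Let P4_big n x : homog n x -> 3 < n -> \sum_l aug (J (xi l * x)) *: w l = 0.
Proof.
move=> hx n3; rewrite big1// => l _; rewrite (@homog_aug _ _ _ (1 + n - 3)) ?scale0r//.
  by apply: J3.2; apply: homogM => //; exact: (homog_gen R (fun _ : 'I_k => 1%N)).
by apply/eqP; lia.
Qed.

Let P7h n x : homog n x -> homog (7 - n + 0) (act (J x) g4).
Proof.
move=> hx; rewrite (_ : 7 - n + 0 = 4 - (n - 3)); last by lia.
by apply: act_homog; [exact: J3.2 | exact: homog_g4].
Qed.

Let P7_big n x : homog n x -> 6 < n -> act (J x) g4 = 0.
Proof. by move=> /J3.2 hx n6; apply: (act_g4_big hx); lia. Qed.

Lemma contr_gder : gderivation 0 (contr J).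
Proof. by apply: ext_gder => // i; exact: homog0. Qed.

Lemma contr_w i : contr J (w i) = 0.
Proof. by apply: ext_w => // l; exact: homog0. Qed.

Lemma contr_act_g4 x : contr J (act x g4) = \sum_l aug (J (xi l * x)) *: w l.
Proof. by apply: ext_g4 => // l; exact: homog0. Qed.

Lemma contr_act_g7 x : contr J (act x g7) = act (J x) g4.
Proof.
apply: ext_g7 => //; last by move=> l; exact: homog0.
- by move=> y z; rewrite lowers3D actD.
- by move=> c y; rewrite lowers3Z actZ.
Qed.

(** Both sides vanish, for any [J] of degree -3: on the left a double sum pairs the commuting
    [w i * w l] with the anticommuting [xi i], [xi l], and is its own opposite. *)
Lemma contr_d_act_g4 x : contr J (d_op (act x g4)) = d_op (contr J (act x g4)).
Proof.
have gd := d_gderivation R k; have [_ _ L] := contr_gder.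
rewrite contr_act_g4 (gder_sum gd) big1 => [|i _]; last by rewrite (gderZ gd) d_w scaler0.
rewrite d_act_g4 (gder_sum contr_gder).
under eq_bigr => i _.
  rewrite (L _ _ _ (homog_w R i)) contr_w mul0r add0r mul0n scale1r contr_act_g4 mulr_sumr.
  over.
apply: addrr_eq0; rewrite [X in X + _]exchange_big /= -big_split big1// => i _ /=.
rewrite -big_split big1// => l _ /=.
rewrite [xi i * _]mulrA xiC mulNr -mulrA -scaleN1r lowers3Z aug_scale mulN1r.
rewrite -!scalerAr (homog_comm (homog_w R l) (homog_w R i)) -signr_odd scale1r.
by rewrite -scalerDl addNr scale0r.
Qed.

End OneContraction.

Lemma contr_eq J J' : J =1 J' -> contr J = contr J'.
Proof. by move=> JJ; congr contr; apply/funext. Qed.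

Lemma lowers3_comb c J J' : lowers3 J -> lowers3 J' ->
  lowers3 (fun x => c *: J x + J' x).
Proof.
move=> h h'; split=> [e x y|n x hx].
  rewrite h.1 h'.1 !scalerDr !scalerA addrACA; congr (_ + _ + _).
  by rewrite mulrC.
by apply: homogD; [apply: homogZ; exact: h.2 | exact: h'.2].
Qed.

Lemma contr_comb c J J' a : lowers3 J -> lowers3 J' ->
  contr (fun x => c *: J x + J' x) a = c *: contr J a + contr J' a.
Proof.
move=> h h'; have h'' := lowers3_comb c h h'.
have gc : gderivation 0 (fun a => c *: contr J a + contr J' a).
  have := @gder_lincomb R _ (@tdeg k) 0 bool [:: true; false]
    (fun e => if e then c else 1) (fun e => if e then contr J else contr J').
  case=> [[]|l hh L]; [exact: contr_gder | exact: contr_gder |].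
  split=> [e x y|n x hx|n x y hx];
   [have := l e x y | have := hh n x hx | have := L n x y hx];
   by rewrite !big_cons !big_nil !addr0 !scale1r.
move: a; apply: (act_gder_ext (contr_gder h'') gc).
- move=> x; rewrite !contr_act_g4// scaler_sumr -big_split; apply: eq_bigr => l _ /=.
  by rewrite aug_add aug_scale scalerDl scalerA.
- by move=> x; rewrite !contr_act_g7// actD actZ.
- by move=> i; rewrite !contr_w// scaler0 addr0.
Qed.

Lemma lowers3_delta A c J : lowers3 J ->
  lowers3 (fun x => delta A (J x) - J (delta A x) - c *: J x).
Proof.
move=> h; split=> [e x y|n x hx].
  by rewrite deltaD deltaZ !h.1 deltaD deltaZ !scalerBr scalerDr !scalerA
    [c * e]mulrC; zmodule.
have dh m z : homog m z -> homog m (delta A z).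
  by case: (delta_gder A) => _ + _ => /(_ m z) /[apply]; rewrite addr0.
by apply: homogB; [apply: homogB|apply: homogZ]; [apply/dh/h.2|apply/h.2/dh|exact: h.2].
Qed.

(** The term in [c] is the difference between the scalar [c] at the target [g4] and [2 * c] at the
    source [g7]. *)
Lemma levi_contr A c J a : lowers3 J ->
  levi A c (contr J a) - contr J (levi A c a) =
  contr (fun x => delta A (J x) - J (delta A x) - c *: J x) a.
Proof.
move=> h; have h' := lowers3_delta A c h; move: a.
apply: (act_gder_ext (gder_comm0 (levi_gder A c) (contr_gder h)) (contr_gder h')).
- move=> x; rewrite levi_act_g4 !contr_act_g4// (gder_sum (levi_gder A c)).
  under eq_bigr do rewrite (gderZ (levi_gder A c)) levi_w scaler_sumr.
  rewrite exchange_big -sumrB; apply: eq_bigr => l _ /=.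
  rewrite -[_ - _ *: w l in LHS]/(_ + _); under eq_bigr do rewrite scalerA.
  rewrite -scaler_suml -scalerBl; congr (_ *: _).
  rewrite !(aug_add, aug_opp, aug_scale) mulrDr -scalerAr (lowers3D h) (lowers3Z h).
  rewrite deltaM (lowers3D h) -scaleN1r (lowers3Z h) !(aug_add, aug_scale).
  (* The part [delta A (J _)] has augmentation 0; the action of [A] on [w] is recovered from
     [deltaM] instead. *)
  rewrite (gder_aug (D := delta A))//; last exact: delta_gder.
  rewrite (big_morph J (lowers3D h) (lowers30 h)).
  rewrite (big_morph (@aug _ _ _) (@aug_add _ _ _) (@aug_eq0 _ _ _)).
  have -> : \sum_i aug (J (A i l *: (xi i * x))) = \sum_i aug (J (xi i * x)) * A i l.
    by apply: eq_bigr => i _; rewrite (lowers3Z h) aug_scale mulrC.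
  ring.
- move=> x; rewrite levi_act_g7 !contr_act_g7// levi_act_g4 -actN -actD.
  rewrite (lowers3D h) (lowers3Z h); congr act.
  have -> : (2 * c) *: J x = c *: J x + c *: J x by rewrite -scalerDl; congr (_ *: _); ring.
  by zmodule.
- move=> i; rewrite levi_w !contr_w// (gder0 (levi_gder _ _)) (gder_sum (contr_gder h)).
  by rewrite big1 ?subrr// => l _; rewrite (gderZ (contr_gder h)) contr_w// scaler0.
Qed.

(** Products of two contractions kill the [act x g4], which go to combinations of the [w_i]. On
    [act x g7] they are the sums with coefficients [aug (J (xi l * J' x))], whence the symmetry
    condition. *)
Lemma contr_contr J J' a : lowers3 J -> lowers3 J' ->
  (forall l x, aug (J (xi l * J' x)) = aug (J' (xi l * J x))) ->
  contr J (contr J' a) - contr J' (contr J a) = 0.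
Proof.
move=> h h' JJ; move: a.
have z I I' x : lowers3 I -> lowers3 I' -> contr I (contr I' (act x g4)) = 0.
  move=> hI hI'; rewrite contr_act_g4// (gder_sum (contr_gder hI)) big1// => l _.
  by rewrite (gderZ (contr_gder hI)) contr_w// scaler0.
apply: (act_gder_eq0 (gder_comm0 (contr_gder h) (contr_gder h'))).
- by move=> x; rewrite !z// subrr.
- move=> x; rewrite !contr_act_g7// !contr_act_g4// -sumrB big1// => l _.
  by rewrite JJ subrr.
- by move=> i; rewrite !contr_w// (gder0 (contr_gder h)) (gder0 (contr_gder h')) subrr.
Qed.

End Contraction.

(** * The triple contraction and the differential *)

Section TripleContraction.
Variables (R : realType) (k : nat).
Local Notation Lam := (fgca R (fun _ : 'I_k => 1%N)).
Local Notation M := (tmodel R k).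
Local Notation xi := (@xi R k).
Local Notation g4 := (g4 R k).
Local Notation g7 := (g7 R k).
Local Notation w := (w_gen R).
Implicit Types (x y : Lam) (u v : M) (i j l p q : 'I_k) (A B : 'M[R]_k) (n m : int).

(** Three odd contractions change the sign on passing [xi j], and the parity [tau] changes it back;
    so [hook3] commutes with [xi j] for [j] outside [p], [q], [l]. *)
Definition hook3 p q l : Lam -> Lam := fun x => hook p (hook q (hook l (tau x))).

Lemma hook_homog j n x : homog n x -> homog (n - 1) (hook j x).
Proof. by case: (hook_gder R j) => _ + _; apply. Qed.

Lemma lowers3_hook3 p q l : lowers3 (hook3 p q l).
Proof.
split=> [c x y|n x hx]; first by rewrite /hook3 tauD tauZ !(hookD, hookZ).
by rewrite (_ : n - 3 = n - 1 - 1 - 1); [do 3 apply: hook_homog; exact: tau_homog | lia].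
Qed.

Lemma hook3M p q l j x : hook3 p q l (xi j * x) = xi j * hook3 p q l x
  - (j == l)%:R *: hook p (hook q (tau x)) + (j == q)%:R *: hook p (hook l (tau x))
  - (j == p)%:R *: hook q (hook l (tau x)).
Proof.
rewrite /hook3 tauM !(hookM, hookN, hookD, hookZ).
by zmodule.
Qed.

Lemma aug_tau x : aug (tau x) = aug x.
Proof.
elim/Lam_ind: x => [x y Ix Iy|c x Ix||i x Ix].
- by rewrite tauD !aug_add Ix Iy.
- by rewrite tauZ !aug_scale Ix.
- by rewrite tau1.
- by rewrite tauM aug_opp !augM aug_gen !mul0r oppr0.
Qed.

(** By the Leibniz rule [act x (g4 * g4)] is a combination of products of two [sI r g4]. This allows
    comparison of derivations that agree on the [sI r g4] but not on the whole model. *)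
Lemma g4g4_ind (P : M -> Prop) : P 0 ->
  (forall u v, P u -> P v -> P (u + v)) -> (forall c u, P u -> P (c *: u)) ->
  (forall r r', P (sI r g4 * sI r' g4)) -> forall x, P (act x (g4 * g4)).
Proof.
move=> P0 PD PZ PM x; elim/Lam_ind: x P P0 PD PZ PM => [x y Ix Iy|c x Ix||i x Ix] P P0 PD PZ PM.
- by rewrite actD; apply: (PD); [apply: Ix | apply: Iy].
- by rewrite actZ; apply: (PZ); apply: Ix.
- by rewrite act1; apply: (PM [::] [::]).
- rewrite act_xi; apply: (Ix (fun u => P (s_op i u))).
  + by rewrite s0.
  + by move=> u v Pu Pv; rewrite sD; apply: PD.
  + by move=> c u Pu; rewrite sZ; apply: PZ.
  + move=> r r'; have [_ _ L] := s_gderivation R i.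
    rewrite (L _ _ _ (sI_homog r (homog_g4 R k))).
    by apply: (PD); [apply: (PM (i :: r)) | apply/PZ/(PM r (i :: r'))].
Qed.

(* Only functionals [f] of degree [m] are relevant.  The commutator with [s_i]
  lowers [m] (see [extends_functional_s]), which allows to compute the values at
  the [s_I (g4 * g4)] by induction on [I]. *)
Definition extends_functional (m : nat) (f : Lam -> R) (D : M -> M) : Prop :=
  [/\ gderivation (m%:Z - 4) D, forall x, D (act x g4) = f x *: 1,
      forall x, D (act x g7) = 0 & forall i, D (w i) = 0].

Lemma gderivation_eq n n0 (D : M -> M) : n = n0 -> gderivation n D -> gderivation n0 D.
Proof. by move=> ->. Qed.

Lemma s_const i c : s_op i (c *: 1) = 0 :> M.
Proof. by rewrite sZ (gder1 (s_gderivation R i)) scaler0. Qed.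

Lemma extends_functional_s (m : nat) f f' D i : (forall x, f (xi i * x) = f' x) ->
  extends_functional m.+1 f D ->
  extends_functional m f' (fun u => D (s_op i u) - (-1) ^+ (odd m.+1) *: s_op i (D u)).
Proof.
move=> ff' [gD D4 D7 Dw]; split.
- have := gder_comm gD (s_gderivation R i).
  have -> : (-1) ^+ (absz (m.+1%:Z - 4)%R * absz (-1)%R)%N = (-1) ^+ (odd m.+1) :> R.
    by rewrite -signr_odd oddM; congr (_ ^+ _); lia.
  by apply: gderivation_eq; lia.
- by move=> x; rewrite -act_xi !D4 s_const scaler0 subr0 ff'.
- by move=> x; rewrite -act_xi !D7 s0 scaler0 subr0.
- by move=> j; rewrite s_w Dw (gder0 gD) s0 scaler0 subr0.
Qed.

Lemma gder_g4g4 n D : gderivation n D -> ~~ odd `|n| -> D (g4 * g4) = D g4 * g4 + g4 * D g4.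
Proof.
case=> _ _ L op; rewrite (L _ _ _ (homog_g4 R k)) -signr_odd oddM andbC.
by rewrite scale1r.
Qed.

Lemma functional0_g4g4 c D x : extends_functional 0 (fun x => c * aug x) D ->
  D (act x (g4 * g4)) = (2 * c) *: act x g4.
Proof.
case=> gD D4 D7 Dw; elim/Lam_ind: x => [x y Ix Iy|e x Ix||i x Ix].
- by rewrite !actD (gderD gD) Ix Iy scalerDr.
- by rewrite !actZ (gderZ gD) Ix !scalerA mulrC.
- have := D4 1; rewrite !act1 aug1 mulr1 => Dg.
  rewrite (gder_g4g4 gD)// Dg -scalerAl -scalerAr mul1r mulr1 -scalerDl.
  by congr (_ *: _); ring.
(* The degree -4 is even, so this is the graded commutator; it vanishes on generators because the
   augmentation kills multiples of [xi i]. *)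
- suff E u : D (s_op i u) - s_op i (D u) = 0.
    rewrite !act_xi; have /eqP := E (act x (g4 * g4)); rewrite subr_eq0 => /eqP ->.
    by rewrite Ix sZ.
  move: u; have := gder_comm gD (s_gderivation R i).
  rewrite -signr_odd expr0 => gC.
  have {}gC : gderivation (0%:Z - 4 + -1) (fun u => D (s_op i u) - s_op i (D u)).
    case: gC => l h L; split=> [e y z|n y hy|n y z hy];
     [have := l e y z | have := h n y hy | have := L n y z hy]; by rewrite !scale1r.
  apply: (act_gder_eq0 gC).
  + by move=> y; rewrite -act_xi !D4 augM aug_gen mul0r mulr0 scale0r s_const subrr.
  + by move=> y; rewrite -act_xi !D7 s0 subrr.
  + by move=> j; rewrite s_w Dw (gder0 gD) s0 subrr.
Qed.

(** Two contractions are combined because this is what the commutator with [s_i] leaves of the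
    functional [aug (hook p (hook q x))]. *)
Lemma functional1_g4g4 p q c c' D x :
  extends_functional 1 (fun x => c * aug (hook p x) + c' * aug (hook q x)) D ->
  D (act x (g4 * g4)) = 2 *: act (c *: hook p x + c' *: hook q x) g4.
Proof.
move=> eD; have [gD D4 D7 Dw] := eD; elim/Lam_ind: x => [x y Ix Iy|e x Ix||i x Ix].
- rewrite actD (gderD gD) Ix Iy -scalerDr -actD !hookD !scalerDr.
  by congr (_ *: act _ _); zmodule.
- rewrite actZ (gderZ gD) Ix !hookZ !scalerA [c * e]mulrC [c' * e]mulrC.
  by rewrite -!scalerA -scalerDr actZ !scalerA mulrC.
- have := D4 1; rewrite !act1 !hook1 aug_eq0 !mulr0 addr0 scale0r => Dg.
  rewrite !scaler0 addr0 act0 scaler0; have [_ _ L] := gD.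
  by rewrite (L _ _ _ (homog_g4 R k)) Dg mul0r mulr0 scaler0 addr0.
- have := @extends_functional_s 0 _
    (fun x => (c * (i == p)%:R + c' * (i == q)%:R) * aug x) D i _ eD.
  rewrite /= expr1 => /(_ _)/functional0_g4g4 H.
  rewrite act_xi -[D (s_op _ _)](subrK (-1 *: s_op i (D (act x (g4 * g4))))).
  rewrite H => [|y]; last first.
    rewrite !hookM !(aug_add, aug_opp, aug_scale, augM) aug_gen.
    by ring.
  rewrite Ix scaleN1r sZ -scalerN -act_xi -scalerA -[_ *: act x g4]actZ -actN.
  rewrite -scalerDr -actD !hookM.
  rewrite mulrDr -!scalerAr [_ *: x]scalerDl -!scalerA !scalerBr.
  by congr (_ *: act _ _); zmodule.
Qed.

Lemma functional2_g4g4 p q D x :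
  extends_functional 2 (fun x => aug (hook p (hook q x))) D ->
  D (act x (g4 * g4)) = 2 *: act (hook p (hook q x)) g4.
Proof.
move=> eD; have [gD D4 D7 Dw] := eD; elim/Lam_ind: x => [x y Ix Iy|e x Ix||i x Ix].
- by rewrite !hookD !actD (gderD gD) Ix Iy scalerDr.
- by rewrite !hookZ !actZ (gderZ gD) Ix !scalerA mulrC.
- have := D4 1; rewrite !act1 !hook1 (gder0 (hook_gder R p)) aug_eq0 scale0r => Dg.
  by rewrite (gder_g4g4 gD)// Dg mul0r mulr0 addr0 act0 scaler0.
- have := @extends_functional_s 1 _ (fun x => (- (i == p)%:R) * aug (hook q x) +
    (i == q)%:R * aug (hook p x)) D i _ eD.
  rewrite /= expr0 => /(_ _)/functional1_g4g4 H.
  rewrite act_xi -[D (s_op _ _)](subrK (1 *: s_op i (D (act x (g4 * g4))))).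
  rewrite H => [|y]; last first.
    rewrite !(hookM, hookD, hookN, hookZ) !(aug_add, aug_opp, aug_scale, augM) aug_gen.
    by ring.
  rewrite Ix scale1r sZ -act_xi -scalerDr -actD !(hookM, hookD, hookN, hookZ).
  by rewrite scaleNr; congr (_ *: act _ _); zmodule.
Qed.

Lemma functional2_ex p q :
  exists D, extends_functional 2 (fun x => aug (hook p (hook q x))) D.
Proof.
pose P4 x : M := aug (hook p (hook q x)) *: 1.
have P4D x y : P4 (x + y) = P4 x + P4 y by rewrite /P4 !hookD aug_add scalerDl.
have P4Z c x : P4 (c *: x) = c *: P4 x by rewrite /P4 !hookZ aug_scale scalerA.
have P4_0 n x : homog n x -> n != 2 -> P4 x = 0.
  move=> hx n2; rewrite /P4 (homog_aug (hook_homog p (hook_homog q hx))) ?scale0r//.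
  by apply: contra_neq n2; lia.
have P4h n x : homog n x -> homog (4 - n + (2%:Z - 4)) (P4 x).
  move=> hx; have [->|n2] := eqVneq n 2; first exact: homog_const.
  by rewrite (P4_0 _ _ hx n2); exact: homog0.
have P4b n x : homog n x -> 3 < n -> P4 x = 0.
  by move=> hx n3; apply: (P4_0 _ _ hx); apply/eqP; lia.
exists (ext (2%:Z - 4) P4 (fun=> 0) (fun=> 0)); split.
- by apply: ext_gder => // *; exact: homog0.
- by move=> x; apply: ext_g4 => // *; exact: homog0.
- by move=> x; apply: ext_g7 => // *; rewrite ?addr0 ?scaler0//; exact: homog0.
- by move=> x; apply: ext_w => // *; exact: homog0.
Qed.

(** On the [sI r g4] the contraction equals [w q * D2 - w l * D1 - w p * D3] with [D1], [D2], [D3]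
    of degree -2. As these degrees and the [w] are even, the identity extends to products without
    signs. On the [act x g7] it has no reason to hold, hence the use of [g4g4_ind]. *)
Lemma contr_hook3_g4g4 p q l x : contr (hook3 p q l) (act x (g4 * g4)) =
  2 *: (w q * act (hook p (hook l x)) g4 - w l * act (hook p (hook q x)) g4
        - w p * act (hook q (hook l x)) g4).
Proof.
have h3 := lowers3_hook3 p q l; have gC := contr_gder h3.
have [D1 e1] := functional2_ex p q; have [D2 e2] := functional2_ex p l.
have [D3 e3] := functional2_ex q l.
rewrite !scalerBr !scalerAr -(functional2_g4g4 x e1) -(functional2_g4g4 x e2).
rewrite -(functional2_g4g4 x e3).
have [g1 D14 _ _] := e1; have [g2 D24 _ _] := e2; have [g3 D34 _ _] := e3.
have g4E r : contr (hook3 p q l) (sI r g4) =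
    w q * D2 (sI r g4) - w l * D1 (sI r g4) - w p * D3 (sI r g4).
  rewrite -act_xis contr_act_g4// D14 D24 D34 -!scalerAr !mulr1.
  have E j : aug (hook3 p q l (xi j * xis R r)) =
      (j == q)%:R * aug (hook p (hook l (xis R r)))
      - (j == l)%:R * aug (hook p (hook q (xis R r)))
      - (j == p)%:R * aug (hook q (hook l (xis R r))).
    (* Parity passes two contractions without a sign, and the augmentation ignores it. *)
    have augh a b y : aug (hook a (hook b (tau y))) = aug (hook a (hook b y)).
      by rewrite -[RHS]aug_tau !tau_hook hookN opprK.
    rewrite hook3M !(aug_add, aug_opp, aug_scale, augM) aug_gen !augh; ring.
  under eq_bigr do rewrite E !scalerBl -!scalerA.
  have pick i c : \sum_j (j == i)%:R *: (c *: w j) = c *: w i.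
    rewrite (bigD1 i)//= eqxx scale1r big1 ?addr0// => j /negbTE ->.
    by rewrite scale0r.
  by rewrite !sumrB !pick.
apply: (@g4g4_ind (fun u =>
  contr (hook3 p q l) u = w q * D2 u - w l * D1 u - w p * D3 u)).
- by rewrite (gder0 gC) (gder0 g1) (gder0 g2) (gder0 g3) !mulr0 !subr0.
- move=> u v Pu Pv; rewrite (gderD gC) (gderD g1) (gderD g2) (gderD g3) Pu Pv.
  by rewrite !mulrDr; zmodule.
- move=> c u Pu; rewrite (gderZ gC) (gderZ g1) (gderZ g2) (gderZ g3) Pu.
  by rewrite -!scalerAr !scalerBr.
- move=> r r'; have hr := sI_homog r (homog_g4 R k).
  have [_ _ L] := gC; have [_ _ L1] := g1; have [_ _ L2] := g2; have [_ _ L3] := g3.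
  rewrite (L _ _ _ hr) (L1 _ _ _ hr) (L2 _ _ _ hr) (L3 _ _ _ hr) !g4E.
  have ev (m : nat) : (-1) ^+ (absz (2%:Z - 4)%R * m)%N = 1 :> R.
    by rewrite -signr_odd oddM.
  rewrite !ev mul0n expr0 !scale1r.
  have wC i : sI r g4 * w i = w i * sI r g4.
    by rewrite (homog_comm hr (homog_w R i)) -signr_odd oddM andbF scale1r.
  rewrite !mulrBr !mulrBl !mulrDr !mulrA !wC; zmodule.
Qed.

(** At [act x g7] the leading term of [hook3M] gives the differential of the image. Its three
    corrections cancel the contribution of the square of [g4], where the factor 2 of
    [contr_hook3_g4g4] meets the coefficient one half. *)
Lemma contr_hook3_d p q l u :
  contr (hook3 p q l) (d_op u) = d_op (contr (hook3 p q l) u).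
Proof.
have h3 := lowers3_hook3 p q l; have gC := contr_gder h3; have gd := d_gderivation R k.
apply/eqP; rewrite -subr_eq0; apply/eqP; move: u.
apply: (act_gder_eq0 (gder_comm0 gC gd)) => [x|x|i].
- by rewrite (contr_d_act_g4 h3) subrr.
- have [_ _ L] := gC.
  rewrite contr_act_g7// d_act_g4 d_act_g7 (gderD gC) (gderN gC) (gderZ gC).
  rewrite contr_hook3_g4g4 scalerA mulVf ?pnatr_eq0// scale1r (gder_sum gC).
  under eq_bigr => i _.
    rewrite (L _ _ _ (homog_w R i)) contr_w// mul0r add0r mul0n scale1r contr_act_g7//.
    rewrite hook3M !(actD, actN, actZ) !(mulrDr, mulrN) -!scalerAr.
    over.
  have pick j (F : 'I_k -> M) : \sum_i (i == j)%:R *: F i = F j.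
    rewrite (bigD1 j)//= eqxx scale1r big1 ?addr0// => i /negbTE ->.
    by rewrite scale0r.
  rewrite !big_split /= !sumrN.
  rewrite (pick l (fun i => w i * act (hook p (hook q (tau x))) g4)).
  rewrite (pick q (fun i => w i * act (hook p (hook l (tau x))) g4)).
  rewrite (pick p (fun i => w i * act (hook q (hook l (tau x))) g4)).
  zmodule.
- by rewrite d_w contr_w// (gder0 gC) (gder0 gd) subrr.
Qed.

Lemma contr_hook3_tder p q l : contr (hook3 p q l) \in @tder_pred R k.
Proof.
exact: tder_predP (contr_gder (lowers3_hook3 p q l)) (contr_hook3_d p q l).
Qed.

End TripleContraction.

(** * Brackets of gl_k x R with triple contractions *)

Section LeviAndContractions.
Variables (R : realType) (k : nat).
Local Notation Lam := (fgca R (fun _ : 'I_k => 1%N)).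
Local Notation M := (tmodel R k).
Local Notation xi := (@xi R k).
Local Notation g4 := (g4 R k).
Local Notation g7 := (g7 R k).
Local Notation w := (w_gen R).
Local Notation tder := (tder R k).
Implicit Types (x y : Lam) (u v : M) (i j l p q : 'I_k) (A B : 'M[R]_k) (c e : R).

Definition Levi A c : tder := TDer (levi_tder A c).
Definition Contr p q l : tder := TDer (contr_hook3_tder R p q l).

Lemma lie_tderE (D E : tder) u : lie D E u = D (E u) - E (D u).
Proof. by []. Qed.

Lemma lie_Levi A c B c' : lie (Levi A c) (Levi B c') = Levi (B *m A - A *m B) 0.
Proof. by apply: tder_eq => u; rewrite lie_tderE; exact: levi_comm. Qed.

Lemma delta_comb e A B x : delta (e *: A + B) x = e *: delta A x + delta B x.
Proof.
elim/Lam_ind: x => [x y Ix Iy|c x Ix||i x Ix].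
- by rewrite !deltaD Ix Iy scalerDr addrACA.
- by rewrite !deltaZ Ix scalerDr !scalerA mulrC.
- by rewrite !delta1 scaler0 addr0.
- rewrite !deltaM Ix mulrDr -scalerAr scalerBr.
  have -> : \sum_l (e *: A + B) l i *: (xi l * x) =
      e *: (\sum_l A l i *: (xi l * x)) + \sum_l B l i *: (xi l * x).
    rewrite scaler_sumr -big_split; apply: eq_bigr => l _ /=.
    by rewrite !mxE scalerDl scalerA.
  by zmodule.
Qed.

Lemma Levi_comb e A c B c' :
  Levi (e *: A + B) (e * c + c') = e *: Levi A c + Levi B c'.
Proof.
apply: tder_eq; apply: (act_gder_ext (levi_gder _ _) (tder_gder (e *: Levi A c + Levi B c'))).
- move=> x; rewrite tder_linearE /= !levi_act_g4 -actZ -actD delta_comb.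
  by rewrite scalerDr scalerDl !scalerA addrACA.
- move=> x; rewrite tder_linearE /= !levi_act_g7 -actZ -actD delta_comb.
  by rewrite scalerDr !mulrDr scalerDl !scalerA mulrCA addrACA.
- move=> i; rewrite tder_linearE /= !levi_w scaler_sumr -big_split.
  by apply: eq_bigr => l _ /=; rewrite !mxE scalerDl scalerA.
Qed.

Lemma Levi0 : Levi 0 0 = 0.
Proof.
apply: (addIr (Levi 0 0)); rewrite add0r -[X in X + _]scale1r -Levi_comb.
by rewrite scaler0 addr0 mulr0 addr0.
Qed.

Lemma LeviZ e A c : Levi (e *: A) (e * c) = e *: Levi A c.
Proof. by rewrite -[e *: A]addr0 -[e * c]addr0 Levi_comb Levi0 addr0. Qed.

Lemma contrZ e (J : Lam -> Lam) u : lowers3 J -> contr (fun x => e *: J x) u = e *: contr J u.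
Proof.
move=> h; rewrite (@contr_eq _ _ _ (fun x => (e - 1) *: J x + J x)).
  by rewrite contr_comb// scalerBl scale1r subrK.
by move=> x; rewrite scalerBl scale1r subrK.
Qed.

(** The shift by [c] undoes the term [- c *: J] of [levi_contr]. *)
Lemma lie_Levi_eigen A c p q l e :
  (forall x, delta A (hook3 p q l x) - hook3 p q l (delta A x) = (e + c) *: hook3 p q l x) ->
  lie (Levi A c) (Contr p q l) = e *: Contr p q l.
Proof.
move=> h; apply: tder_eq => u; rewrite lie_tderE /= levi_contr; last exact: lowers3_hook3.
rewrite -[RHS]/(e *: contr (hook3 p q l) u) -contrZ; last exact: lowers3_hook3.
by congr (contr _ u); apply/funext => x; rewrite h scalerDl addrK.
Qed.

Lemma lie_Levi_Contr A p q l p' q' l' :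
  (forall x, delta A (hook3 p q l x) - hook3 p q l (delta A x) = hook3 p' q' l' x) ->
  lie (Levi A 0) (Contr p q l) = Contr p' q' l'.
Proof.
move=> h; apply: tder_eq => u; rewrite lie_tderE /= levi_contr; last exact: lowers3_hook3.
by congr (contr _ u); apply/funext => x; rewrite h scale0r subr0.
Qed.

Lemma delta_hook3 A p q l x : delta A (hook3 p q l x) - hook3 p q l (delta A x) =
  \sum_m A p m *: hook3 m q l x + \sum_m A q m *: hook3 p m l x
  + \sum_m A l m *: hook3 p q m x.
Proof.
have hookS a (F : 'I_k -> Lam) : hook a (\sum_m F m) = \sum_m hook a (F m).
  exact: (big_morph _ (hookD a) (gder0 (hook_gder R a))).
rewrite /hook3 tau_delta !(delta_hook, hookD, hookS).
have E2 : \sum_m hook p (A q m *: hook m (hook l (tau x))) =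
    \sum_m A q m *: hook p (hook m (hook l (tau x))).
  by apply: eq_bigr => m _; rewrite hookZ.
have E3 : \sum_m hook p (hook q (A l m *: hook m (tau x))) =
    \sum_m A l m *: hook p (hook q (hook m (tau x))).
  by apply: eq_bigr => m _; rewrite !hookZ.
by rewrite E2 E3; zmodule.
Qed.

Lemma hook3_rep1 p l x : hook3 p p l x = 0.
Proof. exact: hook_sq. Qed.

Lemma hook3_rep2 p q x : hook3 p q q x = 0.
Proof. by rewrite /hook3 hook_sq (gder0 (hook_gder R p)). Qed.

Lemma hook3_kill a p q l x : a \in [:: p; q; l] -> hook a (hook3 p q l x) = 0.
Proof.
have h0 b : hook b (0 : Lam) = 0 by exact: gder0 (hook_gder R b).
rewrite !inE => /or3P[] /eqP ->; rewrite /hook3.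
- exact: hook_sq.
- by rewrite hook_anti hook_sq h0 oppr0.
- by rewrite hook_anti [hook l (hook q _)]hook_anti hook_sq h0 oppr0 h0 oppr0.
Qed.

(** By [hook3M] the coefficients in [contr_contr] reduce to double contractions of the other
    [hook3]. Any two of the three indices include [p] or [q], which is shared, so both sides
    vanish. *)
Lemma lie_Contr p q l p' q' l' : p \in [:: p'; q'; l'] -> q \in [:: p'; q'; l'] ->
  p' \in [:: p; q; l] -> q' \in [:: p; q; l] ->
  lie (Contr p q l) (Contr p' q' l') = 0.
Proof.
move=> hp hq hp' hq'; apply: tder_eq => u; rewrite lie_tderE.
apply: contr_contr; try exact: lowers3_hook3.
move=> j x.
have kill a b p1 q1 l1 y : (a \in [:: p1; q1; l1]) || (b \in [:: p1; q1; l1]) ->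
    hook a (hook b (tau (hook3 p1 q1 l1 y))) = 0 :> Lam.
  have -> : tau (hook3 p1 q1 l1 y) = - hook3 p1 q1 l1 (tau y).
    by rewrite /hook3 !tau_hook !hookN !opprK.
  rewrite !hookN; case/orP => h.
    by rewrite hook_anti (hook3_kill _ h) (gder0 (hook_gder R b)) !oppr0.
  by rewrite (hook3_kill _ h) (gder0 (hook_gder R a)) oppr0.
by rewrite !hook3M !kill ?hp ?hq ?hp' ?hq' ?orbT// !scaler0 !subr0 !addr0 !augM aug_gen !mul0r.
Qed.

End LeviAndContractions.

(** * Relations of the parabolic subalgebra *)

Section Relations.
Variables (R : realType) (k : nat) (k3 : (3 <= k)%N).
Local Notation tder := (tder R k).
Local Notation hk := 'rV[R]_k.+1.
Local Notation o := (i3 k3).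
Implicit Types (i j l p q a b : 'I_k) (x y : hk).

(** A total successor, so that no proof of [i.+1 < k] has to be carried along; at the last index it
    takes the dummy value [i]. *)
Definition nxt i : 'I_k := insubd i i.+1.

Lemma val_nxt i : (i.+1 < k)%N -> nxt i = i.+1 :> nat.
Proof. by move=> ik; rewrite /nxt val_insubd ik. Qed.

Lemma ord_succ_nxt i (hi : (i.+1 < k)%N) : Ordinal hi = nxt i.
Proof. by apply: val_inj; rewrite /= val_nxt. Qed.

Definition model_h x : tder := Levi (diag_mx (\row_i - eps i.+1 x)) (- eps 0 x).

Definition model_gen (z : ekgen R k) : tder :=
  match z with
  | Ee i => if i.+1 == k then Contr R (o 0) (o 1) (o 2) else Levi (delta_mx i (nxt i)) 0
  | Ef i => if i.+1 == k then 0 else Levi (delta_mx (nxt i) i) 0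
  | Eh x => model_h x
  end.

Local Notation e i := (model_gen (Ee R i)).
Local Notation f i := (model_gen (Ef R i)).
Local Notation h x := (model_h x).

Lemma unit_comm a b p q : lie (Levi (delta_mx a b : 'M[R]_k) 0) (Levi (delta_mx p q) 0) =
  Levi ((q == a)%:R *: delta_mx p b - (b == p)%:R *: delta_mx a q) 0.
Proof. by rewrite lie_Levi !mul_delta_mx_cond -!scaler_nat. Qed.

Lemma h_unit x a b : lie (h x) (Levi (delta_mx a b) 0) =
  (eps a.+1 x - eps b.+1 x) *: Levi (delta_mx a b) 0.
Proof.
rewrite lie_Levi -LeviZ mulr0 mul_mx_diag mul_diag_mx; congr Levi.
apply/matrixP => i j; rewrite !mxE.
case: eqP => [->|_]; case: eqP => [->|_] /=; ring.
Qed.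

Lemma alpha_lt i x : (i.+1 < k)%N -> alpha i x = eps i.+1 x - eps (nxt i).+1 x.
Proof. by move=> ik; rewrite /alpha ltn_eqF// val_nxt. Qed.

Lemma alpha_last i x : i.+1 = k ->
  alpha i x = eps 0 x - eps 1 x - eps 2 x - eps 3 x.
Proof. by rewrite /alpha => ->; rewrite eqxx. Qed.

Lemma ord_lastVlt i : i.+1 = k \/ (i.+1 < k)%N.
Proof. by have := ltn_ord i; rewrite leq_eqVlt => /orP[/eqP|]; [left|right]. Qed.

Lemma e_last i : i.+1 = k -> e i = Contr R (o 0) (o 1) (o 2).
Proof. by move=> /= ->; rewrite eqxx. Qed.

Lemma e_lt i : (i.+1 < k)%N -> e i = Levi (delta_mx i (nxt i)) 0.
Proof. by move=> ik /=; rewrite ltn_eqF. Qed.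

Lemma f_last i : i.+1 = k -> f i = 0.
Proof. by move=> /= ->; rewrite eqxx. Qed.

Lemma f_lt i : (i.+1 < k)%N -> f i = Levi (delta_mx (nxt i) i) 0.
Proof. by move=> ik /=; rewrite ltn_eqF. Qed.

Lemma sum_delta_mx (V : lmodType R) a b p (F : 'I_k -> V) :
  \sum_m (delta_mx a b : 'M[R]_k) p m *: F m = (p == a)%:R *: F b.
Proof.
rewrite (bigD1 b)//= mxE eqxx andbT big1 ?addr0// => m /negbTE mb.
by rewrite mxE mb andbF scale0r.
Qed.

Lemma sum_diag_mx (V : lmodType R) (d : 'rV[R]_k) p (F : 'I_k -> V) :
  \sum_m (diag_mx d) p m *: F m = d 0 p *: F p.
Proof.
rewrite (bigD1 p)//= mxE eqxx mulr1n big1 ?addr0// => m /negbTE mp.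
by rewrite mxE eq_sym mp mulr0n scale0r.
Qed.

Lemma rel_hlinear (c : R) x y : h (c *: x + y) = c *: h x + h y.
Proof.
rewrite -Levi_comb; congr Levi; last by rewrite eps_linear; ring.
apply/matrixP => i j; rewrite !mxE eps_linear; case: eqP => _ /=; ring.
Qed.

Lemma rel_hh x y : lie (h x) (h y) = 0.
Proof.
by rewrite lie_Levi (diag_mx_comm (\row_i - eps i.+1 y)) subrr Levi0.
Qed.

Lemma rel_he x i : lie (h x) (e i) = alpha i x *: e i.
Proof.
have [ik|ik] := ord_lastVlt i; last by rewrite e_lt// h_unit -alpha_lt.
(* The three contractions contribute [- eps 1 x - eps 2 x - eps 3 x]; the missing [eps 0 x] is minus
   the scalar of [model_h x]. *)
rewrite e_last// alpha_last//; apply: lie_Levi_eigen => z.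
rewrite delta_hook3 !sum_diag_mx -!scalerDl !mxE /=; congr (_ *: _); ring.
Qed.

Lemma rel_hf x i : lie (h x) (f i) = - alpha i x *: f i.
Proof.
have [ik|ik] := ord_lastVlt i; first by rewrite f_last// lie0r scaler0.
by rewrite f_lt// h_unit alpha_lt// opprB.
Qed.

Lemma coroot_lt i : (i.+1 < k)%N ->
  h (coroot R i) = Levi (delta_mx (nxt i) (nxt i) - delta_mx i i) 0.
Proof.
move=> ik; rewrite /coroot ltn_eqF//; congr Levi; last first.
  by rewrite epsB !eps_hb ?mulr0 ?subrr ?oppr0// ltnW.
apply/matrixP => p q; rewrite !mxE epsB !eps_hb ?expr0 ?mul1r//; try exact: ltnW.
rewrite !eqSS -(inj_eq val_inj) -[p == nxt i](inj_eq val_inj) -[q == i](inj_eq val_inj).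
rewrite -[q == nxt i](inj_eq val_inj) -[p == i](inj_eq val_inj) /= val_nxt//.
case: (eqVneq (p : nat) q) => [->|pq].
  by case: (q == i :> nat); case: (q == i.+1 :> nat) => /=; ring.
have -> : (p == i :> nat) && (q == i :> nat) = false.
  by apply: contraNF pq => /andP[/eqP-> /eqP->].
have -> : (p == i.+1 :> nat) && (q == i.+1 :> nat) = false.
  by apply: contraNF pq => /andP[/eqP-> /eqP->].
by rewrite /=; ring.
Qed.

(** The reversed order in [unit_comm] is matched by the minus sign on the diagonal of [model_h]. *)
Lemma rel_ef i : (i.+1 < k)%N -> lie (e i) (f i) = h (coroot R i).
Proof. by move=> ik; rewrite e_lt// f_lt// unit_comm coroot_lt// !eqxx !scale1r. Qed.

Lemma o_inj (r s : 'I_3) : (o r == o s) = (r == s).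
Proof. by rewrite -!(inj_eq val_inj). Qed.

Lemma nxt_inj i j : (i.+1 < k)%N -> (j.+1 < k)%N -> (nxt i == nxt j) = (i == j).
Proof. by move=> ik jk; rewrite -!(inj_eq val_inj) /= !val_nxt. Qed.

Lemma delta_unit_hook3 a b p q l z :
  delta (delta_mx a b : 'M[R]_k) (hook3 p q l z) - hook3 p q l (delta (delta_mx a b) z) =
  (p == a)%:R *: hook3 b q l z + (q == a)%:R *: hook3 p b l z
  + (l == a)%:R *: hook3 p q b z.
Proof. by rewrite delta_hook3 !sum_delta_mx. Qed.

Lemma unit_Contr0 a b p q l :
  (forall z : fgca R (fun _ : 'I_k => 1%N),
    (p == a)%:R *: hook3 b q l z + (q == a)%:R *: hook3 p b l z
    + (l == a)%:R *: hook3 p q b z = 0) ->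
  lie (Levi (delta_mx a b : 'M[R]_k) 0) (Contr R p q l) = 0.
Proof.
move=> E; rewrite (@lie_Levi_eigen _ _ _ _ _ _ _ 0) ?scale0r// => z.
by rewrite delta_unit_hook3 E addr0 scale0r.
Qed.

Lemma rel_ef0 i j : i != j -> lie (e i) (f j) = 0.
Proof.
move=> ij; have [jk|jk] := ord_lastVlt j; first by rewrite f_last// lie0r.
rewrite f_lt//; have [ik|ik] := ord_lastVlt i.
  rewrite e_last// lieC unit_Contr0 ?oppr0// => z.
  rewrite -!(inj_eq val_inj) /= val_nxt//=.
  (* [f j] replaces the contraction index [j + 1] by [j]: for [j] equal to 0 or 1 an index is
     repeated, and for larger [j] there is nothing to replace. *)
  case jE: (nat_of_ord j) => [|[|m]]; rewrite /= ?scale0r ?addr0 ?add0r//.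
    have -> : j = o 0 by apply: val_inj; exact: jE.
    by rewrite scale1r hook3_rep1.
  have -> : j = o 1 by apply: val_inj; exact: jE.
  by rewrite scale1r hook3_rep2.
rewrite e_lt// unit_comm nxt_inj// (negbTE ij) eq_sym (negbTE ij) !scale0r subrr.
exact: Levi0.
Qed.

Lemma e_two i : (i.+1 < k)%N -> i = 2 :> nat ->
  lie (e i) (Contr R (o 0) (o 1) (o 2)) = Contr R (o 0) (o 1) (nxt i).
Proof.
move=> ik i2; rewrite e_lt//; apply: lie_Levi_Contr => z.
by rewrite delta_unit_hook3 -!(inj_eq val_inj) /= i2 /= !scale0r !add0r scale1r.
Qed.

(** [e i] replaces the contraction index [i] by [i + 1]. For [i] equal to 0 or 1 an index is then
    repeated, and for [i > 2] none is affected. *)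
Lemma e_Contr0 i : (i.+1 < k)%N -> i != 2 :> nat ->
  lie (e i) (Contr R (o 0) (o 1) (o 2)) = 0.
Proof.
move=> ik i2; rewrite e_lt//; apply: unit_Contr0 => z.
rewrite -!(inj_eq val_inj) /=.
case iE: (nat_of_ord i) i2 => [|[|[|m]]] // _; rewrite /= ?scale0r ?addr0 ?add0r ?scale1r//.
- have -> : nxt i = o 1 by apply: val_inj; rewrite /= val_nxt// iE.
  exact: hook3_rep1.
- have -> : nxt i = o 2 by apply: val_inj; rewrite /= val_nxt// iE.
  exact: hook3_rep2.
Qed.

Lemma unit_serre1 a b p q : q != a -> b != p ->
  lie (Levi (delta_mx a b : 'M[R]_k) 0) (Levi (delta_mx p q) 0) = 0.
Proof.
by move=> /negbTE qa /negbTE bp; rewrite unit_comm qa bp !scale0r subrr Levi0.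
Qed.

(** The square of the adjoint action of an off-diagonal matrix unit is nonzero on a matrix unit only
    if the latter is its transpose. *)
Lemma unit_serre2 a b p q : a != b -> ~~ ((q == a) && (b == p)) ->
  lie (Levi (delta_mx a b : 'M[R]_k) 0)
    (lie (Levi (delta_mx a b) 0) (Levi (delta_mx p q) 0)) = 0.
Proof.
move=> /negbTE ab /negbTE qabp; rewrite unit_comm lie_Levi -Levi0; congr Levi.
rewrite mulmxBl mulmxBr -!scalemxAl -!scalemxAr !mul_delta_mx_cond [b == a]eq_sym ab.
move: qabp; case: (q == a); case: (b == p) => //= _;
  by rewrite ?mulr0n ?scale0r ?scaler0 ?subrr.
Qed.

Lemma cartan0_lt i j : i != j -> (i.+1 < k)%N -> (j.+1 < k)%N -> cartan R i j = 0 ->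
  nxt j != i /\ nxt i != j.
Proof.
move=> ij ik jk; rewrite (cartanE R k3 ij) (ltn_eqF ik) (ltn_eqF jk).
rewrite -!(inj_eq val_inj) /= !val_nxt// [j.+1 == i]eq_sym [i.+1 == j]eq_sym.
by case: eqP => _; case: eqP => _ //= c0; exfalso; move: c0; rewrite ?oppr0 /=; lra.
Qed.

Lemma rel_serre_e i j n : i != j -> n%:R = 1 - cartan R i j ->
  iter n (lie (e i)) (e j) = 0.
Proof.
move=> ij nc; have cE := cartanE R k3 ij.
have [ik|ik] := ord_lastVlt i; have [jk|jk] := ord_lastVlt j.
- by case/eqP: ij; apply: val_inj; apply: succn_inj; exact: etrans ik (esym jk).
- case: (serre_exponent k3 ij nc) => -[-> c0 _];
    [change (lie (e i) (e j) = 0) | change (lie (e i) (lie (e i) (e j)) = 0)]; rewrite (e_last ik).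
    rewrite lieC e_Contr0 ?oppr0//; move: c0; rewrite cE ik eqxx.
    by case: eqP => // _ /eqP; rewrite oppr_eq0 oner_eq0.
  rewrite [lie _ (e j)]lieC e_two//; last first.
    move: c0; rewrite cE ik eqxx; case: eqP => // _ /eqP.
    by rewrite oppr0 eq_sym oppr_eq0 oner_eq0.
  (* The two contractions share the indices 0 and 1. *)
  by rewrite lieNr lie_Contr ?oppr0// !inE eqxx ?orbT.
- have ik' : (i.+1 == k) = false by rewrite ltn_eqF.
  case: (serre_exponent k3 ij nc) => -[-> c0 _];
    [change (lie (e i) (e j) = 0) | change (lie (e i) (lie (e i) (e j)) = 0)]; rewrite (e_last jk).
    rewrite e_Contr0//; move: c0; rewrite cE ik' jk eqxx.
    by case: eqP => // _ /eqP; rewrite oppr_eq0 oner_eq0.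
  have i2 : i = 2 :> nat.
    move: c0; rewrite cE ik' jk eqxx; case: eqP => // _ /eqP.
    by rewrite oppr0 eq_sym oppr_eq0 oner_eq0.
  (* After one bracket the indices are 0, 1 and 3, so [e i] with [i = 2] finds nothing to
     replace. *)
  rewrite e_two// e_lt//; apply: unit_Contr0 => z.
  by rewrite -!(inj_eq val_inj) /= val_nxt// i2 /= !scale0r !addr0.
- have ik' : (i.+1 == k) = false by rewrite ltn_eqF.
  have jk' : (j.+1 == k) = false by rewrite ltn_eqF.
  have ni : i != nxt i by rewrite -(inj_eq val_inj) /= val_nxt// neq_ltn ltnSn.
  case: (serre_exponent k3 ij nc) => -[-> c0 _];
    [change (lie (e i) (e j) = 0) | change (lie (e i) (lie (e i) (e j)) = 0)].
    have [ji ij'] := cartan0_lt ij ik jk c0.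
    by rewrite !e_lt// unit_serre1// eq_sym.
  rewrite !e_lt// unit_serre2// -!(inj_eq val_inj) /= !val_nxt//.
  by apply/andP => -[/eqP h1 /eqP h2]; lia.
Qed.

Lemma rel_serre_f i j n : i != j -> n%:R = 1 - cartan R i j ->
  iter n (lie (f i)) (f j) = 0.
Proof.
move=> ij nc; have iter0 m : iter m (lie (f i)) 0 = 0 by elim: m => //= m ->; rewrite lie0r.
have [jk|jk] := ord_lastVlt j; first by rewrite (f_last jk) iter0.
have [ik|ik] := ord_lastVlt i.
  by case: (serre_exponent k3 ij nc) => -[-> _ _]; rewrite !iterS (f_last ik) lie0l.
have ni : nxt i != i by rewrite -(inj_eq val_inj) /= val_nxt// neq_ltn ltnSn orbT.
case: (serre_exponent k3 ij nc) => -[-> c0 _];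
  [change (lie (f i) (f j) = 0) | change (lie (f i) (lie (f i) (f j)) = 0)].
  have [ji ij'] := cartan0_lt ij ik jk c0.
  by rewrite !f_lt// unit_serre1// eq_sym.
rewrite !f_lt// unit_serre2// -!(inj_eq val_inj) /= !val_nxt//.
by apply/andP => -[/eqP h1 /eqP h2]; lia.
Qed.

Lemma pk_family_model : pk_family model_gen.
Proof.
split=> [i ik|t u]; first exact: f_last.
case=> {t u}.
- by move=> c x y _; exact: rel_hlinear.
- by move=> x y _; exact: rel_hh.
- by move=> x i _; exact: rel_he.
- by move=> x i _; exact: rel_hf.
- move=> i ni; have [ik|ik] := ord_lastVlt i; last exact: rel_ef.
  by case: (ni i ik).
- by move=> i j ij _; exact: rel_ef0.
- by move=> i j n ij nc _; rewrite leval_iter; exact: rel_serre_e.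
- by move=> i j n ij nc _; rewrite leval_iter; exact: rel_serre_f.
Qed.

End Relations.

(** * The formulas of the action *)

Section LinearDerivations.
Variables (R : realType) (k : nat).
Local Notation M := (tmodel R k).
Local Notation V := (tspace R k).
Local Notation incl := (@tspace_incl R k).
Local Notation w := (w_gen R).
Implicit Types (D E : M -> M) (u v : V).

Lemma tspace_incl_linear : linear incl.
Proof.
move=> c u v; rewrite /tspace_incl scaler_sumr -big_split; apply: eq_bigr => z _ /=.
by rewrite !ffunE scalerDl scalerA.
Qed.

HB.instance Definition _ := GRing.isLinear.Build R V M _ incl tspace_incl_linear.

Definition in_tspace (a : M) : Prop := exists v, a = incl v.

Lemma in_tspaceD a b : in_tspace a -> in_tspace b -> in_tspace (a + b).
Proof. by move=> [u ->] [v ->]; exists (u + v); rewrite linearD. Qed.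

Lemma in_tspaceZ c a : in_tspace a -> in_tspace (c *: a).
Proof. by move=> [u ->]; exists (c *: u); rewrite linearZ. Qed.

Lemma in_tspace0 : in_tspace 0.
Proof. by exists 0; rewrite linear0. Qed.

Lemma in_tspace_var z : in_tspace (tvar R z).
Proof.
exists [ffun y => (y == z)%:R]; rewrite /tspace_incl (bigD1 z)//= ffunE eqxx scale1r.
by rewrite big1 ?addr0// => y /negbTE yz; rewrite ffunE yz scale0r.
Qed.

Lemma in_tspace_w i : in_tspace (w i).
Proof. exact: in_tspace_var. Qed.

Lemma in_tspace_act4 x : in_tspace (act x (g4 R k)).
Proof.
elim/Lam_enum_ind: x => [x y Ix Iy|c x Ix|I].
- by rewrite actD; exact: in_tspaceD.
- by rewrite actZ; exact: in_tspaceZ.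
- by rewrite -sg4_act /sg4; case: insubP => [z _ _|_]; [exact: in_tspace_var | exact: in_tspace0].
Qed.

Lemma in_tspace_act7 x : in_tspace (act x (g7 R k)).
Proof.
elim/Lam_enum_ind: x => [x y Ix Iy|c x Ix|I].
- by rewrite actD; exact: in_tspaceD.
- by rewrite actZ; exact: in_tspaceZ.
- by rewrite -sg7_act /sg7; case: insubP => [z _ _|_]; [exact: in_tspace_var | exact: in_tspace0].
Qed.

Lemma in_tspace_sum (I : Type) (r : seq I) (F : I -> M) :
  (forall i, in_tspace (F i)) -> in_tspace (\sum_(i <- r) F i).
Proof.
by move=> hF; elim/big_ind: _ => [|a b|i _];
  [exact: in_tspace0 | exact: in_tspaceD | exact: hF].
Qed.

Section MatrixMap.
Variable C : tgen k -> V.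

Definition matrix_map (v : V) : V := \sum_z (v z : R) *: C z.

Lemma matrix_map_linear : linear matrix_map.
Proof.
move=> c u v; rewrite /matrix_map scaler_sumr -big_split; apply: eq_bigr => z _ /=.
by rewrite !ffunE scalerDl scalerA.
Qed.

HB.instance Definition _ := GRing.isLinear.Build R V V _ matrix_map matrix_map_linear.

End MatrixMap.

(** Coordinates of the images of the generators are chosen and assembled into a linear map. *)
Lemma linear_derivation_gen D : gderivation 0 D ->
  (forall x, in_tspace (D (act x (g4 R k)))) ->
  (forall x, in_tspace (D (act x (g7 R k)))) ->
  (forall i, in_tspace (D (w i))) -> linear_derivation D.
Proof.
move=> gD D4 D7 Dw; have H z : in_tspace (D (tvar R z)).
  apply: (@tgen_ind R k (fun a => in_tspace (D a))) => [I|J|i]; last exact: Dw.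
  - by rewrite sg4_act.
  - by rewrite sg7_act.
have [C CE] := choice H; exists (matrix_map C) => v.
rewrite {1}/tspace_incl (gder_sum gD) /= linear_sum; apply: eq_bigr => z _.
by rewrite (gderZ gD) CE linearZ.
Qed.

Lemma linear_derivation0 : linear_derivation (0 : tder R k).
Proof. by exists (\0 : V -> V) => v; rewrite linear0. Qed.

Lemma linear_derivation_comb c (D E : tder R k) :
  linear_derivation D -> linear_derivation E -> linear_derivation (c *: D + E).
Proof.
move=> [L LE] [L' LE']; exists (c \*: L \+ L') => v.
by rewrite tder_linearE LE LE' /= linearD linearZ.
Qed.

Lemma linear_derivation_lie (D E : tder R k) :
  linear_derivation D -> linear_derivation E -> linear_derivation (lie D E : tder R k).
Proof.
move=> [L LE] [L' LE']; exists ((L \o L') \- (L' \o L)) => v.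
by rewrite lie_tderE LE LE' LE LE' /= linearB.
Qed.

Lemma linear_Levi A c : linear_derivation (@Levi R k A c).
Proof.
apply: linear_derivation_gen; first exact: levi_gder.
- by move=> x; rewrite /= levi_act_g4; exact: in_tspace_act4.
- by move=> x; rewrite /= levi_act_g7; exact: in_tspace_act7.
- by move=> i; rewrite /= levi_w; apply: in_tspace_sum => l; exact/in_tspaceZ/in_tspace_w.
Qed.

Lemma linear_Contr p q l : linear_derivation (@Contr R k p q l).
Proof.
have h3 := lowers3_hook3 R p q l.
apply: linear_derivation_gen; first exact: contr_gder.
- move=> x; rewrite /= contr_act_g4//; apply: in_tspace_sum => i.
  exact/in_tspaceZ/in_tspace_w.
- by move=> x; rewrite /= contr_act_g7//; exact: in_tspace_act4.
- by move=> i; rewrite /= contr_w//; exact: in_tspace0.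
Qed.

End LinearDerivations.

(** * Values on generators and determination by them *)

Section Formulas.
Variables (R : realType) (k : nat) (k3 : (3 <= k)%N).
Local Notation M := (tmodel R k).
Local Notation Lam := (fgca R (fun _ : 'I_k => 1%N)).
Local Notation g4 := (g4 R k).
Local Notation g7 := (g7 R k).
Local Notation w := (w_gen R).
Local Notation xi := (@xi R k).
Local Notation s := (@s_op R k).
Local Notation o := (i3 k3).
Local Notation Ek := (Contr R (o 0) (o 1) (o 2)).
Implicit Types (a b : M) (i j l : 'I_k) (x y : Lam).

Lemma act_xi1 i a : act (xi i) a = s i a.
Proof. by rewrite -[xi i]mulr1 act_xi act1. Qed.

Lemma homog_xi i : homog 1 (xi i).
Proof. exact: (homog_gen R (fun _ : 'I_k => 1%N)). Qed.

Section TripleContractionValues.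
Variables p q r : 'I_k.
Let D : tder R k := Contr R p q r.
Let h3 := lowers3_hook3 R p q r.

Lemma Contr_act_g4_0 n x : homog n x -> n != 2 -> D (act x g4) = 0.
Proof.
move=> hx n2; rewrite [LHS]contr_act_g4// big1// => l _.
rewrite (@homog_aug _ _ _ (1 + n - 3)) ?scale0r//; last by apply: contra_neq n2; lia.
by apply: (h3.2); apply: homogM => //; exact: homog_xi.
Qed.

Lemma Contr_act_g7_0 n x : homog n x -> n < 3 -> D (act x g7) = 0.
Proof.
move=> hx n3; rewrite [LHS]contr_act_g7//.
by rewrite (homog_lt0 (h3.2 _ _ hx)) ?act0//; lia.
Qed.

Lemma Contr_s i a : i \notin [:: p; q; r] -> D (s i a) - s i (D a) = 0.
Proof.
move=> ni; have hM x : hook3 p q r (xi i * x) = xi i * hook3 p q r x.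
  move: ni; rewrite hook3M !inE !negb_or => /and3P[/negbTE -> /negbTE -> /negbTE ->].
  by rewrite !scale0r !subr0 addr0.
move: a; have gC := contr_gder h3.
apply: (act_gder_eq0 (gder_comm0 gC (s_gderivation R i))).
- move=> x; rewrite -act_xi /= !contr_act_g4// (gder_sum (s_gderivation R i)).
  rewrite !big1 ?subrr// => l _; first by rewrite sZ s_w scaler0.
  rewrite [xi l * _]mulrA xiC mulNr -mulrA -scaleN1r (lowers3Z h3) hM aug_scale augM.
  by rewrite aug_gen mul0r mulr0 scale0r.
- by move=> x; rewrite -act_xi /= !contr_act_g7// hM act_xi subrr.
- by move=> j; rewrite s_w /= contr_w// (gder0 gC) s0 subrr.
Qed.

Lemma Contr_ss i j : D (s i (s j g4)) =
   ((i == q)%:R * (j == p)%:R - (j == q)%:R * (i == p)%:R) *: - w r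
 + ((i == r)%:R * (j == p)%:R - (j == r)%:R * (i == p)%:R) *: w q
 + ((i == r)%:R * (j == q)%:R - (j == r)%:R * (i == q)%:R) *: - w p.
Proof.
rewrite -(act_xi1 j) -act_xi [LHS]contr_act_g4//.
have hx m n : hook m (xi n) = (n == m)%:R *: 1.
  by rewrite -[xi n]mulr1 hookM hook1 mulr0 subr0.
have tE : tau (xi i * xi j) = xi i * xi j.
  by rewrite -[xi j]mulr1 !tauM tau1 mulrN opprK.
have T m n : aug (hook m (hook n (tau (xi i * xi j)))) =
    (i == n)%:R * (j == m)%:R - (j == n)%:R * (i == m)%:R.
  rewrite tE hookM hx -scalerAr mulr1 hookD hookN !hookZ !hx.
  by rewrite aug_add aug_opp !aug_scale aug1 !mulr1.
have pick n c : \sum_l ((l == n)%:R * c) *: w l = c *: w n.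
  rewrite (bigD1 n)//= eqxx mul1r big1 ?addr0// => l /negbTE ->.
  by rewrite mul0r scale0r.
under eq_bigr do rewrite hook3M !(aug_add, aug_opp, aug_scale, augM) aug_gen mul0r add0r
  !T !scalerDl !scaleNr.
by rewrite !big_split /= !sumrN !pick !scalerN.
Qed.

End TripleContractionValues.

Lemma Ek_sss : Ek (s (o 0) (s (o 1) (s (o 2) g7))) = g4.
Proof.
rewrite -(act_xi1 (o 2)) -!act_xi [LHS]contr_act_g7; last exact: lowers3_hook3.
have -> : hook3 (o 0) (o 1) (o 2) (xi (o 0) * (xi (o 1) * xi (o 2))) = 1 :> Lam.
  (* Parity gives -1 in degree 3, and so do the contractions, which are taken in the order 2, 1, 0;
     hence the value 1. *)
  have tE : tau (xi (o 0) * (xi (o 1) * xi (o 2))) = - (xi (o 0) * (xi (o 1) * xi (o 2))).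
    by rewrite -[xi (o 2)]mulr1 !tauM tau1 !mulrN !opprK.
  rewrite /hook3 tE -[xi (o 2)]mulr1 !(hookN, hookM, hookD, hookZ, o_inj, hook1) /=.
  have h0 m : hook m (0 : Lam) = 0 by exact: gder0 (hook_gder R m).
  by rewrite !(h0, scale0r, scale1r, scaler0, mulr0, subr0, sub0r, opprK, oppr0, addr0).
exact: act1.
Qed.

(** A normal form for the six permutations in which sign and values can be computed. *)
Lemma perm3_decomp (sigma : 'S_3) :
  exists (b : bool) (m : 'I_3),
    sigma = ((if b then tperm 1%R 2%R else (1 : {perm _})) * tperm 0%R m)%g.
Proof.
pose m := sigma 0; pose sigma' := (sigma * tperm 0%R m)%g.
have s0 : sigma' 0 = 0 by rewrite permM tpermR.
have sE : sigma = (sigma' * tperm 0%R m)%g by rewrite -mulgA tperm2 mulg1.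
have ord3 (i : 'I_3) : [\/ i = 0, i = 1 | i = 2].
  by case: i => [[|[|[|//]]] lti]; [constructor 1|constructor 2|constructor 3]; apply: val_inj.
have inj0 (i : 'I_3) : sigma' i = 0 -> i = 0 by rewrite -{1}s0 => /perm_inj.
have [/inj0 //|s1|s1] := ord3 (sigma' 1); have [/inj0 //|s2|s2] := ord3 (sigma' 2).
- by have /perm_inj := etrans s1 (esym s2).
- exists false, m; rewrite {1}sE; congr (_ * _)%g; apply/permP => i.
  by case: (ord3 i) => ->; rewrite perm1.
- exists true, m; rewrite {1}sE; congr (_ * _)%g; apply/permP => i.
  by case: (ord3 i) => ->; rewrite ?tpermL ?tpermR ?tpermD.
- by have /perm_inj := etrans s1 (esym s2).
Qed.

Lemma Ek_formulas : ek_formulas k3 Ek.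
Proof.
have hx i : homog 1 (xi i) by exact: homog_xi.
have h2 i j : homog 2 (xi i * xi j) by apply: (homogM (m := 1) (n := 1)).
split; split.
- by split; [rewrite -[g4]act1 (Contr_act_g4_0 _ _ _ (@homog1 _ _ _))
           | rewrite -[g7]act1 (Contr_act_g7_0 _ _ _ (@homog1 _ _ _))].
- move=> i; rewrite -!(act_xi1 (o i)); split.
    exact: Contr_act_g4_0 (hx _) _.
  exact: Contr_act_g7_0 (hx _) _.
- by move=> i j; rewrite -(act_xi1 (o j)) -act_xi; exact: Contr_act_g7_0 (h2 _ _) _.
- rewrite -(act_xi1 (o 2)) -!act_xi.
  by apply: (@Contr_act_g4_0 _ _ _ 3); first apply: (homogM (m := 1) (n := 2)).
- by move=> i; rewrite [LHS]contr_w//; exact: lowers3_hook3.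
- move=> sigma; rewrite Contr_ss !o_inj.
  have [b [m ->]] := perm3_decomp sigma; rewrite odd_permM !permM odd_tperm.
  case: b; rewrite ?odd_tperm ?odd_perm1 ?perm1; case: m => [[|[|[|//]]] lti];
    rewrite !permE /= ?expr0 ?expr1 !(mulr0, mulr1, subr0, sub0r, scale0r, scaleN1r, scale1r,
      opprK, add0r, addr0, oppr0); rewrite ?scaleN1r ?scale1r ?opprK//.

- exact: Ek_sss.
- move=> i i3 a; apply: Contr_s.
  by rewrite !inE -!(inj_eq val_inj) /=; case: (nat_of_ord i) i3 => [|[|[|m]]].
Qed.

Lemma h_formulas_model (x : 'rV[R]_k.+1) : h_formulas x (model_h x).
Proof.
split.
- exact: levi_g4.
- by rewrite [LHS]levi_g7 mulrN.
- move=> i a; rewrite [LHS]levi_s (bigD1 i)//= !mxE eqxx mulr1n opprK big1 ?addr0//.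
  by move=> j /negbTE ji; rewrite !mxE ji mulr0n oppr0 scale0r.
- move=> i; rewrite [LHS]levi_w (bigD1 i)//= !mxE eqxx mulr1n big1 ?addr0//.
  by move=> j /negbTE ji; rewrite !mxE eq_sym ji mulr0n scale0r.
Qed.

Lemma unit_formulas p q :
  [/\ Levi (delta_mx p q) 0 g4 = 0, Levi (delta_mx p q) 0 g7 = 0,
      forall j, Levi (delta_mx p q) 0 (w j) = (p == j)%:R *: w q &
      forall j a, commutator (Levi (delta_mx p q) 0) (s j) a = - ((q == j)%:R *: s p a)].
Proof.
split.
- by rewrite [LHS]levi_g4 scale0r.
- by rewrite [LHS]levi_g7 mulr0 scale0r.
- by move=> j; rewrite [LHS]levi_w sum_delta_mx eq_sym.
- move=> j a; rewrite [LHS]levi_s (bigD1 p)//= mxE eqxx big1 => [|i /negbTE ip].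
    by rewrite addr0 scaleNr eq_sym.
  by rewrite mxE ip oppr0 scale0r.
Qed.

Section Determination.
Variables D E : tder R k.

Lemma tder_ext : (forall x, D (act x g4) = E (act x g4)) ->
  (forall x, D (act x g7) = E (act x g7)) -> (forall i, D (w i) = E (w i)) -> D = E.
Proof.
by move=> e4 e7 ew; apply: tder_eq; apply: (act_gder_ext (tder_gder D) (tder_gder E)).
Qed.

(** The model is generated by the [w_i] and the images of [g4] and [g7] under the exterior algebra,
    through which the commutators carry the equality. *)
Lemma tder_determined : D g4 = E g4 -> D g7 = E g7 -> (forall i, D (w i) = E (w i)) ->
  (forall j a, commutator D (s j) a = commutator E (s j) a) -> D = E.
Proof.
move=> e4 e7 ew es.
have ind a : D a = E a -> forall x, D (act x a) = E (act x a).
  move=> ea; elim/Lam_ind => [x y Ix Iy|c x Ix||i x Ix].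
  - by rewrite actD !(gderD (tder_gder _)) Ix Iy.
  - by rewrite actZ !(gderZ (tder_gder _)) Ix.
  - by rewrite !act1.
  - by have := es i (act x a); rewrite /commutator act_xi Ix => /addIr.
by apply: tder_ext => //; apply: ind.
Qed.

Lemma ssign_sq i (I : {set 'I_k}) : ssign R i I * ssign R i I = 1.
Proof. by rewrite /ssign -expr2 sqrr_sign. Qed.

Lemma sg4U1 i (I : {set 'I_k}) : i \notin I -> sg4 R (i |: I) = ssign R i I *: s i (sg4 R I).
Proof. by move=> /negbTE iI; rewrite s_sg4 iI scalerA ssign_sq scale1r. Qed.

Lemma sg7U1 i (I : {set 'I_k}) : i \notin I -> sg7 R (i |: I) = ssign R i I *: s i (sg7 R I).
Proof. by move=> /negbTE iI; rewrite s_sg7 iI scalerA ssign_sq scale1r. Qed.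

Lemma perm3_ex (m n : 'I_3) : m != n -> exists sigma : 'S_3, sigma 0 = m /\ sigma 1 = n.
Proof.
move=> mn; exists (tperm 0%R m * tperm (tperm 0%R m 1%R) n)%g; rewrite !permM tpermL; split.
  apply: tpermD; last by rewrite eq_sym.
  by apply/eqP => h; have /perm_inj := etrans h (esym (tpermL 0 m)).
by rewrite tpermL.
Qed.

Lemma ek_determined : ek_formulas k3 D -> ek_formulas k3 E -> D = E.
Proof.
have gD := tder_gder D; have gE := tder_gder E.
case=> -[[D4 D7] Ds Dss Dsss] [Dw Dsig Dsss7 Dc].
case=> -[[E4 E7] Es Ess Esss] [Ew Esig Esss7 Ec].
have eqZ c a : D a = E a -> D (c *: a) = E (c *: a) by rewrite (gderZ gD) (gderZ gE) => ->.
have key n (I : {set 'I_k}) : #|I| = n ->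
    D (sg4 R I) = E (sg4 R I) /\ D (sg7 R I) = E (sg7 R I).
  elim: n I => [|n IH] I In.
    by rewrite (cards0_eq In) D4 E4 D7 E7.
  (* An index beyond the first three is removed by the commutation rule. Otherwise [I] is a subset
     of the first three indices, and the explicit formulas settle each size. *)
  have [[i iI i3]|small] := pselect (exists2 i, i \in I & (3 <= i)%N).
    have iD : i \notin I :\ i by rewrite !inE eqxx.
    have [|e4 e7] := IH (I :\ i).
      by move: In; rewrite (cardsD1 i) iI add1n => -[].
    rewrite -(setD1K iI) sg4U1// sg7U1//; split; apply: eqZ.
      have /eqP := Dc i i3 (sg4 R (I :\ i)); have /eqP := Ec i i3 (sg4 R (I :\ i)).
      by rewrite !subr_eq0 => /eqP -> /eqP ->; rewrite e4.
    have /eqP := Dc i i3 (sg7 R (I :\ i)); have /eqP := Ec i i3 (sg7 R (I :\ i)).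
    by rewrite !subr_eq0 => /eqP -> /eqP ->; rewrite e7.
  have oI i : i \in I -> exists m, i = o m.
    move=> iI; have i3 : (i < 3)%N by rewrite ltnNge; apply/negP => ?; apply: small; exists i.
    by exists (Ordinal i3); apply: val_inj.
  have IU : I \subset (o 0 |: [set o 1; o 2]).
    apply/subsetP => i /oI[m ->]; rewrite !inE !o_inj.
    by case: m => [[|[|[|//]]] lti].
  have U3 : #|(o 0 |: [set o 1; o 2])| = 3%N.
    by rewrite cardsU1 cards2 !inE !o_inj.
  have n3 : (n < 3)%N by rewrite -In -U3 subset_leq_card.
  case: n n3 In {IH} => [|[|[|//]]] _ In.
  - move/eqP: In => /cards1P[i Ii]; have [|m im] := oI i; first by rewrite Ii set11.
    rewrite Ii -[[set i]]setU0 sg4U1 ?inE// sg7U1 ?inE// im.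
    have [d4 d7] := Ds m; have [f4 f7] := Es m.
    by split; apply: eqZ; [rewrite d4 f4 | rewrite d7 f7].
  - move/eqP: In => /cards2P[i [j [ij Iij]]].
    have [|m im] := oI i; first by rewrite Iij !inE eqxx.
    have [|m' jm] := oI j; first by rewrite Iij !inE eqxx orbT.
    have [sigma [s0 s1]] : exists sigma : 'S_3, sigma 0 = m /\ sigma 1 = m'.
      by apply: perm3_ex; move: ij; rewrite im jm o_inj.
    have -> : I = i |: (j |: set0) by rewrite setU0 Iij.
    have iJ : i \notin j |: set0 by rewrite !inE orbF.
    rewrite (sg4U1 iJ) (sg7U1 iJ) sg4U1 ?inE// sg7U1 ?inE// !sZ im jm; split; do 2 apply: (eqZ).
      by rewrite -s0 -s1 Dsig Esig.
    by rewrite Dss Ess.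
  - have -> : I = o 0 |: (o 1 |: (o 2 |: set0)).
      by apply/eqP; rewrite setU0 eqEcard IU In U3.
    rewrite !sg4U1 ?inE ?o_inj// !sg7U1 ?inE ?o_inj// !sZ; split; do 3 apply: (eqZ).
      by rewrite Dsss Esss.
    by rewrite Dsss7 Esss7.
apply: tder_eq; apply: (gder_ext gD gE).
apply: (@tgen_ind R k (fun a => D a = E a)) => [I|J|i].
- exact: (key _ _ erefl).1.
- exact: (key _ _ erefl).2.
- by rewrite Dw Ew.
Qed.

End Determination.

End Formulas.

(** * The model as a faithful representation of its derivations *)

Section LinearOperatorOfDerivation.
Variables (R : realType) (k : nat).

Lemma tder_linop (D : tder R k) : (D : tmodel R k -> tmodel R k) \in @linop_pred R _.
Proof. by apply/asboolP; case: (tder_gder D). Qed.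

Definition linop_of_tder (D : tder R k) : linop (tmodel R k) := LinOp (tder_linop D).

Lemma linop_of_tder_morph : lie_morphism linop_of_tder.
Proof. by split=> [c D E|D E]; apply: linop_eq. Qed.

Lemma linop_of_tder_inj : injective linop_of_tder.
Proof. by move=> D E DE; apply: tder_eq => a; rewrite -[D a]/(linop_of_tder D a) DE. Qed.

End LinearOperatorOfDerivation.

Theorem theorem4p6 (R : realType) (k : nat) (k3 : (3 <= k)%N) :
  exists phi : pk R k -> tder R k,
    [/\ lie_morphism phi,
        forall x : pk R k, linear_derivation (phi x),
        action_formulas k3 phi &
        forall psi : pk R k -> tder R k,
          lie_morphism psi -> action_formulas k3 psi -> psi = phi].
Proof.
have [phi [phiL phih phie phif]] :=
  pk_morphism k3 (@linop_of_tder_morph R k) (@linop_of_tder_inj R k) (pk_family_model R k3).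
have phi_formulas : action_formulas k3 phi.
  split=> [i ik|x|i ik|i ik].
  - by rewrite phie e_last//; exact: Ek_formulas.
  - by rewrite phih; exact: h_formulas_model.
  - by rewrite phie e_lt// (ord_succ_nxt ik); exact: unit_formulas.
  - by rewrite phif f_lt// (ord_succ_nxt ik); exact: unit_formulas.
exists phi; split=> //.
  (* Linear derivations form a Lie subalgebra, so only the generators have to be inspected. *)
  apply: pk_ind.
  - have -> : phi 0 = 0.
      by apply: (addIr (phi 0)); rewrite add0r -[X in X + _]scale1r -phiL.1 scaler0 addr0.
    exact: linear_derivation0.
  - by move=> c x y hx hy; rewrite phiL.1; exact: linear_derivation_comb.
  - by move=> x y hx hy; rewrite phiL.2; exact: linear_derivation_lie.
  - by move=> x; rewrite phih; exact: linear_Levi.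
  - move=> i; rewrite phie; have [ik|ik] := ord_lastVlt i.
      by rewrite e_last//; exact: linear_Contr.
    by rewrite e_lt//; exact: linear_Levi.
  - by move=> i ik; rewrite phif f_lt//; exact: linear_Levi.
move=> psi psiL psi_formulas.
have [pe ph pei pf] := phi_formulas; have [qe qh qei qf] := psi_formulas.
apply: pk_morph_eq => //.
- move=> x; have [p4 p7 ps pw] := ph x; have [q4 q7 qs qw] := qh x.
  apply: tder_determined; first by rewrite p4 q4.
  + by rewrite p7 q7.
  + by move=> i; rewrite pw qw.
  + by move=> i a; rewrite ps qs.
- move=> i; have [ik|ik] := ord_lastVlt i; first exact: (ek_determined (qe i ik) (pe i ik)).
  have [p4 p7 pw ps] := pei i ik; have [q4 q7 qw qs] := qei i ik.
  apply: tder_determined; first by rewrite p4 q4.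
  + by rewrite p7 q7.
  + by move=> j; rewrite pw qw.
  + by move=> j a; rewrite ps qs.
- move=> i ik; have [p4 p7 pw ps] := pf i ik; have [q4 q7 qw qs] := qf i ik.
  apply: tder_determined; first by rewrite p4 q4.
  + by rewrite p7 q7.
  + by move=> j; rewrite pw qw.
  + by move=> j a; rewrite ps qs.
Qed.
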